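(* Let $q\ge 3$. Let $\mathcal M_q$ be the space of $q\times q$ complex matrices and $\mathbf P(\mathcal M_q)$ its projectivization. Let $J(x)=(x_{i,j}^{-1})$ (entrywise reciprocal) and $I(x)=x^{-1}$ (matrix inverse), both viewed as birational involutions of $\mathbf P(\mathcal M_q)$, and let $K_q=I\circ J$. Then the dynamical degree $$\delta(K_q)=\lim_{n\to\infty}\big(\deg(K_q^n)\big)^{1/n}$$ equals the largest modulus of a root of the polynomial $\lambda^2-(q^2-4q+2)\lambda+1$.
   Context: For a rational self-map $f$ of projective space, $\deg(f)$ is the common degree of homogeneous polynomials without common factor representing $f$, and $f^n=f\circ\cdots\circ f$ ($n$ times). *)

(* Defs.v *)
From HB Require Import structures.
From mathcomp Require Import all_boot all_order all_algebra.
From mathcomp Require Import complex.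
From mathcomp Require Import mpoly.

Set Implicit Arguments.
Unset Strict Implicit.
Unset Printing Implicit Defensive.

Import Order.TTheory GRing.Theory Num.Theory.
Local Open Scope ring_scope.

Section Defs.
Variables (R : rcfType) (q : nat).

Local Notation C := (complex R).

(** Homogeneous coordinates on P(M_q): the q*q entries x_{i,j} of a
    q x q matrix; the variable x_{i,j} has index [mxvec_index i j]. *)
Definition MP := mpoly.mpoly (q * q) C.

Definition xvar (i j : 'I_q) : MP := mpoly.mpolyX C (mpoly.mnm1 (mxvec_index i j)).

(** A rational self-map of P(M_q) is given by a q x q matrix of
    polynomials in the q*q variables (its (i,j) entry is the (i,j)
    coordinate of the image). *)
Definition rep := 'M[MP]_q.

Definition Xmat : rep := \matrix_(i, j) xvar i j.

Definition subst_tuple (F : rep) : (q * q).-tuple MP :=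
  [tuple mxvec F 0 k | k < q * q].
Definition comp_rep (G F : rep) : rep :=
  map_mx (mpoly.comp_mpoly (subst_tuple F)) G.

Definition iter_rep (F : rep) (n : nat) : rep := iter n (comp_rep F) Xmat.

(** J(x) = (x_{i,j}^{-1}); multiplying by the product of all
    coordinates gives the polynomial representative. *)
Definition Jrep : rep :=
  \matrix_(i, j) \prod_(k : 'I_(q * q) | k != mxvec_index i j)
                   mpoly.mpolyX C (mpoly.mnm1 k).

(** I(x) = x^{-1} = adj(x)/det(x); projectively, the adjugate. *)
Definition Irep : rep := \adj Xmat.

Definition Krep : rep := comp_rep Irep Jrep.

(** Homogeneous of degree e (total degree; the zero polynomial counts). *)
Definition homog_of (e : nat) (p : MP) : Prop :=
  p \is mpoly.ishomog1 e mpoly.mdeg.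

(** Total-degree size (1 + degree, 0 for the zero polynomial). *)
Definition msize (p : MP) : nat := mpoly.mmeasure mpoly.mdeg p.

(** G and F define the same point of projective space over the
    function field, i.e. the same rational map. *)
Definition same_map (F G : rep) : Prop :=
  forall i j k l, F i j * G k l = F k l * G i j.

Definition reduced_rep (G : rep) (e : nat) : Prop :=
  [/\ G != 0,
      (forall i j, homog_of e (G i j)) &
      ~ (exists H : MP, (1 < msize H)%N /\
           forall i j, exists Q : MP, G i j = H * Q)].

Definition has_degree (F : rep) (e : nat) : Prop :=
  exists G : rep, reduced_rep G e /\ same_map F G.

End Defs.

Definition cmod (R : rcfType) (z : complex R) : R :=
  Num.sqrt (complex.Re z ^+ 2 + complex.Im z ^+ 2).

Definition max_root_modulus (R : rcfType) (p : {poly complex R}) (r : R) : Prop :=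
  (exists z, root p z /\ cmod z = r) /\ (forall z, root p z -> cmod z <= r).

Definition Kpoly (R : rcfType) (q : nat) : {poly complex R} :=
  'X^2 - ((q%:R ^+ 2 - 4 * q%:R + 2 : complex R) *: 'X) + 1.

(* Main.v *)
(* An irreducible form p defines an order function V(g) = vp(g) on forms. Both the Hadamard inverse J
   and the cofactor involution C act on such functions by pull-back, and the total degree of p's
   counted with V(x_ij) is 1 after any number of steps. Along its orbit the valuation of p is centred
   at a prime divisor until it meets a coordinate hyperplane x_ab = 0 (which J turns into the pole of
   x_ab, fixed by C, and J turns back into x_ab = 0) or the determinant (which C turns into the
   exceptional divisor over the rank-one matrices, fixed by J, and C turns back into the determinant).
   Hence V is known in terms of the times at which these events occur. Summing over all p, the total
   degree S_k of the primes that reach a given coordinate hyperplane at time k satisfies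
   S_(k+2) = (q^2 - 4 q + 2) S_(k+1) - S_k + q, with S_0 = 1 and S_1 = (q^2 - 4 q + 2) + q.
   The degree d_n of the n-th iterate is the sum over p of deg p * (V(x_ij) - min V), which lies between
   S_n and 1 + (2 q / (q - 2)) * (the sum over l < n of S_(l+1) + S_l - 1). For q = 3 the sequence S is
   1, 2, 0, 1, 2, 0, ...; there d_n >= 1 because d_n = 0 would force S_(n+1) = 0 as well as S_n = 0. *)

Require Import Defs.
From HB Require Import structures.
From mathcomp Require Import all_boot all_order all_algebra.
From mathcomp Require Import complex.
From mathcomp Require Import perm boolp ring lra zify.
From mathcomp Require mpoly.
Import Order.TTheory GRing.Theory Num.Theory.
Local Open Scope ring_scope.

(** Three choices shape the proof. The cofactor matrix replaces the inverse because it carries no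
    transposition: poles of entries stay in place instead of moving from [(a, b)] to [(b, a)], and
    as transposition commutes with $J$, the iterates are unchanged up to one transposition.
    Pull-backs are normalised by a multiple of the degree, which makes them involutions on
    integer-valued functions and lets blow-ups be replaced by lower bounds that turn into equalities
    when applied twice. Finally, $C$ fixes the pole of $x_{ab}$ only up to a twist by the scalings
    of row $a$ and column $b$. Twists change sign under $J$ and under $C$, so they accumulate over
    time, and the balance equations contain sums over all earlier times. The geometric core is that
    $J$ fixes the divisor over the rank-one matrices. It needs the exact order $q-1$ of $\det
    J(C(x))$ along $\det x=0$, found on a test curve, and the nonvanishing of $q$ in the field.
    Evaluating every orbit at one entry and at the determinant gives two linear relations per time,
    in the degree sums of primes reaching an entry and of primes reaching the determinant;
    eliminating the latter yields the recursion. *)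

Module Iterates.
Import mpoly.
Set Implicit Arguments.
Unset Strict Implicit.
Unset Printing Implicit Defensive.

(** * Factorial rings *)

Section Divisibility.
Variable R : idomainType.
Implicit Types a b c p u : R.

Definition dvd a b := exists c, b = a * c.

Definition prime_elt p :=
  [/\ p != 0, p \isn't a GRing.unit
    & forall a b, dvd p (a * b) -> dvd p a \/ dvd p b].

Definition factored a := exists u s,
  [/\ u \is a GRing.unit, {in s, forall p, prime_elt p} & a = u * \prod_(p <- s) p].

Lemma dvd_refl a : dvd a a.
Proof. by exists 1; rewrite mulr1. Qed.

Lemma dvd_mulr a b c : dvd a b -> dvd a (b * c).
Proof. by case=> d ->; exists (d * c); rewrite mulrA. Qed.

Lemma dvd_mull a b c : dvd a b -> dvd a (c * b).
Proof. by rewrite mulrC; apply: dvd_mulr. Qed.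

Lemma dvd_add a b c : dvd a b -> dvd a c -> dvd a (b + c).
Proof. by case=> d -> [e ->]; exists (d + e); rewrite mulrDr. Qed.

Lemma dvd_opp a b : dvd a b -> dvd a (- b).
Proof. by case=> d ->; exists (- d); rewrite mulrN. Qed.

Lemma dvd0 a : dvd a 0.
Proof. by exists 0; rewrite mulr0. Qed.

Lemma dvd_unit p u : u \is a GRing.unit -> dvd p u -> p \is a GRing.unit.
Proof. by move=> uu [c e]; move: uu; rewrite e unitrM => /andP[]. Qed.

Lemma factored_unit u : u \is a GRing.unit -> factored u.
Proof. by move=> uu; exists u, [::]; split=> //; rewrite big_nil mulr1. Qed.

Lemma factored_prime p : prime_elt p -> factored p.
Proof.
move=> pp; exists 1, [:: p]; split; rewrite ?unitr1 //.
  by move=> x; rewrite inE => /eqP->.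
by rewrite big_seq1 mul1r.
Qed.

Lemma factoredM a b : factored a -> factored b -> factored (a * b).
Proof.
case=> u [s [uu hs ->]] [v [t [uv ht ->]]]; exists (u * v), (s ++ t); split.
- by rewrite unitrM uu.
- by move=> p; rewrite mem_cat => /orP[/hs|/ht].
- by rewrite big_cat /= mulrACA.
Qed.

Lemma prime_dvd_prod p (s : seq R) : prime_elt p ->
  dvd p (\prod_(x <- s) x) -> exists2 x, x \in s & dvd p x.
Proof.
move=> [_ nu pP]; elim: s => [|x s IHs].
  by rewrite big_nil => /(dvd_unit (unitr1 R)) pu; rewrite pu in nu.
rewrite big_cons => /pP[px|/IHs[y ys py]].
  by exists x; rewrite ?mem_head.
by exists y; rewrite // inE ys orbT.
Qed.

(** Cancelling a prime shortens the factorization; this decreasing length makes the extraction of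
    constants in [content_split] stop. *)
Lemma factor_cancel p b u (s : seq R) : prime_elt p -> u \is a GRing.unit ->
  {in s, forall p, prime_elt p} -> p * b = u * \prod_(x <- s) x ->
  exists v t, [/\ v \is a GRing.unit, {in t, forall p, prime_elt p},
                 (size t < size s)%N & b = v * \prod_(x <- t) x].
Proof.
move=> pp uu hs e; have [p0 nu pP] := pp.
have : dvd p (u * \prod_(x <- s) x) by rewrite -e; apply/dvd_mulr/dvd_refl.
case/pP=> [/(dvd_unit uu) pu|]; first by rewrite pu in nu.
case/(prime_dvd_prod pp)=> x xs [c xE].
have [x0 xnu xP] := hs _ xs.
have cu : c \is a GRing.unit.
  have : dvd x (p * c) by rewrite -xE; apply: dvd_refl.
  case/xP=> [[d pE]|[d cE]].
    apply/unitrPr; exists d; apply: (mulfI x0).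
    by rewrite mulr1 {2}xE pE; ring.
  case/negP: nu; apply/unitrPr; exists d; apply: (mulfI x0).
  by rewrite mulr1 {2}xE cE; ring.
exists (u * c), (rem x s); split.
- by rewrite unitrM uu.
- by move=> y /mem_rem/hs.
- by rewrite size_rem //; case: (s) xs.
- apply: (mulfI p0); rewrite e (perm_big _ (perm_to_rem xs)) big_cons.
  set r := \prod_(_ <- rem _ _) _; rewrite [in LHS]xE -[LHS]/(u * (p * c * r)); ring.
Qed.

End Divisibility.

Definition factorial (R : idomainType) := forall a : R, a != 0 -> factored a.

(** * Gauss's lemma and factorial polynomial rings *)

Section PolyFactorial.
Variable R : idomainType.
Hypothesis factR : factorial R.
Implicit Types (p c : R) (f g h a : {poly R}).

Lemma dvd_polyC p f : dvd p%:P f <-> forall i, dvd p f`_i.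
Proof.
split=> [[g ->] i|H]; first by rewrite coefCM; apply/dvd_mulr/dvd_refl.
have [g gP] := choice H.
exists (\poly_(i < size f) g i); apply/polyP=> i.
rewrite coefCM coef_poly; case: ltnP => [_|/leq_sizeP->//]; first exact: gP.
by rewrite mulr0.
Qed.

(** Induction on the sum of the sizes: [p] divides the product of the leading coefficients, hence
    one of them, and removing that leading term leaves a smaller pair whose product is still
    divisible by [p]. *)
Lemma prime_polyC p : prime_elt p -> prime_elt p%:P.
Proof.
move=> [p0 nu pP]; split; first by rewrite polyC_eq0.
  by rewrite poly_unitE size_polyC p0 coefC.
move=> f g; move: {2}(_ + _)%N (leqnn (size f + size g)) => n.
elim: n f g => [|n IHn] f g.
  rewrite leqn0 addn_eq0 size_poly_eq0 => /andP[/eqP-> _] _.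
  by left; apply: dvd0.
have [->|f0] := eqVneq f 0; first by left; apply: dvd0.
have [->|g0] := eqVneq g 0; first by right; apply: dvd0.
move=> szn pfg.
have lcE f' : f' = (f' - lead_coef f' *: 'X^((size f').-1)) + lead_coef f' *: 'X^((size f').-1).
  by rewrite subrK.
have szlt f' : f' != 0 -> (size (f' - lead_coef f' *: 'X^((size f').-1))%R < size f')%N.
  move=> f'0; rewrite (polySpred f'0) ltnS; apply/leq_sizeP => j hj.
  rewrite coefB coefZ coefXn; have [->|nj] := eqVneq j (size f').-1.
    by rewrite mulr1 subrr.
  rewrite mulr0 subr0; move/leq_sizeP: (leqnn (size f')); apply.
  by rewrite (polySpred f'0) ltn_neqAle eq_sym nj.
have pZ f' : dvd p (lead_coef f') -> dvd p%:P (lead_coef f' *: 'X^((size f').-1)).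
  by case=> c ->; exists (c *: 'X^((size f').-1)); rewrite mul_polyC scalerA.
have : dvd p (lead_coef f * lead_coef g).
  by rewrite -lead_coefM lead_coefE; move/dvd_polyC: pfg.
case/pP => [pf|pg].
  have /IHn : (size (f - lead_coef f *: 'X^((size f).-1))%R + size g <= n)%N.
    by rewrite -ltnS (leq_trans _ szn) // ltn_add2r szlt.
  case=> [|pf'|]; last by right.
    by rewrite mulrBl; apply/dvd_add/dvd_opp/dvd_mulr/pZ.
  by left; rewrite (lcE f); apply/dvd_add/pZ.
have /IHn : (size f + size (g - lead_coef g *: 'X^((size g).-1))%R <= n)%N.
  by rewrite -ltnS (leq_trans _ szn) // ltn_add2l szlt.
case=> [||pg']; [|by left|].
  by rewrite mulrBr; apply/dvd_add/dvd_opp/dvd_mull/pZ.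
by right; rewrite (lcE g); apply/dvd_add/pZ.
Qed.

Lemma polyC_is_unit c : c \is a GRing.unit -> c%:P \is a GRing.unit.
Proof.
move=> cu; have c0 : c != 0 by apply: contraTneq cu => ->; rewrite unitr0.
by rewrite poly_unitE size_polyC coefC eqxx cu c0.
Qed.

Lemma factored_polyC c : c != 0 -> factored c%:P.
Proof.
move/factR => [u [s [uu hs ->]]]; rewrite polyCM rmorph_prod /=.
apply: factoredM; first exact/factored_unit/polyC_is_unit.
elim: s hs => [|x s IHs] hs; first by rewrite big_nil; apply/factored_unit/unitr1.
rewrite big_cons; apply: factoredM; last first.
  by apply: IHs => y ys; apply: hs; rewrite inE ys orbT.
by apply/factored_prime/prime_polyC/hs; rewrite mem_head.
Qed.

Definition primitive a := forall p, prime_elt p -> ~ dvd p%:P a.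

Lemma mulZC c f : c *: f = c%:P * f. Proof. by rewrite mul_polyC. Qed.

Lemma prime_ind (P : R -> Prop) :
    (forall u, u \is a GRing.unit -> P u) ->
    (forall p c, prime_elt p -> c != 0 -> P c -> P (p * c)) ->
  forall c, c != 0 -> P c.
Proof.
move=> Pu Pp c /factR [u [s [uu hs ->]]].
elim: s hs => [|x s IHs] hs; first by rewrite big_nil mulr1; apply: Pu.
have hs' : {in s, forall p, prime_elt p} by move=> y ys; apply: hs; rewrite inE ys orbT.
have xp : prime_elt x by apply: hs; rewrite mem_head.
rewrite big_cons mulrCA; apply: Pp => //; last exact: IHs.
rewrite mulf_neq0 //; first by apply: contraTneq uu => ->; rewrite unitr0.
elim: (s) hs' => [|y t IHt] ht; first by rewrite big_nil oner_neq0.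
rewrite big_cons mulf_neq0 //; first by case: (ht y (mem_head _ _)).
by apply: IHt => z zt; apply: ht; rewrite inE zt orbT.
Qed.

Lemma mul_unitV c f g : c \is a GRing.unit -> c%:P * f = g -> f = c^-1%:P * g.
Proof. by move=> cu <-; rewrite mulrA -polyCM mulVr // mul1r. Qed.

(** Gauss's lemma without a fraction field: each prime factor of [c] divides [f] or [h] and is
    cancelled there, which changes no size. *)
Lemma gauss_split c : c != 0 -> forall a f h, c%:P * a = f * h ->
  exists f' h', [/\ a = f' * h', size f' = size f & size h' = size h].
Proof.
move: c; apply: prime_ind => [u uu|p c pp c0 IHc] a f h.
  move=> /(mul_unitV uu) ->; exists (u^-1%:P * f), h; split=> //; first by rewrite mulrA.
  by rewrite mul_polyC size_scale // invr_neq0 //; apply: contraTneq uu => ->; rewrite unitr0.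
rewrite polyCM -mulrA => e.
have [p0 _ pP] := prime_polyC pp; have p0' : p != 0 by rewrite -polyC_eq0.
have : dvd p%:P (f * h) by rewrite -e; apply/dvd_mulr/dvd_refl.
case/pP=> [[k kE]|[k kE]].
  have /IHc [f' [h' [-> szf szh]]] : c%:P * a = k * h.
    by apply: (mulfI p0); rewrite e kE mulrA.
  by exists f', h'; split=> //; rewrite szf kE mul_polyC size_scale.
have /IHc [f' [h' [-> szf szh]]] : c%:P * a = f * k.
  by apply: (mulfI p0); rewrite e kE mulrCA.
by exists f', h'; split=> //; rewrite szh kE mul_polyC size_scale.
Qed.

Lemma primitive_dvd a : primitive a -> forall c, c != 0 ->
  forall f, dvd a (c%:P * f) -> dvd a f.
Proof.
move=> pa; apply: prime_ind => [u uu f [h /(mul_unitV uu) ->]|p c pp c0 IHc f [h]].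
  by exists (u^-1%:P * h); rewrite mulrCA.
rewrite polyCM -mulrA => e; have [p0 _ pP] := prime_polyC pp.
have : dvd p%:P (a * h) by rewrite -e; apply/dvd_mulr/dvd_refl.
case/pP=> [/(pa _ pp)//|[k kE]].
apply: IHc; exists k; apply: (mulfI p0); rewrite e kE; ring.
Qed.

(** Over a domain, [%|] is divisibility up to a nonzero constant, that is, over the fraction field.
    There an irreducible polynomial is prime, and primitivity of [a] brings the quotient back to the
    ring. *)
Lemma prime_primitive a : primitive a -> (1 < size a)%N ->
    (forall f h, a = f * h -> (size f <= 1)%N \/ (size h <= 1)%N) ->
  prime_elt a.
Proof.
move=> pa sza irr.
have a0 : a != 0 by rewrite -size_poly_gt0 (ltn_trans _ sza).
split=> //; first by rewrite poly_unitE gtn_eqF.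
have dvdpW f : a %| f -> dvd a f.
  move=> /Pdiv.Idomain.dvdpP [[c k] /= c0 e].
  by apply: (primitive_dvd pa c0); rewrite mul_polyC e; exists k; rewrite mulrC.
have irra : irreducible_poly a.
  split=> // d szd /Pdiv.Idomain.dvdpP [[c k] /= c0 e].
  rewrite mulZC in e.
  have kd0 : k * d != 0 by rewrite -e mulf_neq0 // polyC_eq0.
  have [k0 d0] : k != 0 /\ d != 0 by move: kd0; rewrite mulf_eq0 negb_or => /andP[].
  have [k' [d' [aE szk' szd']]] := gauss_split c0 e.
  case: (irr _ _ aE) => [szk|szd1]; last first.
    by move: szd; rewrite eqn_leq -szd' szd1 szd' size_poly_gt0 d0.
  apply/eqpP; exists (lead_coef k, c); first by rewrite lead_coef_eq0 k0.
  rewrite /= !mulZC e; congr (_ * _).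
  by rewrite szk' in szk; rewrite [in RHS](size1_polyC szk) [in LHS](size1_polyC szk) lead_coefC.
move=> f h [k e].
have afh : a %| f * h by rewrite e dvdp_mulr.
have [cop|ncop] := boolP (coprimep a f).
  by right; apply: dvdpW; rewrite -(Gauss_dvdpr _ cop).
left; apply: dvdpW.
have := irra.2 _ ncop (dvdp_gcdl _ _).
by move/eqp_dvdl <-; apply: dvdp_gcdr.
Qed.

(** A constant prime dividing [a] divides its leading coefficient, so the number of primes in the
    latter bounds the number of extractions. *)
Lemma content_split a : a != 0 -> exists c b,
  [/\ c != 0, a = c%:P * b & primitive b].
Proof.
move=> a0; have : lead_coef a != 0 by rewrite lead_coef_eq0.
move=> /factR [u [s [uu hs]]].
have [n] := ubnP (size s); elim: n a a0 u s uu hs => // n IHn a a0 u s uu hs szs e.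
have [pa|/existsNP[p]] := pselect (primitive a).
  by exists 1, a; rewrite oner_neq0 mul1r.
move=> /not_implyP [pp] /contrapT [b aE].
have p0 : p != 0 by case: pp.
have b0 : b != 0 by apply: contraNneq a0 => b0; rewrite aE b0 mulr0.
have lE : p * lead_coef b = u * \prod_(x <- s) x.
  by rewrite -e aE lead_coefM lead_coefC.
have [v [t [vu ht szt bE]]] := factor_cancel pp uu hs lE.
have [|c [b' [c0 bE' pb]]] := IHn _ b0 v t vu ht _ bE.
  by rewrite -ltnS (leq_trans _ szs).
exists (p * c), b'; split=> //; first exact: mulf_neq0.
by rewrite aE bE' polyCM mulrA.
Qed.

Lemma factorial_poly : factorial {poly R}.
Proof.
move=> a; have [n] := ubnP (size a); elim: n a => // n IHn a sza a0.
have [c [b [c0 aE pb]]] := content_split a0.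
have b0 : b != 0 by apply: contraNneq a0 => b0; rewrite aE b0 mulr0.
have szb : size b = size a by rewrite aE mul_polyC size_scale.
rewrite aE; apply: factoredM; first exact: factored_polyC.
have [szb1|szb1] := leqP (size b) 1.
  by rewrite (size1_polyC szb1); apply: factored_polyC; rewrite -polyC_eq0 -size1_polyC.
have [[f [h [bE szf szh]]]|irr] :=
    pselect (exists f h, [/\ b = f * h, (1 < size f)%N & (1 < size h)%N]).
  have [f0 h0] : f != 0 /\ h != 0.
    by rewrite -!size_poly_gt0 !(ltn_trans (ltn0Sn 0)).
  have szE : size b = (size f + size h).-1 by rewrite bE size_mul.
  rewrite bE; apply: factoredM; apply: IHn => //.
    by lia.
  by lia.
apply/factored_prime/prime_primitive => // f h bE.
have [|szf] := leqP (size f) 1; first by left.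
have [|szh] := leqP (size h) 1; first by right.
by case: irr; exists f, h.
Qed.

End PolyFactorial.

Section FactorialIso.
Variables (A B : idomainType) (phi : {rmorphism A -> B}) (psi : {rmorphism B -> A}).
Hypotheses (phiK : cancel phi psi) (psiK : cancel psi phi).

Lemma dvd_iso a b : dvd (psi a) (psi b) <-> dvd a b.
Proof.
split=> [[c e]|[c ->]]; last by exists (psi c); rewrite rmorphM.
by exists (phi c); rewrite -[b]psiK e rmorphM psiK.
Qed.

Lemma factorial_iso : factorial B -> factorial A.
Proof.
move=> fB a a0; have : phi a != 0 by rewrite -(inj_eq (can_inj psiK)) phiK rmorph0.
move=> /fB [u [s [uu hs e]]]; exists (psi u), (map psi s); split.
- exact: rmorph_unit.
- move=> _ /mapP [p /hs [p0 nu pP] ->]; split.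
  + by rewrite -(inj_eq (can_inj phiK)) psiK rmorph0.
  + by apply: contra nu => /(rmorph_unit phi); rewrite psiK.
  + move=> x y; rewrite -[x]phiK -[y]phiK -rmorphM !dvd_iso; exact: pP.
- by rewrite -[a]phiK e rmorphM rmorph_prod big_map.
Qed.
End FactorialIso.

Section FactorialMPoly.
Variable F : fieldType.

Section Step.
Variable n : nat.
Local Notation MPn := {mpoly F[n]}.
Local Notation MPs := {mpoly F[n.+1]}.

(** Inverse of [muni], which views the last variable as the variable of a univariate polynomial; the
    pair transports factoriality from [n] to [n.+1] variables. *)
Definition poly_mpoly (f : {poly MPn}) : MPs := (map_poly (@mwiden n F) f).['X_ord_max].

Lemma poly_mpoly_is_additive : additive poly_mpoly.
Proof. by move=> f g; rewrite /poly_mpoly rmorphB hornerD hornerN. Qed.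
Lemma poly_mpoly_is_multiplicative : multiplicative poly_mpoly.
Proof.
split=> [f g|]; first by rewrite /poly_mpoly rmorphM hornerM.
by rewrite /poly_mpoly rmorph1 hornerC.
Qed.
HB.instance Definition _ := GRing.isAdditive.Build {poly MPn} MPs poly_mpoly poly_mpoly_is_additive.
HB.instance Definition _ := GRing.isMultiplicative.Build {poly MPn} MPs poly_mpoly poly_mpoly_is_multiplicative.

Lemma poly_mpolyC c : poly_mpoly c%:P = mwiden c.
Proof. by rewrite /poly_mpoly map_polyC hornerC. Qed.
Lemma poly_mpolyX : poly_mpoly 'X = 'X_ord_max.
Proof. by rewrite /poly_mpoly map_polyX hornerX. Qed.

Lemma muniK : cancel (@muni n F) poly_mpoly.
Proof.
move=> p; rewrite muniE rmorph_sum /= [RHS]mpolyE; apply: eq_bigr => m _.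
rewrite -!mul_polyC !rmorphM rmorphXn /= poly_mpolyX !poly_mpolyC.
rewrite mwidenZ -scalerAl; congr (_ *: _).
rewrite mwidenX mpolyXn -mpolyXD; congr 'X_[_]; apply/mnmP => i.
rewrite mnmDE mulmnE mnm1E.
case: (unliftP ord_max i) => [j ->|->].
  rewrite (_ : lift ord_max j = widen_ord (leqnSn n) j); last first.
    by apply: val_inj; exact: lift_max.
  rewrite mnmwiden_widen mnmE eq_sym (_ : _ == _ = false) ?addn0 //.
  by apply/eqP => /(congr1 val) /= e; move: (ltn_ord j); rewrite e ltnn.
by rewrite mnmwiden_ordmax eqxx mul1n.
Qed.

Lemma muni_widen (p : MPn) : muni (mwiden p) = p%:P.
Proof.
rewrite [p]mpolyE (raddf_sum (@mwiden _ _)) (raddf_sum (@muni _ _)) (raddf_sum (@polyC _)) /=; apply: eq_bigr => m _.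
rewrite mwidenZ muniZ mwidenX [in LHS]muniE msuppX big_seq1 mcoeffX eqxx scale1r.
rewrite mnmwiden_ordmax expr0 -!mul_polyC mulr1 -polyCM mul_mpolyC.
congr (_ *: 'X_[_])%:P; apply/mnmP => i.
by rewrite mnmE mnmwiden_widen.
Qed.

Lemma poly_mpolyK : cancel poly_mpoly (@muni n F).
Proof.
move=> f; rewrite -[f]coefK poly_def !rmorph_sum /=; apply: eq_bigr => i _.
rewrite -mul_polyC !rmorphM !rmorphXn /= poly_mpolyX poly_mpolyC muni_widen.
congr (_ * _ ^+ _); rewrite muniE msuppX big_seq1 mcoeffX eqxx scale1r.
rewrite mnm1E eqxx expr1 (_ : [multinom _ | _ < n] = 0%MM) ?mpolyX0 ?scale1r //.
apply/mnmP=> j; rewrite mnmE mnm1E mnm0E; case: eqP => // /(congr1 val) /= e.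
by move: (ltn_ord j); rewrite -e ltnn.
Qed.
End Step.

Lemma factorial_mpoly n : factorial {mpoly F[n]}.
Proof.
elim: n => [|n IHn].
  move=> a a0; apply: factored_unit; rewrite (nvar0_mpolyC a) in a0 *.
  by rewrite rmorph_unit // unitfE; apply: contraNneq a0 => ->.
exact: (factorial_iso (@muniK n) (@poly_mpolyK n) (factorial_poly IHn)).
Qed.
End FactorialMPoly.

(** * Weighted gradings and factors of homogeneous polynomials *)

Section Grading.
Variables (F : fieldType) (n : nat) (mf : measure n).
Local Notation A := {mpoly F[n]}.
Implicit Types f g h : A.

(* Turns the weight [mf] into the degree in an additional variable. *)
Definition graded f : {poly A} :=
  mmap (polyC \o @mpolyC n F) (fun i => ('X_i)%:P * 'X^(mf U_(i)%MM)) f.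

Lemma graded_is_additive : additive graded.
Proof. exact: mmap_is_additive. Qed.
Lemma graded_is_multiplicative : multiplicative graded.
Proof. exact: mmap_is_multiplicative. Qed.
HB.instance Definition _ := GRing.isAdditive.Build A {poly A} graded graded_is_additive.
HB.instance Definition _ := GRing.isMultiplicative.Build A {poly A} graded graded_is_multiplicative.

Lemma gradedX m : graded 'X_[m] = 'X_[m]%:P * 'X^(mf m).
Proof.
rewrite /graded mmapX /mmap1.
under eq_bigr do rewrite exprMn -rmorphXn /= -exprM.
rewrite big_split /= -rmorph_prod /= -mpolyXE_id; congr (_ * _).
rewrite (mfE mf m) (big_morph (fun k => 'X^k) (exprD _) (expr0 _)).
by apply: eq_bigr => i _; rewrite mulnC.
Qed.

Lemma coef_graded f d m : ((graded f)`_d)@_m = if mf m == d then f@_m else 0.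
Proof.
rewrite {1}[f]mpolyE rmorph_sum coef_sum raddf_sum /=.
under eq_bigr => m' _.
  rewrite /graded mmapZ -/(graded _) gradedX /= mulrA -polyCM coefCM coefXn mul_mpolyC.
  rewrite (_ : _ *: _ * _ = (f@_m' * (d == mf m')%:R) *: 'X_[m']); last first.
    by case: eqP; rewrite ?mulr1 ?mulr0 ?scale0r.
  rewrite mcoeffZ mcoeffX; over.
have [mf0'|mf0'] := boolP (m \in msupp f); last first.
  rewrite (memN_msupp_eq0 mf0') if_same big_seq big1 // => m' m'f.
  by case: (m' =P m) => [e|]; [rewrite -e m'f in mf0'|rewrite mulr0].
rewrite (bigD1_seq m) ?msupp_uniq //= big1 => [|m' /negPf->]; last by rewrite mulr0.
by rewrite eqxx mulr1 addr0 eq_sym; case: eqP; rewrite ?mulr1 ?mulr0.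
Qed.

Lemma size_graded f : size (graded f) = mmeasure mf f.
Proof.
apply/eqP; rewrite eqn_leq; apply/andP; split.
  apply/leq_sizeP => j hj; apply/mpolyP=> m; rewrite coef_graded mcoeff0.
  by case: eqP => // e; apply/memN_msupp_eq0/(mmeasure_mnm_ge (mf:=mf)); rewrite e.
rewrite mmeasureE; apply/bigmax_leqP_seq => m mf0' _.
rewrite ltnNge; apply/negP => /leq_sizeP/(_ _ (leqnn _)) /mpolyP/(_ m).
by rewrite coef_graded eqxx mcoeff0 => /eqP; rewrite mcoeff_eq0 mf0'.
Qed.

Lemma graded_homog f d : (f \is d.-homog for mf) <-> graded f = f%:P * 'X^d.
Proof.
split=> [/dhomogP hf|e].
  apply/polyP => k; rewrite coefCM coefXn; apply/mpolyP => m; rewrite coef_graded.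
  have [mf0'|mf0'] := boolP (m \in msupp f).
    by rewrite hf // eq_sym; case: eqP => _; rewrite ?mulr1 // mulr0 mcoeff0.
  by rewrite (memN_msupp_eq0 mf0') if_same; case: eqP => _;
    rewrite ?mulr1 ?mulr0 ?mcoeff0 // (memN_msupp_eq0 mf0').
apply/dhomogP => m mf0'; apply/eqP; apply: contraLR mf0' => md.
have /mpolyP/(_ m) := congr1 (fun g : {poly A} => g`_(mf m)) e.
rewrite coef_graded eqxx coefCM coefXn (negPf md) mulr0 mcoeff0 => e'.
by rewrite -mcoeff_eq0 e'.
Qed.

Lemma mmeasureM f g : f != 0 -> g != 0 ->
  mmeasure mf (f * g) = (mmeasure mf f + mmeasure mf g).-1.
Proof.
move=> f0 g0; rewrite -!size_graded rmorphM size_mul //.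
- by rewrite -size_poly_gt0 size_graded lt0n mmeasure_poly_eq0.
- by rewrite -size_poly_gt0 size_graded lt0n mmeasure_poly_eq0.
Qed.

(** Split the powers of ['X] off both factors. What remains does not vanish at 0, so the product of
    the remainders has no factor ['X] and must be constant. *)
Lemma monomial_factor (B : idomainType) (P Q : {poly B}) c k : c != 0 ->
  P * Q = c%:P * 'X^k -> exists a i, P = a%:P * 'X^i.
Proof.
move=> c0 e; have e0 : P * Q != 0 by rewrite e mulf_neq0 ?polyC_eq0 // -size_poly_gt0 size_polyXn.
have [P0 Q0] : P != 0 /\ Q != 0 by move: e0; rewrite mulf_eq0 negb_or => /andP[].
have [i [P']] := multiplicity_XsubC P 0; rewrite P0 /= subr0 => nP' PE.
have [j [Q']] := multiplicity_XsubC Q 0; rewrite Q0 /= subr0 => nQ' QE.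
have nPQ : ~~ root (P' * Q') 0 by rewrite rootM negb_or nP'.
have X0 l : 'X^l != 0 :> {poly B} by rewrite -size_poly_gt0 size_polyXn.
have szE : size P' = 1%N.
  have : P' * Q' * 'X^(i + j) = c%:P * 'X^k by rewrite -e PE QE exprD; ring.
  have [le|lt] := leqP k (i + j).
    rewrite -(subnK le) exprD mulrA => /(mulIf (X0 _)) h.
    have : size (P' * (Q' * 'X^(i + j - k))) = 1%N by rewrite mulrA h size_polyC c0.
    have : P' * (Q' * 'X^(i + j - k)) != 0 by rewrite mulrA h polyC_eq0.
    rewrite mulf_eq0 negb_or => /andP[P'0 W0]; rewrite size_mul //.
    move: P'0 W0; rewrite -!size_poly_gt0.
    by case: (size P') => [|[|u]] //; case: (size (Q' * _)) => [|[|v]] //=; rewrite addnS.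
  rewrite -(subnK (ltnW lt)) (exprD _ (k - _)) [in RHS]mulrA => /(mulIf (X0 _)) h.
  case/negP: nPQ; rewrite h; apply/rootP; rewrite hornerM hornerXn expr0n.
  by rewrite subn_eq0 leqNgt lt mulr0.
exists P'`_0, i; rewrite {1}PE; congr (_ * _).
by apply/size1_polyC; rewrite szE.
Qed.

(** [graded] sends homogeneous polynomials, and only these, to a monomial with coefficient the
    polynomial itself; a divisor of a monomial is a monomial, and setting the extra variable to 1
    identifies its coefficient. *)
Lemma dhomog_divl f g d : f * g != 0 -> f * g \is d.-homog for mf ->
  exists e, f \is e.-homog for mf.
Proof.
move=> fg0 /graded_homog; rewrite rmorphM => /(monomial_factor fg0) [a [e fE]].
exists e; apply/graded_homog; rewrite fE; congr (_%:P * _).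
have g1 h : (graded h).[1] = h.
  apply/mpolyP => m; rewrite horner_coef raddf_sum /= size_graded.
  under eq_bigr => i _ do rewrite expr1n mulr1 coef_graded.
  have [mh|mh] := boolP (m \in msupp h).
    have lt := mmeasure_mnm_lt mf mh.
    rewrite (bigD1 (Ordinal lt)) //= eqxx big1 ?addr0 // => i.
    by rewrite -val_eqE /= eq_sym => /negPf->.
  by rewrite (memN_msupp_eq0 mh) big1 // => i _; rewrite if_same.
by rewrite -[RHS]g1 fE hornerM hornerC hornerXn expr1n mulr1.
Qed.

End Grading.

(** * Orders along prime divisors *)

Section Valuation.
Variables (F : fieldType) (n : nat).
Local Notation A := {mpoly F[n]}.
Implicit Types f g h p q : A.

Definition degp f := (msize f).-1.

Lemma msizeS f : f != 0 -> msize f = (degp f).+1.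
Proof. exact: mpolySpred. Qed.

Lemma degpM f g : f != 0 -> g != 0 -> degp (f * g) = (degp f + degp g)%N.
Proof. by move=> f0 g0; rewrite {1}/degp msizeM // (msizeS f0) (msizeS g0) addSn addnS. Qed.

Lemma degpX f k : f != 0 -> degp (f ^+ k) = (k * degp f)%N.
Proof.
move=> f0; elim: k => [|k IHk]; first by rewrite expr0 /degp msize1.
by rewrite exprS degpM ?expf_neq0 // IHk.
Qed.

Lemma degp_homog f d : f != 0 -> f \is d.-homog -> degp f = d.
Proof. by move=> f0 hf; apply: (dhomog_uniq f0 (dhomog_msize hf) hf). Qed.

Lemma mpoly_unitP f : reflect (exists2 c, c != 0 & f = c%:MP) (f \is a GRing.unit).
Proof.
apply: (iffP idP) => [|[c c0 ->]]; last by rewrite rmorph_unit // unitfE.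
by move=> /andP[/eqP e]; rewrite unitfE => c0; exists (f@_0%MM).
Qed.

Lemma prime_degp p : prime_elt p -> (0 < degp p)%N.
Proof.
move=> [p0 nu _]; rewrite lt0n; apply: contra nu => /eqP e; apply/mpoly_unitP.
by apply/msize_poly1P; rewrite msizeS // e.
Qed.

Section Val.
Variable p : A.
Hypothesis pp : prime_elt p.

(** Repeated division stops because primes are not constant, so that each quotient has smaller
    degree. *)
Lemma val_spec g : g != 0 -> {k | exists2 h, g = p ^+ k * h & ~ dvd p h}.
Proof.
move=> g0; apply/cid; have [d] := ubnP (degp g); elim: d g g0 => // d IHd g g0 dg.
have [[h gE]|ndv] := pselect (dvd p g); last by exists 0%N, g => //; rewrite mul1r.
have p0 : p != 0 by case: pp.
have h0 : h != 0 by apply: contraNneq g0 => h0; rewrite gE h0 mulr0.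
have [|k [h' hE ndv]] := IHd h h0.
  by rewrite -ltnS; apply: leq_trans dg; rewrite ltnS gE degpM // -[X in (X < _)%N]add0n ltn_add2r prime_degp.
by exists k.+1, h' => //; rewrite gE hE exprS mulrA.
Qed.

Definition val g : nat := if pselect (g != 0) is left g0 then sval (val_spec g0) else 0.

Lemma valP g : g != 0 -> exists2 h, g = p ^+ (val g) * h & ~ dvd p h.
Proof. by move=> g0; rewrite /val; case: pselect => // ?; case: val_spec. Qed.

Lemma val_uniq g k h : g != 0 -> g = p ^+ k * h -> ~ dvd p h -> val g = k.
Proof.
have p0 : p != 0 by case: pp.
have aux a b u v : p ^+ a * u = p ^+ b * v -> ~ dvd p u -> (b <= a)%N.
  move=> e nu; rewrite leqNgt; apply/negP => lt; apply: nu.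
  rewrite -(subnK (ltnW lt)) addnC exprD -mulrA in e.
  move/(mulfI (expf_neq0 _ p0)): e => ->; apply/dvd_mulr.
  by rewrite -(prednK (_ : 0 < b - a)%N) ?subn_gt0 // exprS; apply/dvd_mulr/dvd_refl.
move=> g0 gE nh; have [h' gE' nh'] := valP g0.
by apply/eqP; rewrite eqn_leq (aux _ _ h h') -?gE // (aux _ _ h' h) -?gE.
Qed.

Lemma val_ndvd g : ~ dvd p g -> val g = 0%N.
Proof.
move=> nd; apply: (@val_uniq _ _ g) => //; rewrite ?mul1r //.
by apply/eqP => g0; apply: nd; rewrite g0; apply: dvd0.
Qed.

Lemma valM g h : g != 0 -> h != 0 -> val (g * h) = (val g + val h)%N.
Proof.
move=> g0 h0; have [g' gE ng] := valP g0; have [h' hE nh] := valP h0.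
apply: (@val_uniq _ _ (g' * h')); first by rewrite mulf_neq0.
  by rewrite {1}gE {1}hE exprD mulrACA.
by case: pp => _ _ pP /pP[].
Qed.

Lemma val_self : val p = 1%N.
Proof.
have [p0 nu _] := pp; apply: (@val_uniq _ _ 1) => //; first by rewrite mulr1.
by move/(dvd_unit (unitr1 _)) => pu; rewrite pu in nu.
Qed.

Lemma valX g k : g != 0 -> val (g ^+ k) = (k * val g)%N.
Proof.
move=> g0; elim: k => [|k IHk]; last by rewrite exprS valM ?expf_neq0 // IHk.
rewrite val_ndvd // => /(dvd_unit (unitr1 _)) pu; case: pp => _.
by rewrite pu.
Qed.

Lemma val_prod (I : Type) (r : seq I) (P : pred I) (E : I -> A) :
  (forall i, P i -> E i != 0) ->
  val (\prod_(i <- r | P i) E i) = (\sum_(i <- r | P i) val (E i))%N.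
Proof.
move=> E0; elim: r => [|i r IHr].
  by rewrite !big_nil val_ndvd // => /(dvd_unit (unitr1 _)) pu; case: pp => _; rewrite pu.
rewrite !big_cons; case: ifP => // Pi; rewrite valM ?E0 ?IHr //.
by apply: (big_ind (fun f : A => f != 0)) => //; [exact: oner_neq0|move=> f g; exact: mulf_neq0].
Qed.

Lemma val_geP k g : g != 0 -> (k <= val g)%N <-> dvd (p ^+ k) g.
Proof.
move=> g0; split=> [le|[h gE]].
  have [h -> _] := valP g0.
  by rewrite -(subnK le) addnC exprD -mulrA; apply/dvd_mulr/dvd_refl.
have h0 : h != 0 by apply: contraNneq g0 => h0; rewrite gE h0 mulr0.
have p0 : p != 0 by case: pp.
by rewrite gE valM ?expf_neq0 // valX // val_self muln1 leq_addr.
Qed.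

Lemma val_gt0 g : g != 0 -> (0 < val g)%N <-> dvd p g.
Proof. by move=> g0; rewrite val_geP // expr1. Qed.

Lemma val_sum_ge k (I : Type) (r : seq I) (P : pred I) (E : I -> A) :
  (forall i, P i -> E i != 0 -> (k <= val (E i))%N) ->
  \sum_(i <- r | P i) E i != 0 -> (k <= val (\sum_(i <- r | P i) E i)%R)%N.
Proof.
move=> hE s0; apply/val_geP => //.
apply: (big_ind (fun g => dvd (p ^+ k) g)); [exact: dvd0|exact: dvd_add|].
move=> i Pi; have [->|e0] := eqVneq (E i) 0; first exact: dvd0.
by apply/val_geP => //; apply: hE.
Qed.

Lemma valZ c g : c != 0 -> g != 0 -> val (c *: g) = val g.
Proof.
move=> c0 g0; rewrite -mul_mpolyC valM // ?mpolyC_eq0 // val_ndvd // => h.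
have /dvd_unit/(_ h) pu : c%:MP_[n] \is a GRing.unit by apply/mpoly_unitP; exists c.
by case: pp => _; rewrite pu.
Qed.

End Val.

(** Leading coefficient 1 selects one prime in each class of associates, so that divisibility
    between two of them becomes equality. *)
Definition hprime p := [/\ prime_elt p, mleadc p = 1 & exists d, p \is d.-homog].

Lemma monic_dvd_eq p q : prime_elt p -> prime_elt q -> mleadc p = 1 -> mleadc q = 1 ->
  dvd p q -> p = q.
Proof.
move=> [p0 nup pP] [q0 nuq qP] mp mq [c e].
have : dvd q (p * c) by rewrite -e; apply: dvd_refl.
case/qP=> [[d e']|[d e']].
  have : c \is a GRing.unit.
    apply/unitrPr; exists d; apply: (mulfI p0); rewrite mulr1.
    by rewrite [in RHS]e' e; ring.
  case/mpoly_unitP=> a a0 cE; move: mq; rewrite e cE mulrC mul_mpolyC mleadZ //.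
  by rewrite mcoeffZ mp mulr1 => ->; rewrite scale1r.
case/negP: nup; apply/unitrPr; exists d; apply: (mulfI q0).
by rewrite mulr1 [in RHS]e e'; ring.
Qed.

Lemma val_prime_neq p q (pp : prime_elt p) : prime_elt q -> mleadc p = 1 -> mleadc q = 1 ->
  val pp q = (p == q).
Proof.
move=> pq mp mq; have q0 : q != 0 by case: pq.
have [e|ne] := eqVneq p q; first by rewrite -e val_self.
by rewrite val_ndvd // => /(monic_dvd_eq pp pq mp mq)/eqP; rewrite (negPf ne).
Qed.

Lemma prime_elt_assoc u p : u \is a GRing.unit -> prime_elt p -> prime_elt (u * p).
Proof.
move=> uu [p0 nu pP].
have u0 : u != 0 by apply: contraTneq uu => ->; rewrite unitr0.
have dvE a : dvd (u * p) a <-> dvd p a.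
  split=> [[c ->]|[c ->]]; first by exists (u * c); ring.
  by exists (u^-1 * c); rewrite mulrACA mulrV // mul1r.
split; first by rewrite mulf_neq0.
  by rewrite unitrM uu.
by move=> a b; rewrite !dvE; apply: pP.
Qed.

Lemma homog_factor_hprime g d : g != 0 -> g \is d.-homog ->
  exists c (s : seq A), [/\ c != 0, {in s, forall p, hprime p} & g = c%:MP * \prod_(p <- s) p].
Proof.
move=> g0 hg; have [u [s [uu hs gE]]] := factorial_mpoly g0.
elim: s u uu hs g g0 d hg gE => [|x s IHs] u uu hs g g0 d hg gE.
  have [c c0 uE] := mpoly_unitP _ uu.
  by exists c, [::]; split=> //; rewrite gE uE !big_nil.
have xp : prime_elt x by apply: hs; rewrite mem_head.
have x0 : x != 0 by case: xp.
have lx0 : mleadc x != 0 by rewrite mleadc_eq0.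
set y := (mleadc x)^-1 *: x.
have yp : prime_elt y.
  rewrite /y -mul_mpolyC; apply: prime_elt_assoc => //.
  by rewrite rmorph_unit // unitfE invr_neq0.
have gE' : g = y * ((mleadc x)%:MP * u * \prod_(p <- s) p).
  rewrite gE big_cons /y -mul_mpolyC.
  have := congr1 (fun c => c%:MP_[n]) (mulVf lx0); rewrite rmorphM rmorph1 /= => e.
  transitivity ((((mleadc x)^-1)%:MP * (mleadc x)%:MP) * (u * (x * \prod_(j <- s) j))).
    by rewrite e mul1r.
  by ring.
set g' := _ * u * _ in gE'.
have g'0 : g' != 0 by apply: contraNneq g0 => e; rewrite gE' e mulr0.
have [e hy] : exists e, y \is e.-homog by apply: (dhomog_divl (d := d) (g := g')); rewrite -gE'.
have [e' hg'] : exists e, g' \is e.-homog by apply: (dhomog_divl (d := d) (g := y)); rewrite mulrC -gE'.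
have [||c [t [c0 ht g'E]]] := IHs ((mleadc x)%:MP * u) _ _ g' g'0 e' hg' erefl.
- by rewrite unitrM uu andbT rmorph_unit // unitfE.
- by move=> p ps; apply: hs; rewrite inE ps orbT.
exists c, (y :: t); split=> //.
  move=> p; rewrite inE => /predU1P[->|/ht//]; split=> //; last by exists e.
  by rewrite /y mleadZ ?invr_neq0 // mcoeffZ mulVf.
by rewrite gE' g'E big_cons; ring.
Qed.

End Valuation.

Section TotalVal.
Variables (F : fieldType) (n : nat).
Local Notation A := {mpoly F[n]}.
Implicit Types f g h p q : A.

(** Total in [p], with value 0 off the primes, so that functions of [p] can be summed over lists
    without carrying proofs of primality. *)
Definition vp p g : nat := if pselect (prime_elt p) is left pp then val pp g else 0.

Lemma vpE p (pp : prime_elt p) g : vp p g = val pp g.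
Proof. by rewrite /vp; case: pselect => // pp'; rewrite (Prop_irrelevance pp pp'). Qed.

Definition hom g := g != 0 /\ exists d, g \is d.-homog.

Lemma hom_neq0 g : hom g -> g != 0. Proof. by case. Qed.

Lemma hom_degp g : hom g -> g \is (degp g).-homog.
Proof. by case=> g0 [d hd]; rewrite (degp_homog g0 hd). Qed.

Lemma homM f g : hom f -> hom g -> hom (f * g).
Proof.
move=> [f0 [d hf]] [g0 [e hg]]; split; first exact: mulf_neq0.
by exists (d + e)%N; apply: dhomogM.
Qed.

Lemma homX f k : hom f -> hom (f ^+ k).
Proof.
move=> [f0 [d hf]]; split; first exact: expf_neq0.
by exists (d * k)%N; apply: dhomogMn.
Qed.

Lemma hom1 : hom 1.
Proof. by split; [exact: oner_neq0 | exists 0%N; apply: dhomog1]. Qed.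

Lemma hom_prod (I : Type) (r : seq I) (P : pred I) (E : I -> A) :
  (forall i, P i -> hom (E i)) -> hom (\prod_(i <- r | P i) E i).
Proof.
by move=> hE; apply: big_ind => //; [exact: hom1|exact: homM].
Qed.

Lemma hom_divl f g : hom (f * g) -> hom f /\ hom g.
Proof.
move=> [fg0 [d hfg]]; have := fg0; rewrite mulf_eq0 negb_or => /andP[f0 g0].
split; split=> //; first exact: dhomog_divl hfg.
by apply: (dhomog_divl (g := f) (d := d)); rewrite mulrC.
Qed.

Lemma hprime_hom p : hprime p -> hom p.
Proof. by case=> -[p0 _ _] _ hd. Qed.

Lemma hprime_prime p : hprime p -> prime_elt p. Proof. by case. Qed.

Lemma vpM p f g : hprime p -> f != 0 -> g != 0 -> vp p (f * g) = (vp p f + vp p g)%N.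
Proof. by move=> /hprime_prime pp f0 g0; rewrite !(vpE pp) valM. Qed.

Lemma vpX p g k : hprime p -> g != 0 -> vp p (g ^+ k) = (k * vp p g)%N.
Proof. by move=> /hprime_prime pp g0; rewrite !(vpE pp) valX. Qed.

Lemma vp_self p : hprime p -> vp p p = 1%N.
Proof. by move=> /hprime_prime pp; rewrite (vpE pp) val_self. Qed.

Lemma vp_gt0 p g : hprime p -> g != 0 -> (0 < vp p g)%N <-> dvd p g.
Proof. by move=> /hprime_prime pp g0; rewrite (vpE pp) val_gt0. Qed.

Lemma vp_eq0 p g : hprime p -> g != 0 -> vp p g = 0%N <-> ~ dvd p g.
Proof.
move=> hp g0; rewrite -(vp_gt0 hp g0); by case: (vp p g) => [|k]; split=> //; case.
Qed.

Lemma vp_spec p g : hprime p -> g != 0 -> exists2 h, g = p ^+ (vp p g) * h & ~ dvd p h.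
Proof. by move=> /hprime_prime pp g0; rewrite (vpE pp); apply: valP. Qed.

End TotalVal.

(** * Substitution of a matrix of polynomials *)

Section Substitution.
Variables (F : fieldType) (q : nat).
Local Notation N := (q * q)%N.
Local Notation A := {mpoly F[q * q]}.
Implicit Types (f g : A) (M : 'M[A]_q).

Definition xv (i j : 'I_q) : A := 'X_(mxvec_index i j).

Definition sub M : A -> A := comp_mpoly [tuple mxvec M 0 k | k < q * q].
HB.instance Definition _ M := GRing.RMorphism.on (sub M).
HB.instance Definition _ M := GRing.Linear.on (sub M).

Lemma sub_xv M i j : sub M (xv i j) = M i j.
Proof. by rewrite /sub /xv comp_mpolyXU -tnth_nth tnth_mktuple mxvecE. Qed.

Lemma sub_ext (S : comNzRingType) (f g : {rmorphism A -> S}) :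
  (forall c, f c%:MP = g c%:MP) -> (forall i j, f (xv i j) = g (xv i j)) -> f =1 g.
Proof.
move=> hc hx p; rewrite [p]mpolyE !rmorph_sum; apply: eq_bigr => m _.
rewrite -mul_mpolyC !rmorphM hc; congr (_ * _).
rewrite mpolyXE_id !rmorph_prod; apply: eq_bigr => k _; rewrite !rmorphXn; congr (_ ^+ _).
by case/mxvec_indexP: k => i j; apply: hx.
Qed.

Lemma subC M c : sub M c%:MP = c%:MP.
Proof. by rewrite /sub comp_mpolyC. Qed.

Lemma sub_comp M M' g : sub M' (sub M g) = sub (map_mx (sub M') M) g.
Proof.
apply: (@sub_ext _ (sub M' \o sub M) (sub (map_mx (sub M') M))) => [c|i j] /=.
  by rewrite !subC.
by rewrite !sub_xv mxE.
Qed.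

Lemma sub_id g : sub (\matrix_(i, j) xv i j) g = g.
Proof.
apply: (@sub_ext _ (sub _) idfun) => [c|i j] /=; first by rewrite subC.
by rewrite sub_xv mxE.
Qed.

Lemma sub_scale M c g d : g \is d.-homog -> sub (map_mx ( *%R c) M) g = c ^+ d * sub M g.
Proof.
move=> /dhomogP hg; rewrite [g]mpolyE !raddf_sum mulr_sumr /= big_seq [RHS]big_seq.
apply: eq_bigr => m /hg md; rewrite !linearZ /= -scalerAr; congr (_ *: _).
rewrite /sub !comp_mpolyX -md /= mdegE -prodrXr -big_split /=.
apply: eq_bigr => k _; rewrite !tnth_mktuple.
by case/mxvec_indexP: k => i j; rewrite !mxvecE mxE exprMn.
Qed.

Lemma sub_homog (mf : measure (q * q)) M (K : 'M[nat]_q) g d :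
  (forall i j, M i j \is (K i j).-homog for mf) ->
  {in msupp g, forall m : 'X_{1..q * q}, \sum_k m k * mxvec K 0%R k = d}%N ->
  sub M g \is d.-homog for mf.
Proof.
move=> hM hg; rewrite [g]mpolyE raddf_sum /= big_seq.
apply: rpred_sum => m /hg md; rewrite linearZ /=; apply: dhomogZ.
rewrite /sub comp_mpolyX -md.
apply: (big_ind2 (fun (f : A) k => f \is k.-homog for mf)).
- exact: dhomog1.
- by move=> f1 d1 f2 d2; apply: dhomogM.
move=> k _; rewrite mulnC; apply: dhomogMn; rewrite tnth_mktuple.
by case/mxvec_indexP: k => i j; rewrite !mxvecE.
Qed.

End Substitution.

(** * Pull-back of order functions by an involution *)

Section Involution.
Variables (F : fieldType) (q : nat).
Local Notation A := {mpoly F[q * q]}.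
Implicit Types (f g : A) (V : A -> int).

Variables (sg : 'M[A]_q) (ms : A) (e : nat).

(* Since [sg] composed with itself is multiplication by [ms ^ (e - 2)], subtracting
   [degp g * V ms] from the pull-back makes [op] an involution, see [op_op]. *)
Definition op V g : int := V (sub sg g) - (degp g)%:Z * V ms.

Definition additive_on (P : A -> Prop) V := forall f g, P f -> P g -> V (f * g) = V f + V g.

(** Polynomial form of a projective involution. For the Hadamard inverse, [ms] is the product of all
    entries and [e] is [q * q]; for the cofactor matrix, [ms] is the determinant and [e] is [q]. *)
Record involutive : Prop := Involutive {
  inv_e : (1 < e)%N;
  inv_ms : hom ms;
  inv_msd : ms \is e.-homog;
  inv_sgd : forall i j, sg i j \is e.-1.-homog;
  inv_sub_ms : sub sg ms = ms ^+ e.-1;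
  inv_sub_sg : forall i j, sub sg (sg i j) = ms ^+ e.-2 * xv F i j }.

Hypothesis I : involutive.

Lemma sub_sub g : hom g -> sub sg (sub sg g) = ms ^+ (e.-2 * degp g) * g.
Proof.
move=> hg; rewrite sub_comp.
rewrite (_ : map_mx _ _ = map_mx ( *%R (ms ^+ e.-2)) (\matrix_(i, j) xv F i j)).
  by rewrite (sub_scale _ _ (hom_degp hg)) sub_id exprM.
by apply/matrixP => i j; rewrite !mxE (inv_sub_sg I).
Qed.

Lemma sub_neq0 g : hom g -> sub sg g != 0.
Proof.
move=> hg; apply: contraTneq (hom_neq0 hg) => e0; move: (sub_sub hg).
by rewrite e0 raddf0 => /esym/eqP; rewrite mulf_eq0 expf_eq0 (negPf (hom_neq0 (inv_ms I))) andbF /= => ->.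
Qed.

Lemma sub_dhomog g d : g \is d.-homog -> sub sg g \is (d * e.-1).-homog.
Proof.
move=> /dhomogP hg; apply: (sub_homog (K := const_mx e.-1)) => [i j|m /hg md].
  by rewrite mxE (inv_sgd I).
rewrite -md /= mdegE big_distrl /=; apply: eq_bigr => k _.
by case/mxvec_indexP: k => i j; rewrite mxvecE mxE.
Qed.

Lemma sub_hom g : hom g -> hom (sub sg g).
Proof.
move=> hg; split; first exact: sub_neq0.
by exists (degp g * e.-1)%N; apply/sub_dhomog/hom_degp.
Qed.

Lemma degp_sub g : hom g -> degp (sub sg g) = (degp g * e.-1)%N.
Proof. by move=> hg; apply: degp_homog; [apply: sub_neq0|apply/sub_dhomog/hom_degp]. Qed.

Lemma degp_ms : degp ms = e.
Proof. exact: degp_homog (hom_neq0 (inv_ms I)) (inv_msd I). Qed.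

Lemma additive_onX V k g : additive_on (@hom _ _) V -> hom g -> V (g ^+ k) = k%:Z * V g.
Proof.
move=> aV hg; elim: k => [|k IHk].
  have := aV _ _ (hom1 F _) (hom1 F _); rewrite mulr1 expr0 => h.
  by lia.
by rewrite exprS aV ?IHk //; [lia|exact: homX].
Qed.

Lemma additive_op V : additive_on (@hom _ _) V -> additive_on (@hom _ _) (op V).
Proof.
move=> aV f g hf hg; rewrite /op rmorphM aV; [|exact: sub_hom..].
by rewrite degpM ?hom_neq0 // PoszD; ring.
Qed.

(** The coefficient of [degp g * V ms] is $(e-2)-(e-1)-(e-1)+e=0$. *)
Lemma op_op V g : additive_on (@hom _ _) V -> hom g -> op (op V) g = V g.
Proof.
move=> aV hg; rewrite /op sub_sub // aV //; last by apply/homX/(inv_ms I).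
rewrite degp_sub // (inv_sub_ms I) !(additive_onX _ aV (inv_ms I)) degp_ms.
have := inv_e I; case: (e) => [|[|e']] //= _; rewrite !PoszM !intS; ring.
Qed.

Lemma op_ms V : additive_on (@hom _ _) V -> op V ms = - V ms.
Proof.
move=> aV; rewrite /op (inv_sub_ms I) additive_onX //; last exact: (inv_ms I).
by rewrite degp_ms; have := inv_e I; case: (e) => [|e'] //= _; rewrite intS; ring.
Qed.

Lemma additive_vp (p : A) : hprime p -> additive_on (@hom _ _) (fun g => (vp p g)%:Z).
Proof. by move=> hp f g [f0 _] [g0 _]; rewrite vpM // PoszD. Qed.

(** Away from [ms = 0] the involution is invertible and carries a prime divisor to a prime divisor.
    The image is found among the prime factors of [sub sg p]. *)
Lemma op_vp_transport (p : A) : hprime p -> ~ dvd p ms ->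
  exists2 p', hprime p' & forall g, hom g -> op (fun g => (vp p g)%:Z) g = (vp p' g)%:Z.
Proof.
move=> hp nms; have hms := inv_ms I.
have vms : vp p ms = 0%N by apply/vp_eq0 => //; apply: hom_neq0.
have hph := hprime_hom hp; have hhh := sub_hom hph.
set h := sub sg p in hhh.
have [d hd] := hhh.2; have [c [s [c0 hs hE]]] := homog_factor_hprime hhh.1 hd.
have vms' k : vp p (ms ^+ k) = 0%N by rewrite vpX ?vms ?muln0 ?hom_neq0.
(* [sub sg h] is [p] times a power of [ms], so exactly one factor of [h] is sent to a multiple of
   [p], and with multiplicity one. *)
have hsum : (\sum_(x <- s) vp p (sub sg x) = 1)%N.
  have : vp p (sub sg h) = 1%N.
    by rewrite (sub_sub hph : sub sg h = _) (vpM hp (hom_neq0 (homX _ hms)) (hom_neq0 hph)) vms' vp_self.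
  rewrite hE rmorphM /= subC rmorph_prod /= mul_mpolyC (vpE (hprime_prime hp)) valZ //.
    rewrite big_seq val_prod => [|x /hs/hprime_hom/sub_neq0//].
    by move=> <-; rewrite [LHS]big_seq; apply: eq_bigr => x _; exact: vpE.
  rewrite prodf_seq_neq0; apply/allP => x xs /=; apply/sub_neq0/hprime_hom/hs/xs.
have [x xs vx] : exists2 x, x \in s & vp p (sub sg x) = 1%N.
  have : has (fun x => vp p (sub sg x) != 0%N) s.
    apply: contraPT hsum => /hasPn hn; rewrite big_seq big1 // => x /hn.
    by rewrite negbK => /eqP.
  case/hasP => x xs vx; exists x => //.
  by move: hsum; rewrite (big_rem x) //=; case: (vp p _) vx => [|[|k]].
have hx := hs x xs; have hxh := hprime_hom hx.
have xh : dvd x h.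
  by rewrite hE (big_rem x) //=; apply/dvd_mull/dvd_mulr/dvd_refl.
have xms : ~ dvd x ms.
  move=> [r rE]; have hr : hom r by have := hms; rewrite rE => /hom_divl[].
  have := vms' e.-1; rewrite -(inv_sub_ms I) rE rmorphM /= vpM ?vx //; exact: sub_neq0.
have xmsk k : ~ dvd x (ms ^+ k).
  have [_ nu xP] := hprime_prime hx.
  elim: k => [|k IHk]; last by rewrite exprS => /xP[].
  by move=> /(dvd_unit (unitr1 _)) xu; rewrite xu in nu.
(* If [p] divided [sub sg g], then [x], a factor of [h], would divide [sub sg (sub sg g)], which is
   [g] times a power of [ms]. *)
have v0 g : hom g -> ~ dvd x g -> vp p (sub sg g) = 0%N.
  move=> hg ng; apply/vp_eq0 => //; first exact: sub_neq0.
  move=> [a aE]; have ha : hom a by have := sub_hom hg; rewrite aE => /hom_divl[].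
  have : dvd x (ms ^+ (e.-2 * degp g) * g).
    by rewrite -sub_sub // aE rmorphM /= -/h; apply: dvd_mulr.
  by have [_ _ xP] := hprime_prime hx; case/xP=> [/xmsk|/ng].
exists x => // g hg; rewrite /op vms mulr0 subr0; congr Posz.
have [g' gE ng'] := vp_spec hx (hom_neq0 hg).
have [hxk hg'] : hom (x ^+ vp x g) /\ hom g' by apply: hom_divl; rewrite -gE.
rewrite {1}gE rmorphM rmorphXn /= vpM ?expf_neq0 ?sub_neq0 //.
by rewrite vpX ?sub_neq0 // vx muln1 v0 // addn0.
Qed.

End Involution.

(** * The Hadamard inverse and the cofactor involution *)

Section Weights.
Variable q : nat.
Implicit Types W : 'M[nat]_q.

Definition wm W (m : 'X_{1..q * q}) : nat := (\sum_k m k * mxvec W 0%R k)%N.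

Lemma wm0 W : wm W 0%MM = 0%N.
Proof. by rewrite /wm big1 // => k _; rewrite mnm0E. Qed.
Lemma wmD W : {morph wm W : m1 m2 / (m1 + m2)%MM >-> (m1 + m2)%N}.
Proof. by move=> m1 m2; rewrite /wm -big_split /=; apply: eq_bigr => k _; rewrite mnmDE mulnDl. Qed.
HB.instance Definition _ W := isMeasure.Build (q * q)%N (wm W) (wm0 W) (wmD W).

Lemma wmU W i j : wm W U_(mxvec_index i j)%MM = W i j.
Proof.
rewrite /wm (bigD1 (mxvec_index i j)) //= mnm1E eqxx mul1n mxvecE big1 ?addn0 // => k kn.
by rewrite mnm1E eq_sym (negPf kn).
Qed.

Lemma sum_mxvec (R : Type) (idx : R) (op : Monoid.com_law idx) (E : 'I_(q * q) -> R) :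
  \big[op/idx]_k E k = \big[op/idx]_i \big[op/idx]_j E (mxvec_index i j).
Proof.
rewrite pair_bigA (reindex _ (curry_mxvec_bij q q)) /=.
by apply: eq_bigr => -[i j].
Qed.

(** Weight of the one-parameter group that scales row [a] and column [b] by the same factor; the
    entry [(a, b)] is scaled twice. *)
Definition Tw a b : 'M[nat]_q := \matrix_(i, j) ((i == a) + (j == b))%N.
Definition Rw a : 'M[nat]_q := \matrix_(i, j) nat_of_bool (i == a).
Definition Cw b : 'M[nat]_q := \matrix_(i, j) nat_of_bool (j == b).
Definition Dw a b : 'M[nat]_q := \matrix_(i, j) nat_of_bool ((i == a) && (j == b)).

Lemma wm_le W W' m : (forall i j, W i j <= W' i j)%N -> (wm W m <= wm W' m)%N.
Proof.
move=> le; apply: leq_sum => k _; rewrite leq_mul2l; apply/orP; right.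
by case/mxvec_indexP: k => i j; rewrite !mxvecE.
Qed.

End Weights.

Section MDeg.
Variables (F : fieldType) (n : nat) (mf : measure n).
Local Notation A := {mpoly F[n]}.
Implicit Types f g : A.

Definition wdeg f : nat := (mmeasure mf f).-1.

Lemma mmeasureS f : f != 0 -> mmeasure mf f = (wdeg f).+1.
Proof. by move=> f0; rewrite /wdeg prednK // lt0n mmeasure_poly_eq0. Qed.

Lemma wdegM f g : f != 0 -> g != 0 -> wdeg (f * g) = (wdeg f + wdeg g)%N.
Proof.
by move=> f0 g0; rewrite {1}/wdeg mmeasureM // (mmeasureS f0) (mmeasureS g0) addSn addnS.
Qed.

Lemma wdegX f k : f != 0 -> wdeg (f ^+ k) = (k * wdeg f)%N.
Proof.
move=> f0; elim: k => [|k IHk]; first by rewrite expr0 /wdeg mmeasure1.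
by rewrite exprS wdegM ?expf_neq0 // IHk.
Qed.

Lemma wdeg_mnm f m : m \in msupp f -> (mf m <= wdeg f)%N.
Proof.
move=> mf0'; have f0 : f != 0 by apply: contraTneq mf0' => ->; rewrite msupp0.
by rewrite -ltnS -mmeasureS //; apply: mmeasure_mnm_lt.
Qed.

Lemma wdeg_leP f d : {in msupp f, forall m, mf m <= d}%N -> (wdeg f <= d)%N.
Proof.
move=> h; rewrite /wdeg mmeasureE -ltnS.
have : (\max_(m <- msupp f) (mf m).+1 <= d.+1)%N.
  by apply/bigmax_leqP_seq => m mf0' _; rewrite ltnS h.
by case: (\max_(_ <- _) _)%N.
Qed.

Lemma wdeg_homog f d : f != 0 -> f \is d.-homog for mf -> wdeg f = d.
Proof. by move=> f0 hf; apply: (dhomog_uniq f0 (dhomog_msize hf) hf). Qed.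

Lemma wdeg_sum d (I : Type) (r : seq I) (P : pred I) (E : I -> A) :
  (forall i, P i -> wdeg (E i) <= d)%N -> (wdeg (\sum_(i <- r | P i) E i)%R <= d)%N.
Proof.
move=> h; apply: (big_ind (fun f => wdeg f <= d)%N) => //.
  by rewrite /wdeg mmeasure0.
move=> f g; rewrite /wdeg => hf hg.
have := mmeasureD_le mf f g; move: hf hg; lia.
Qed.

Lemma wdegZ c f : (wdeg (c *: f) <= wdeg f)%N.
Proof.
have [->|c0] := eqVneq c 0; first by rewrite scale0r /wdeg mmeasure0.
by rewrite /wdeg mmeasureZ.
Qed.

Lemma dhomog_bigprod (I : Type) (r : seq I) (P : pred I) (E : I -> A) (D : I -> nat) :
  (forall i, P i -> E i \is (D i).-homog for mf) ->
  \prod_(i <- r | P i) E i \is (\sum_(i <- r | P i) D i)%N.-homog for mf.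
Proof.
move=> h; apply: (big_ind2 (fun (f : A) k => f \is k.-homog for mf)) => //.
  exact: dhomog1.
by move=> f1 d1 f2 d2; apply: dhomogM.
Qed.

Lemma dhomog_sign (s : bool) f d : f \is d.-homog for mf ->
  (-1) ^+ s * f \is d.-homog for mf.
Proof. by move=> hf; rewrite mulr_sign; case: s => //; rewrite dhomogN. Qed.

End MDeg.

Section Maps.
Variables (F : fieldType) (q : nat).
Local Notation A := {mpoly F[q * q]}.
Local Notation x := (@xv F q).
Implicit Types (g : A).

Definition Xm : 'M[A]_q := \matrix_(i, j) x i j.
Definition mJ : A := \prod_(k < q * q) 'X_k.
Definition Jm : 'M[A]_q := \matrix_(i, j) \prod_(k < q * q | k != mxvec_index i j) 'X_k.
Definition dC : A := \det Xm.
(** Cofactors placed without transposition, so that the pole of an entry stays at the same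
    position. *)
Definition Cm : 'M[A]_q := (\adj Xm)^T.

Lemma map_Xm (M : 'M[A]_q) : map_mx (sub M) Xm = M.
Proof. by apply/matrixP => i j; rewrite !mxE sub_xv. Qed.

Lemma CmE i j : Cm i j = cofactor Xm i j.
Proof. by rewrite !mxE. Qed.

Lemma x_neq0 i j : x i j != 0.
Proof. by rewrite -msupp_eq0 msuppX. Qed.

Lemma JmM i j : Jm i j * x i j = mJ.
Proof. by rewrite mxE mulrC /mJ [in RHS](bigD1 (mxvec_index i j)) //=. Qed.

Lemma mJ_neq0 : mJ != 0.
Proof.
by apply/prodf_neq0 => k _; rewrite -msupp_eq0 msuppX.
Qed.

Section Eval.
Variables (S : comNzRingType) (f : {rmorphism F -> S}) (M : 'M[S]_q).

Definition ev : A -> S := mmap f (fun k => mxvec M 0 k).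
HB.instance Definition _ := GRing.RMorphism.on ev.

Lemma ev_xv i j : ev (x i j) = M i j.
Proof. by rewrite /ev /xv mmapX mmap1U mxvecE. Qed.

Lemma ev_C c : ev c%:MP = f c.
Proof. by rewrite /ev mmapC. Qed.

Lemma map_ev_Xm : map_mx ev Xm = M.
Proof. by apply/matrixP => i j; rewrite [LHS]mxE [X in ev X]mxE ev_xv. Qed.

Lemma ev_dC : ev dC = \det M.
Proof. by rewrite /dC -det_map_mx map_ev_Xm. Qed.

Lemma ev_Cm i j : ev (Cm i j) = cofactor M i j.
Proof. by rewrite CmE -cofactor_map_mx map_ev_Xm. Qed.
End Eval.

Lemma dC_neq0 : dC != 0.
Proof.
apply: contraTneq (oner_neq0 F) => /(congr1 (ev idfun 1%:M)).
by rewrite ev_dC det1 raddf0 => ->; rewrite eqxx.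
Qed.

Lemma sub_dC (M : 'M[A]_q) : sub M dC = \det M.
Proof. by rewrite /dC -det_map_mx map_Xm. Qed.

Lemma sub_Cm (M : 'M[A]_q) : map_mx (sub M) Cm = (\adj M)^T.
Proof. by rewrite /Cm -map_trmx map_mx_adj map_Xm. Qed.

Lemma det_adjE (R : idomainType) (M : 'M[R]_q) : (0 < q)%N ->
  \det M != 0 -> \det (\adj M) = \det M ^+ q.-1.
Proof.
move=> q0 d0; apply: (mulfI d0); rewrite -det_mulmx mul_mx_adj det_scalar.
by rewrite -exprS prednK.
Qed.

Lemma adj_adj (R : idomainType) (M : 'M[R]_q) : (1 < q)%N ->
  \det M != 0 -> \adj (\adj M) = \det M ^+ q.-2 *: M.
Proof.
move=> q1 d0; have q0 := ltnW q1.
have e : \det M *: \adj (\adj M) = \det M *: (\det M ^+ q.-2 *: M).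
  rewrite -mul_scalar_mx -mul_mx_adj -mulmxA mul_mx_adj det_adjE // mul_mx_scalar.
  by rewrite scalerA -exprS; congr (_ ^+ _ *: _); case: (q) q1 => [|[|]].
apply/matrixP => i j; have /matrixP/(_ i j) := e; rewrite !mxE.
exact: mulfI.
Qed.

Section Homog.
Variable mf : measure (q * q).
Let w i j := mf U_(mxvec_index i j)%MM.

Lemma x_homog i j : x i j \is (w i j).-homog for mf.
Proof. by rewrite dhomogX. Qed.

Lemma mJ_homog : mJ \is (\sum_k mf U_(k)%MM)%N.-homog for mf.
Proof. by apply: dhomog_bigprod => k _; rewrite dhomogX. Qed.

Lemma Jm_homog i j :
  Jm i j \is (\sum_(k | k != mxvec_index i j) mf U_(k)%MM)%N.-homog for mf.
Proof. by rewrite mxE; apply: dhomog_bigprod => k _; rewrite dhomogX. Qed.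

Lemma dC_homog d : (forall s : 'S_q, \sum_i w i (s i) = d)%N -> dC \is d.-homog for mf.
Proof.
move=> h; apply: rpred_sum => s _; apply: dhomog_sign; rewrite -(h s).
by apply: dhomog_bigprod => i _; rewrite mxE x_homog.
Qed.

Lemma Cm_homog i j d :
  (forall s : 'S_q, s i = j -> \sum_(k | i != k) w k (s k) = d)%N ->
  Cm i j \is d.-homog for mf.
Proof.
move=> h; rewrite CmE expand_cofactor.
apply: rpred_sum => s /eqP sij; apply: dhomog_sign; rewrite -(h s sij).
by apply: dhomog_bigprod => k _; rewrite mxE x_homog.
Qed.
End Homog.

Hypothesis q1 : (1 < q)%N.

Lemma J_involutive : involutive Jm mJ (q * q).
Proof.
have N1 : (1 < q * q)%N by case: (q) q1 => [|[|k]] //.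
have hd : mJ \is (q * q).-homog.
  have := mJ_homog mdeg; rewrite (eq_bigr (fun=> 1%N)) => [|k _]; last exact: mdeg1.
  by rewrite sum_nat_const card_ord muln1.
have sm : sub Jm mJ = mJ ^+ (q * q).-1.
  apply: (mulIf mJ_neq0); rewrite -exprSr prednK ?(ltnW N1) //.
  rewrite {1}/mJ rmorph_prod /= -{2}/mJ -big_split /=.
  transitivity (\prod_(k < q * q) mJ); last by rewrite prodr_const card_ord.
  apply: eq_bigr => k _.
  case/mxvec_indexP: k => i j; rewrite -[sub _ _]/(sub Jm (x i j)) sub_xv; exact: JmM.
split=> //.
- by split; [exact: mJ_neq0 | exists (q * q)%N].
- move=> i j; have := Jm_homog mdeg i j.
  rewrite (eq_bigr (fun=> 1%N)) => [|k _]; last exact: mdeg1.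
  by rewrite sum_nat_const cardC1 card_ord muln1.
- move=> i j; have J0 : Jm i j != 0.
    by apply: contraNneq mJ_neq0 => e; rewrite -(JmM i j) e mul0r.
  apply: (mulIf J0); rewrite -mulrA (mulrC (x i j)) JmM -exprSr.
  rewrite (_ : (q * q).-2.+1 = (q * q).-1); last by case: (q * q)%N N1 => [|[|]].
  have <- : sub Jm (Jm i j) * sub Jm (x i j) = mJ ^+ (q * q).-1 by rewrite -rmorphM /= JmM sm.
  by rewrite sub_xv.
Qed.

Lemma C_involutive : involutive Cm dC q.
Proof.
have q0 := ltnW q1.
have hd : dC \is q.-homog.
  apply: dC_homog => s; rewrite (eq_bigr (fun=> 1%N)) => [|k _]; last exact: mdeg1.
  by rewrite sum_nat_const card_ord muln1.
split=> //.
- by split; [exact: dC_neq0 | exists q].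
- move=> i j; apply: Cm_homog => s _.
  rewrite (eq_bigr (fun=> 1%N)) => [|k _]; last exact: mdeg1.
  rewrite sum_nat_const muln1 (eq_card (B := predC1 i)) ?cardC1 ?card_ord //.
  by move=> k; rewrite !inE eq_sym.
- by rewrite sub_dC det_tr det_adjE ?dC_neq0.
- move=> i j; have /matrixP/(_ i j) := sub_Cm Cm.
  rewrite mxE => ->; rewrite /Cm -trmx_adj trmxK adj_adj ?dC_neq0 //.
  by rewrite !mxE.
Qed.

End Maps.

Section WeightedInvolution.
Variables (F : fieldType) (q : nat).
Local Notation A := {mpoly F[q * q]}.
Variables (sg : 'M[A]_q) (ms : A) (e : nat).
Hypothesis I : involutive sg ms e.
Variables (W : 'M[nat]_q) (K : nat).
Hypothesis hW : forall i j, (W i j <= K)%N.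
Hypothesis hsg : forall i j, sg i j \is (K - W i j).-homog for (wm W).
Hypothesis hms : ms \is K.-homog for (wm W).

Lemma wm_compl (m : 'X_{1..q * q}) : (\sum_k m k * mxvec (\matrix_(i, j) (K - W i j)%N) 0%R k + wm W m = mdeg m * K)%N.
Proof.
rewrite /wm -big_split /= mdegE big_distrl /=; apply: eq_bigr => k _.
by case/mxvec_indexP: k => i j; rewrite !mxvecE mxE -mulnDr subnK.
Qed.

Lemma sub_whomog g k : hom g -> g \is k.-homog for (wm W) ->
  (k <= degp g * K)%N /\ sub sg g \is (degp g * K - k).-homog for (wm W).
Proof.
move=> hg /dhomogP hk; have /dhomogP hd := hom_degp hg.
have key m : m \in msupp g ->
    (\sum_k m k * mxvec (\matrix_(i, j) (K - W i j)%N) 0%R k + k = degp g * K)%N.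
  by move=> mg; rewrite -(hk _ mg) -(hd _ mg) wm_compl.
split.
  by rewrite -(key _ (mlead_supp (hom_neq0 hg))) leq_addl.
apply: (sub_homog (K := \matrix_(i, j) (K - W i j)%N)) => [i j|m mg].
  by rewrite mxE.
by rewrite -(key _ mg) addnK.
Qed.

(** Weight [k] becomes [degp g * K - k], and the normalisation in [op] removes [degp g * K]. Hence
    twists change sign at every step. *)
Lemma op_wdeg g k : hom g -> g \is k.-homog for (wm W) ->
  op sg ms (fun g => (wdeg (wm W) g)%:Z) g = - (wdeg (wm W) g)%:Z.
Proof.
move=> hg hk; have [le hk'] := sub_whomog hg hk; rewrite /op.
rewrite (wdeg_homog (sub_neq0 I hg) hk') (wdeg_homog (hom_neq0 (inv_ms I)) hms).
by rewrite (wdeg_homog (hom_neq0 hg) hk) -PoszM; lia.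
Qed.

End WeightedInvolution.

(** * Lower bounds from the values on the variables *)

Section Ultra.
Variables (F : fieldType) (q : nat).
Local Notation A := {mpoly F[q * q]}.
Implicit Types (V : A -> int).

(** The common degree [d] of the summands lets the property pass through [op], which subtracts a
    multiple of the degree. *)
Definition ultra V := forall d k (I : eqType) (r : seq I) (E : I -> A),
  {in r, forall i, E i != 0 -> E i \is d.-homog /\ k <= V (E i)} ->
  \sum_(i <- r) E i != 0 -> k <= V (\sum_(i <- r) E i).

Lemma ultra_vp (p : A) : hprime p -> ultra (fun g => (vp p g)%:Z).
Proof.
move=> hp d k I r E hE s0; case: k hE => [k|k] hE //.
rewrite lez_nat (vpE (hprime_prime hp)) big_seq.
apply: val_sum_ge => [i ir Ei0|]; last by rewrite -big_seq.
by have [_] := hE _ ir Ei0; rewrite lez_nat (vpE (hprime_prime hp)).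
Qed.

Lemma ultra_op (sg : 'M[A]_q) ms e V : involutive sg ms e -> ultra V -> ultra (op sg ms V).
Proof.
move=> I uV d k J r E hE s0; rewrite /op.
have hS : \sum_(i <- r) E i \is d.-homog.
  rewrite big_seq; apply: rpred_sum => i ir.
  by have [->|/(hE _ ir)[]//] := eqVneq (E i) 0; apply: dhomog0.
rewrite (degp_homog s0 hS) lerBrDr raddf_sum /=; apply: (uV (d * e.-1)%N).
  move=> i ir s'0; have Ei0 : E i != 0 by apply: contraNneq s'0 => ->; rewrite raddf0.
  have [hd hk] := hE _ ir Ei0; split; first exact: sub_dhomog I _ _ hd.
  by rewrite -lerBrDr; move: hk; rewrite /op (degp_homog Ei0 hd).
rewrite -raddf_sum; apply: (sub_neq0 I); split=> //; by exists d.
Qed.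

Lemma homC (c : F) : c != 0 -> hom (c%:MP : A).
Proof.
move=> c0; split; first by rewrite mpolyC_eq0.
by exists 0%N; rewrite dhomogE msuppC (negPf c0) /= mdeg0.
Qed.

(** An order function is bounded below by the monomial valuation with the same values on the
    variables. *)
Lemma ultra_mnm V (g : A) k : ultra V -> additive_on (@hom F (q * q)) V -> (forall c, c != 0 -> V c%:MP = 0) ->
  hom g -> {in msupp g, forall m : 'X_{1..q * q}, k <= \sum_i (m i)%:Z * V 'X_i} -> k <= V g.
Proof.
move=> uV aV V0 hg hk; have hd := hom_degp hg.
rewrite [g]mpolyE; apply: (uV (degp g)); last by rewrite -mpolyE hom_neq0.
move=> m mg c0; have gm0 : g@_m != 0 by rewrite -mcoeff_msupp.
have hX i : hom ('X_i : A).
  by split; [rewrite -msupp_eq0 msuppX | exists 1%N; rewrite dhomogX /= mdeg1].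
split; first by apply: dhomogZ; rewrite dhomogX; move/dhomogP: hd => ->.
have aP (r : seq 'I_(q * q)) : V (\prod_(i <- r) 'X_i ^+ m i) = \sum_(i <- r) (m i)%:Z * V 'X_i.
  elim: r => [|i r IHr]; first by rewrite !big_nil -mpolyC1 V0 ?oner_neq0.
  rewrite !big_cons aV ?IHr; [|exact: homX|by apply: hom_prod => j _; apply: homX].
  by congr (_ + _); apply: additive_onX.
rewrite -mul_mpolyC aV; first by rewrite V0 // add0r mpolyXE_id aP; apply: hk.
  exact: homC.
by rewrite mpolyXE_id; apply: hom_prod => i _; apply: homX.
Qed.

End Ultra.

Section Coordinate.
Variables (F : fieldType) (q : nat).
Local Notation A := {mpoly F[q * q]}.
Local Notation x := (@xv F q).
Hypothesis q1 : (1 < q)%N.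
Variables (a b : 'I_q).
Implicit Types g : A.

Let k := mxvec_index a b.

Lemma dvd_xvP g : dvd (x a b) g <-> {in msupp g, forall m : 'X_{1..q * q}, 0 < m k}%N.
Proof.
split=> [[h ->] m|hg].
  rewrite /xv mulrC (perm_mem (msuppMX _ _)) => /mapP [m' _ ->].
  by rewrite mnmDE mnm1E eqxx addn_gt0.
rewrite [g]mpolyE big_seq; apply: (big_ind (fun f => dvd (x a b) f)).
- exact: dvd0.
- exact: dvd_add.
move=> m /hg mk; exists (g@_m *: 'X_[m - U_(k)]); rewrite /xv -scalerAr -mpolyXD.
by rewrite addmC submK //; apply/mnm_lepP => i; rewrite mnm1E; case: eqP => [<-|].
Qed.

(** Setting [x a b] to 0 is a ring morphism into a domain whose kernel consists of the multiples of
    [x a b]; this makes [x a b] prime. *)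
Definition kill : A -> A := sub (\matrix_(i, j) if (i == a) && (j == b) then 0 else x i j).
HB.instance Definition _ := GRing.RMorphism.on kill.

Lemma killX (m : 'X_{1..q * q}) : kill 'X_[m] = if m k == 0%N then 'X_[m] else 0.
Proof.
rewrite /kill /sub comp_mpolyX (bigD1 k) //= tnth_mktuple mxvecE mxE !eqxx /=.
rewrite expr0n; case: eqP => [mk0|_]; last by rewrite mul0r.
rewrite mul1r [RHS]mpolyXE_id [RHS](bigD1 k) //= mk0 expr0 mul1r.
apply: eq_bigr => i; case/mxvec_indexP: i => i j ne; rewrite tnth_mktuple mxvecE mxE.
by case: andP => // -[/eqP ia /eqP jb]; rewrite ia jb eqxx in ne.
Qed.

Lemma dvd_kill g : dvd (x a b) g <-> kill g = 0.
Proof.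
rewrite dvd_xvP; split=> [hg|k0 m mg].
  rewrite [g]mpolyE raddf_sum big_seq big1 //= => m /hg mk.
  by rewrite /kill linearZ /= -/(kill _) killX eqn0Ngt mk scaler0.
rewrite lt0n; apply/negP => /eqP mk0.
have /mpolyP/(_ m) := k0; rewrite mcoeff0 {1}[g]mpolyE (raddf_sum kill) (raddf_sum (mcoeff m)) /=.
have E m' : (kill (g@_m' *: 'X_[m']))@_m = if m' == m then g@_m else 0.
  rewrite /kill linearZ /= -/(kill _) killX mcoeffZ.
  have [->|ne] := eqVneq m' m; first by rewrite mk0 eqxx mcoeffX eqxx mulr1.
  by case: ifP; rewrite ?mcoeffX ?(negPf ne) ?mcoeff0 mulr0.
under eq_bigr => m' _ do rewrite E.
rewrite (bigD1_seq m) ?msupp_uniq //= eqxx big1 ?addr0 => [/eqP|m' /negPf->//].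
by rewrite mcoeff_eq0 mg.
Qed.

Lemma x_hprime : hprime (x a b).
Proof.
have x0 : x a b != 0 by rewrite /xv -msupp_eq0 msuppX.
split; last by exists 1%N; rewrite dhomogX /= mdeg1.
  split=> //.
    by apply/mpoly_unitP => -[c c0 /(congr1 (@mcoeff _ _ U_(k)%MM))];
      rewrite mcoeffX eqxx mcoeffC mnm1_eq0 mulr0 => /eqP; rewrite oner_eq0.
  move=> f g; rewrite !dvd_kill rmorphM => /eqP; rewrite mulf_eq0.
  by case/orP=> /eqP; [left|right].
by rewrite mleadXm mcoeffX eqxx.
Qed.

Definition dv g : nat := wdeg (wm (Dw a b)) g.

Lemma wm_Dw (m : 'X_{1..q * q}) : wm (Dw a b) m = m k.
Proof.
rewrite /wm (bigD1 k) //= mxvecE mxE !eqxx muln1 big1 ?addn0 // => i.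
case/mxvec_indexP: i => i j ne; rewrite mxvecE mxE.
by case: andP => [[/eqP ia /eqP jb]|]; [rewrite ia jb eqxx in ne|rewrite muln0].
Qed.

Lemma vp_x_le g m : g != 0 -> m \in msupp g -> (vp (x a b) g <= m k)%N.
Proof.
move=> g0 mg; have [h gE _] := vp_spec x_hprime g0.
move: mg; rewrite {1}gE /xv mpolyXn mulrC (perm_mem (msuppMX _ _)) => /mapP [m' _ ->].
by rewrite mnmDE mulmnE mnm1E eqxx mul1n leq_addr.
Qed.

End Coordinate.

Section WDegSub.
Variables (F : fieldType) (q : nat) (mf : measure (q * q)).
Local Notation A := {mpoly F[q * q]}.

Lemma wdegM_le (f g : A) : (wdeg mf (f * g) <= wdeg mf f + wdeg mf g)%N.
Proof.
have [->|f0] := eqVneq f 0; first by rewrite mul0r /wdeg mmeasure0.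
have [->|g0] := eqVneq g 0; first by rewrite mulr0 /wdeg mmeasure0.
by rewrite wdegM.
Qed.

Lemma wdeg_sub_le (M : 'M[A]_q) (W : 'M[nat]_q) (g : A) d :
  (forall i j, wdeg mf (M i j) <= W i j)%N ->
  {in msupp g, forall m, wm W m <= d}%N -> (wdeg mf (sub M g) <= d)%N.
Proof.
move=> hM hg; rewrite [g]mpolyE raddf_sum /= big_seq; apply: wdeg_sum => m /hg md.
rewrite linearZ /=; apply: leq_trans (wdegZ _ _ _) (leq_trans _ md).
rewrite /sub comp_mpolyX /wm.
apply: (big_ind2 (fun (f : A) k => wdeg mf f <= k)%N) => [|f1 d1 f2 d2 h1 h2|k _].
- by rewrite /wdeg mmeasure1.
- by apply: leq_trans (wdegM_le _ _) (leq_add h1 h2).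
rewrite tnth_mktuple; case/mxvec_indexP: k => i j; rewrite !mxvecE.
elim: (m _) => [|k IHk]; first by rewrite expr0 /wdeg mmeasure1.
rewrite exprS mulSn; apply: leq_trans (wdegM_le _ _) (leq_add _ IHk); exact: hM.
Qed.

End WDegSub.

Lemma wdeg_mono (F : fieldType) q (W W' : 'M[nat]_q) (g : {mpoly F[q * q]}) :
  (forall i j, W i j <= W' i j)%N -> (wdeg (wm W) g <= wdeg (wm W') g)%N.
Proof.
move=> h; apply: wdeg_leP => m mg; apply: leq_trans (@wdeg_mnm _ _ (wm W') _ _ mg).
exact: wm_le.
Qed.

(** * Hyperplanes and poles of entries under the two involutions *)

Section Exchange.
Variables (F : fieldType) (q : nat).
Local Notation A := {mpoly F[q * q]}.
Local Notation x := (@xv F q).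
Hypothesis q1 : (1 < q)%N.
Implicit Types g : A.

Let IJ := J_involutive F q1.
Let IC := C_involutive F q1.

Definition VJ := op (Jm F q) (mJ F q).
Definition VC := op (Cm F q) (dC F q).

Lemma mJX : mJ F q = 'X_[[multinom 1%N | _ < q * q]].
Proof. by rewrite mpolyXE_id; apply: eq_bigr => k _; rewrite mnmE expr1. Qed.

Lemma hom_x i j : hom (x i j).
Proof. by split; [exact: x_neq0 | exists 1%N; rewrite dhomogX /= mdeg1]. Qed.

Lemma hom_mJ : hom (mJ F q). Proof. exact: inv_ms IJ. Qed.
Lemma hom_dC : hom (dC F q). Proof. exact: inv_ms IC. Qed.
Lemma hom_Jm i j : hom (Jm F q i j).
Proof. by rewrite -(sub_xv (Jm F q)); apply/(sub_hom IJ)/hom_x. Qed.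
Lemma hom_Cm i j : hom (Cm F q i j).
Proof. by rewrite -(sub_xv (Cm F q)); apply/(sub_hom IC)/hom_x. Qed.

Lemma degp_x i j : degp (x i j) = 1%N.
Proof. by apply: degp_homog; [exact: x_neq0 | rewrite dhomogX /= mdeg1]. Qed.

Section AtEntry.
Variables a b : 'I_q.

Lemma wdeg_x W i j : wdeg (wm W) (x i j) = W i j.
Proof. by apply: wdeg_homog; [exact: x_neq0 | rewrite dhomogX /= wmU]. Qed.

Lemma dv_x i j : dv a b (x i j) = ((i == a) && (j == b)).
Proof. by rewrite /dv wdeg_x mxE. Qed.

Lemma dvM f g : f != 0 -> g != 0 -> dv a b (f * g) = (dv a b f + dv a b g :> nat)%N.
Proof. exact: wdegM. Qed.

Lemma dvX (f : A) k : f != 0 -> dv a b (f ^+ k) = (k * dv a b f)%N.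
Proof. exact: wdegX. Qed.

Lemma dv_mJ : dv a b (mJ F q) = 1%N.
Proof.
rewrite /dv mJX; apply: wdeg_homog; first by rewrite -mJX mJ_neq0.
by rewrite dhomogX /= wm_Dw mnmE.
Qed.

Lemma dv_Jm i j : dv a b (Jm F q i j) = ~~ ((i == a) && (j == b)).
Proof.
have := dv_mJ; rewrite -(JmM F i j) /dv wdegM ?x_neq0 ?(hom_neq0 (hom_Jm _ _)) //.
by rewrite -!/(dv a b _) dv_x; case: (_ && _) => /=; lia.
Qed.

Lemma vp_x i j : vp (x a b) (x i j) = ((i == a) && (j == b)).
Proof.
have [/andP[/eqP-> /eqP->]|ne] := boolP (_ && _); first by rewrite vp_self //; apply: x_hprime.
apply/eqP; rewrite -leqn0; have := @vp_x_le F q a b (x i j) U_(mxvec_index i j)%MM (x_neq0 F i j).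
rewrite msuppX mem_head => /(_ isT); rewrite mnm1E.
have -> // : (mxvec_index i j == mxvec_index a b) = false.
apply: contraNF ne => /eqP e; have [g gK _] := curry_mxvec_bij q q.
have := gK (i, j) isT; rewrite /= e -[mxvec_index a b]/(uncurry (@mxvec_index _ _) (a, b)) gK //.
by case=> <- <-; rewrite !eqxx.
Qed.

Lemma vp_x_mJ : vp (x a b) (mJ F q) = 1%N.
Proof.
apply/eqP; rewrite eqn_leq; apply/andP; split.
  have := @vp_x_le F q a b (mJ F q) [multinom 1%N | _ < q * q] (mJ_neq0 F q).
  by rewrite mnmE; apply; rewrite mJX msuppX mem_head.
apply/vp_gt0; [exact: x_hprime|exact: mJ_neq0|].
by rewrite -(JmM F a b); apply/dvd_mull/dvd_refl.
Qed.

Lemma vp_x_Jm i j : vp (x a b) (Jm F q i j) = ~~ ((i == a) && (j == b)).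
Proof.
have := vp_x_mJ; rewrite -(JmM F i j) (vpM (x_hprime F a b)) ?x_neq0 ?(hom_neq0 (hom_Jm _ _)) //.
by rewrite vp_x; case: (_ && _) => /=; lia.
Qed.

Lemma vp_C p c : c != 0 -> vp p (c%:MP : A) = 0%N.
Proof.
move=> c0; rewrite /vp; case: pselect => // pp; apply: val_ndvd => h.
have uc : c%:MP_[q * q] \is a GRing.unit by apply/mpoly_unitP; exists c.
by case: pp => _ /negP[]; apply: dvd_unit uc h.
Qed.

Lemma degp_C c : degp (c%:MP : A) = 0%N.
Proof. by rewrite /degp msizeC; case: eqP. Qed.

Lemma op_C sg ms V c : op sg ms V (c%:MP : A) = V c%:MP.
Proof. by rewrite /op subC degp_C mul0r subr0. Qed.

(* [- dv a b] is the valuation at the pole of [x a b]; the substitution of [1 / x a b] for [x a b]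
   exchanges it with the order of vanishing along [x a b = 0]. *)
Lemma VJ_vp_x g : hom g -> VJ (fun g => (vp (x a b) g)%:Z) g = - (dv a b g)%:Z.
Proof.
move=> hg; have hx := x_hprime F a b; apply/eqP; rewrite eq_le; apply/andP; split.
  have hS := sub_hom IJ hg.
  (* Every entry of [Jm] except the one at [(a, b)] has degree 1 in [x a b]. The double substitution
     is [g] times a power of [mJ], so its degree is known and the bound becomes one on the order of
     [sub (Jm F q) g]. *)
  have le : (dv a b (sub (Jm F q) (sub (Jm F q) g)) <= degp (sub (Jm F q) g) - vp (x a b) (sub (Jm F q) g))%N.
    apply: (wdeg_sub_le (W := \matrix_(i, j) nat_of_bool (~~ ((i == a) && (j == b))))).
      by move=> i j; rewrite -/(dv a b _) dv_Jm mxE.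
    move=> m mS; have /dhomogP/(_ _ mS)/= <- := hom_degp hS.
    have := @vp_x_le F q a b _ _ (hom_neq0 hS) mS; rewrite -wm_Dw => lev.
    have : (wm (\matrix_(i, j) nat_of_bool (~~ ((i == a) && (j == b)))) m + wm (Dw a b) m = mdeg m)%N.
      rewrite /wm -big_split mdegE /=; apply: eq_bigr => k _; case/mxvec_indexP: k => i j.
      by rewrite !mxvecE !mxE -mulnDr; case: (_ && _); rewrite /= muln1.
    by move: lev; lia.
  move: le; rewrite (sub_sub IJ hg) /dv wdegM ?expf_neq0 ?mJ_neq0 ?hom_neq0 //.
  rewrite wdegX ?mJ_neq0 // -!/(dv a b _) dv_mJ muln1 (degp_sub IJ hg) /VJ /op vp_x_mJ.
  have N1 : (1 < q * q)%N by case: (q) q1 => [|[|k]].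
  have : (vp (x a b) (sub (Jm F q) g) <= degp (sub (Jm F q) g))%N.
    have [h hE _] := vp_spec hx (hom_neq0 hS).
    have h0 : h != 0 by apply: contraNneq (hom_neq0 hS) => h0; rewrite hE h0 mulr0.
    rewrite {2}hE degpM ?expf_neq0 ?x_neq0 // degpX ?x_neq0 // degp_x muln1.
    exact: leq_addr.
  rewrite (degp_sub IJ hg) mulr1; move: (vp _ _) (degp g) (dv a b g) => v d w.
  case: (q * q)%N N1 => [|[|N]] //= _; nia.
(* The reverse inequality: on each variable the pull-back equals minus the degree in [x a b], so
   comparing monomials suffices. *)
have aV := additive_op IJ (additive_vp hx).
apply: (ultra_mnm (ultra_op IJ (ultra_vp hx)) aV) => // [c c0|m mg].
  by rewrite op_C vp_C.
apply: (@le_trans _ _ (- (wm (Dw a b) m)%:Z)).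
  by rewrite lerN2 lez_nat; apply: wdeg_mnm.
rewrite /wm (big_morph Posz PoszD (erefl 0%:Z)) -sumrN; apply/eqP.
rewrite -subr_ge0 -sumrB big1 // => i _; case/mxvec_indexP: i => i j.
rewrite mxvecE mxE -[X in op _ _ _ X]/(x i j) /op sub_xv vp_x_Jm vp_x_mJ degp_x PoszM.
by case: (_ && _) => /=; ring.
Qed.

Lemma dv_dC : dv a b (dC F q) = 1%N.
Proof.
apply/eqP; rewrite eqn_leq; apply/andP; split.
  rewrite -[X in (_ <= X)%N](_ : wdeg (wm (Rw a)) (dC F q) = 1)%N; last first.
    apply: wdeg_homog; first exact: dC_neq0.
    apply: dC_homog => s; rewrite (bigD1 a) //= wmU mxE eqxx big1 // => i ia.
    by rewrite /= wmU mxE (negPf ia).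
  by apply: wdeg_mono => i j; rewrite !mxE; do 2 case: (_ == _).
rewrite lt0n; apply/negP => /eqP d0.
(* Row [a] of this permutation matrix has its only nonzero entry at [(a, b)]. If the determinant did
   not involve [x a b], clearing the row would leave its value, a sign, unchanged, yet make it 0. *)
pose M : 'M[F]_q := perm_mx (tperm a b).
pose M0 : 'M[F]_q := \matrix_(i, j) if i == a then 0 else M i j.
have : ev idfun M (dC F q) = ev idfun M0 (dC F q).
  rewrite [dC F q]mpolyE !raddf_sum /=; apply: eq_big_seq => m mg.
  rewrite -!mul_mpolyC !rmorphM /= !ev_C; congr (_ * _).
  have mk : m (mxvec_index a b) = 0%N.
    by apply/eqP; rewrite -leqn0 -wm_Dw -d0; apply: wdeg_mnm.
  rewrite /ev !mmapX /mmap1; apply: eq_bigr => k _.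
  case/mxvec_indexP: k => i j; rewrite !mxvecE [M0 i j]mxE.
  case: eqP => // ->; have [->|jb] := eqVneq j b; first by rewrite mk !expr0.
  by rewrite /M !mxE tpermL eq_sym (negPf jb).
rewrite !ev_dC det_perm (expand_det_row _ a) [RHS]big1 => [/eqP|j _].
  by rewrite signr_eq0.
by rewrite mxE eqxx mul0r.
Qed.

Lemma Rw_Cm i j : Cm F q i j \is (nat_of_bool (i != a)).-homog for (wm (Rw a)).
Proof.
apply: Cm_homog => s sij; have [->|ia] := eqVneq i a.
  by rewrite big1 // => k ka; rewrite /= wmU mxE eq_sym (negPf ka).
rewrite (bigD1 a) //= wmU mxE eqxx big1 // => k /andP[_ ka].
by rewrite /= wmU mxE (negPf ka).
Qed.

Lemma Cw_Cm i j : Cm F q i j \is (nat_of_bool (j != b)).-homog for (wm (Cw b)).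
Proof.
apply: Cm_homog => s sij; have [jb|jb] := eqVneq j b.
  rewrite big1 // => k ki; rewrite /= wmU mxE; case: eqP => // skb.
  by rewrite (_ : i = k) ?eqxx // in ki; apply: (@perm_inj _ s); rewrite sij skb.
pose k0 := (s^-1)%g b; have sk0 : s k0 = b by rewrite /k0 permKV.
rewrite (bigD1 k0) /=; last by apply: contraNneq jb => e; rewrite -sij e sk0.
rewrite /= wmU mxE sk0 eqxx big1 // => k /andP[_ kk].
rewrite /= wmU mxE; case: eqP => // skb; case/eqP: kk.
by apply: (@perm_inj _ s); rewrite skb sk0.
Qed.

Lemma Tw_Cm i j : Cm F q i j \is (2 - Tw a b i j).-homog for (wm (Tw a b)).
Proof.
have /dhomogP hR := Rw_Cm i j; have /dhomogP hC := Cw_Cm i j.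
apply/dhomogP => m mC /=; rewrite (_ : wm _ _ = wm (Rw a) m + wm (Cw b) m)%N.
  by rewrite (hR m mC : wm _ _ = _) (hC m mC : wm _ _ = _) mxE; do 2 case: eqP.
rewrite /wm -big_split; apply: eq_bigr => k _; case/mxvec_indexP: k => k l.
by rewrite !mxvecE !mxE /= -mulnDr.
Qed.

Lemma Tw_dC : dC F q \is 2.-homog for (wm (Tw a b)).
Proof.
apply: dC_homog => s.
transitivity (\sum_i ((i == a) + (s i == b)))%N.
  by apply: eq_bigr => i _; rewrite /= wmU mxE.
rewrite big_split /= (bigD1 a) //= eqxx big1 ?addn0 => [|i /negPf-> //].
rewrite (bigD1 ((s^-1)%g b)) //= permKV eqxx big1 // => i ni.
by case: eqP => // e; rewrite -e permK eqxx in ni.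
Qed.

Lemma sum_Tw : (\sum_k mxvec (Tw a b) 0%R k = 2 * q)%N.
Proof.
rewrite sum_mxvec /=.
transitivity (\sum_(i < q) (q * (i == a) + 1))%N.
  apply: eq_bigr => i _; transitivity (\sum_(j < q) ((i == a) + (j == b)))%N.
    by apply: eq_bigr => j _; rewrite mxvecE mxE.
  rewrite big_split /= sum_nat_const card_ord; congr (_ + _)%N.
  by rewrite (bigD1 b) //= eqxx big1 // => j /negPf->.
rewrite big_split /= sum_nat_const card_ord muln1 -big_distrr /=.
by rewrite (bigD1 a) //= eqxx big1 => [|j /negPf->//]; lia.
Qed.

Lemma Tw_le2 i j : (Tw a b i j <= 2)%N.
Proof. by rewrite mxE; do 2 case: eqP. Qed.

Lemma Tw_mJ : mJ F q \is (2 * q).-homog for (wm (Tw a b)).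
Proof.
rewrite mJX dhomogX /=; apply/eqP; rewrite -sum_Tw; apply: eq_bigr => k _.
by rewrite mnmE mul1n.
Qed.

Lemma Tw_Jm i j : Jm F q i j \is (2 * q - Tw a b i j).-homog for (wm (Tw a b)).
Proof.
have [d hd] : exists d, Jm F q i j \is d.-homog for (wm (Tw a b)).
  by eexists; apply: Jm_homog.
have := dhomogM hd (x_homog F (wm (Tw a b)) i j); rewrite JmM => h.
have e := dhomog_uniq (mJ_neq0 F q) h Tw_mJ.
by rewrite -e /= wmU addnK.
Qed.

(* The last term is a twist by the torus of row and column scalings. *)
Lemma VC_dv g k : hom g -> g \is k.-homog for (wm (Tw a b)) ->
  VC (fun g => - (dv a b g)%:Z) g = - (dv a b g)%:Z + (wdeg (wm (Tw a b)) g)%:Z.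
Proof.
(* The cofactor at [(i, j)] has degree at most 1 in [x a b], and 0 if [i = a] or [j = b]: this is 1,
   minus the weight [Tw a b], plus the weight [Dw a b]. The bound for [g] and the bound for
   [sub (Cm F q) g] together force equality. *)
have key h l : hom h -> h \is l.-homog for (wm (Tw a b)) ->
    (dv a b (sub (Cm F q) h) + l <= degp h + dv a b h)%N.
  move=> hh /dhomogP hl; have /dhomogP hd := hom_degp hh.
  have kP m : m \in msupp h ->
      (wm (\matrix_(i, j) nat_of_bool ((i != a) && (j != b))) m + l <= degp h + dv a b h)%N.
    move=> mh; have := @wdeg_mnm _ _ (wm (Dw a b)) _ _ mh; rewrite -/(dv a b h) /= => le.
    rewrite -(hl _ mh) -(hd _ mh) /=; apply: leq_trans (leq_add (leqnn _) le).
    rewrite /wm mdegE -!big_split /=; apply: leq_sum => k' _.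
    case/mxvec_indexP: k' => i j; rewrite !mxvecE !mxE -mulnDr -mulnS leq_mul2l.
    by apply/orP; right; do 2 case: (_ == _).
  have ml := leq_trans (leq_addl _ _) (kP _ (mlead_supp (hom_neq0 hh))).
  rewrite addnC -leq_subRL //; apply: (wdeg_sub_le (W := \matrix_(i, j) nat_of_bool ((i != a) && (j != b)))).
    move=> i j; rewrite mxE; apply: leq_trans (_ : minn (i != a) (j != b) <= _)%N.
      rewrite leq_min -{1}(wdeg_homog (hom_neq0 (hom_Cm i j)) (Rw_Cm i j)).
      rewrite -{1}(wdeg_homog (hom_neq0 (hom_Cm i j)) (Cw_Cm i j)).
      by rewrite !wdeg_mono // => k' l'; rewrite !mxE; do 2 case: (_ == _).
    by do 2 case: (_ == _).
  by move=> m /kP; rewrite addnC -leq_subRL.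
move=> hg hk; have [le hS] := sub_whomog Tw_le2 Tw_Cm hg hk.
have := key _ _ hg hk; have := key _ _ (sub_hom IC hg) hS.
rewrite (sub_sub IC hg) dvM ?expf_neq0 ?dC_neq0 ?hom_neq0 //.
rewrite dvX ?dC_neq0 // dv_dC muln1 (degp_sub IC hg) /VC /op dv_dC.
rewrite (wdeg_homog (hom_neq0 hg) hk); move: le.
move: (dv _ _ _) (dv _ _ _) (degp g) => u v d.
case: (q) q1 => [|[|p]] //= _; nia.
Qed.

End AtEntry.

End Exchange.

(** * The locus of rank-one matrices *)

Section DetLemmas.
Variable R : idomainType.

(** Two block eliminations of one bordered matrix, from the left and from the right; the extra
    factor [a] avoids a division. *)
Lemma det_scalar_const n (a b : R) : a != 0 ->
  a * \det (a%:M + const_mx b : 'M_n) = a ^+ n * (a + n%:R * b).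
Proof.
move=> a0; pose u : 'cV[R]_n := const_mx 1; pose v : 'rV[R]_n := const_mx b.
pose B : 'M_(1 + n) := block_mx 1%:M (- v) u a%:M.
have detB : \det B = \det (a%:M + const_mx b : 'M_n).
  rewrite -[LHS]mul1r -(_ : \det (block_mx 1%:M 0 (- u) 1%:M : 'M_(1 + n)) = 1); last first.
    by rewrite det_lblock !det1 mulr1.
  rewrite -det_mulmx mulmx_block !mul1mx !mul0mx !addr0 mulmx1 addNr.
  rewrite mulNmx mulmxN opprK det_ublock det1 mul1r addrC.
  congr (\det (_ + _)); apply/matrixP => i j; rewrite !mxE big_ord1 !mxE; ring.
have : \det B * a = (a + n%:R * b) * a ^+ n.
  rewrite -[X in _ * X](_ : \det (block_mx a%:M 0 (- u) 1%:M : 'M_(1 + n)) = a); last first.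
    by rewrite det_lblock det1 mulr1 det_scalar1.
  rewrite -det_mulmx mulmx_block !mulmx1 !mulmx0 !add0r mul1mx.
  rewrite mulNmx mulmxN opprK mul_mx_scalar mulmxN mul_scalar_mx subrr det_ublock det_scalar.
  congr (_ * _); rewrite [a%:M + _]mx11_scalar det_scalar1 !mxE eqxx mulr1n.
  congr (_ + _); rewrite (eq_bigr (fun=> b)) => [|i _]; last by rewrite !mxE mulr1.
  by rewrite sumr_const card_ord mulr_natl.
by rewrite detB mulrC => ->; rewrite mulrC.
Qed.

Lemma prime_dvdX_cancel (p f g : R) k n : prime_elt p -> ~ dvd p f ->
  dvd (p ^+ k) (f ^+ n * g) -> dvd (p ^+ k) g.
Proof.
move=> [p0 nu pP] nf; have nfn m : ~ dvd p (f ^+ m).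
  elim: m => [|m IHm]; last by rewrite exprS => /pP[].
  by move=> /(dvd_unit (unitr1 _)) pu; rewrite pu in nu.
elim: k g => [|k IHk] g; first by rewrite expr0 => _; exists g; rewrite mul1r.
move=> [h e]; have : dvd p (f ^+ n * g) by rewrite e exprS -mulrA; apply/dvd_mulr/dvd_refl.
case/pP=> [/nfn//|[g' gE]]; have [|h' hE] := IHk g'.
  by exists h; apply: (mulfI p0); rewrite [RHS]mulrA -exprS -e gE; ring.
by exists h'; rewrite gE hE exprS mulrA.
Qed.

(* Chio's condensation. *)
Lemma dvd_det_rank1 (p : R) n (B : 'M[R]_n) : prime_elt p ->
  (forall i j, ~ dvd p (B i j)) ->
  (forall i j k l, dvd p (B i j * B k l - B k j * B i l)) ->
  dvd (p ^+ n.-1) (\det B).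
Proof.
move=> pp; case: n B => [|n] B nB hB; first by exists (\det B); rewrite mul1r.
have [E hE] : exists E : 'M[R]_n, forall i j,
    B 0 0 * B (lift 0 i) (lift 0 j) - B (lift 0 i) 0 * B 0 (lift 0 j) = p * E i j.
  have hE i : exists e : 'I_n -> R, forall j,
    B 0 0 * B (lift 0 i) (lift 0 j) - B (lift 0 i) 0 * B 0 (lift 0 j) = p * e j.
    by have [e he] := choice (fun j => hB 0 0 (lift 0 i) (lift 0 j)); exists e.
  have [e he] := choice hE; exists (\matrix_(i, j) e i j) => i j.
  by rewrite mxE he.
pose b := B 0 0; pose B' : 'M_(1 + n) := B.
(* Left multiplication by [T] clears the first column below the pivot [b] and leaves the block
   [p *: E], whose determinant has the factor [p ^+ n]; [p] does not divide the pivot, so the powers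
   of [b] can be cancelled. *)
pose T : 'M_(1 + n) := block_mx 1%:M 0 (- dlsubmx B') b%:M.
have detT : \det T = b ^+ n by rewrite det_lblock det1 mul1r det_scalar.
have e0 : lshift n 0 = 0 :> 'I_(1 + n) by apply: val_inj.
have e1 i : rshift 1 i = lift 0 i :> 'I_(1 + n) by apply: val_inj.
have : \det T * \det B' = b * (p ^+ n * \det E).
  rewrite -det_mulmx -{1}[B']submxK /T mulmx_block !mul1mx !mul0mx !addr0.
  have -> : - dlsubmx B' *m ulsubmx B' + b%:M *m dlsubmx B' = 0.
    rewrite mul_scalar_mx; apply/matrixP => i j; rewrite !mxE big_ord1 !mxE !ord1 !e0 -/b; ring.
  rewrite det_ublock -detZ; congr (_ * _).
    by rewrite [ulsubmx _]mx11_scalar det_scalar1 !mxE !e0.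
  congr (\det _); rewrite mul_scalar_mx; apply/matrixP => i j; rewrite !mxE big_ord1 !mxE !ord1 !e0 !e1 -hE -/b; ring.
rewrite detT => e; apply: (@prime_dvdX_cancel p b (\det B) n n pp (nB _ _)).
by rewrite [_ * _]e; apply/dvd_mull/dvd_mulr/dvd_refl.
Qed.

End DetLemmas.

(** * The determinant as a prime, and orders along it *)

Section DetPrime.
Variables (F : fieldType) (q : nat).
Local Notation A := {mpoly F[q * q]}.
Local Notation x := (@xv F q).
Hypothesis q1 : (1 < q)%N.
Local Notation dt := (dC F q).
Local Notation C := (Cm F q).
Let IJ := J_involutive F q1.
Let IC := C_involutive F q1.

Lemma sum_Rw (m : 'X_{1..q * q}) : (\sum_a wm (Rw a) m = mdeg m)%N.
Proof.
rewrite /wm exchange_big mdegE /=; apply: eq_bigr => k _; case/mxvec_indexP: k => i j.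
rewrite -big_distrr /= (bigD1 i) //= mxvecE mxE eqxx big1 ?addn0 ?muln1 // => l ne.
by rewrite mxvecE mxE eq_sym (negPf ne).
Qed.

Lemma sum_Cw (m : 'X_{1..q * q}) : (\sum_b wm (Cw b) m = mdeg m)%N.
Proof.
rewrite /wm exchange_big mdegE /=; apply: eq_bigr => k _; case/mxvec_indexP: k => i j.
rewrite -big_distrr /= (bigD1 j) //= mxvecE mxE eqxx big1 ?addn0 ?muln1 // => l ne.
by rewrite mxvecE mxE eq_sym (negPf ne).
Qed.

(** The determinant has degree 1 in each row, each column and each entry. If [p] involves row [a],
    then [r] does not, so [p] takes the degree of every entry of row [a], hence of every column, and
    nothing is left for [r]. *)
Lemma dt_irreducible (p r : A) : dt = p * r -> (0 < degp p)%N -> degp r = 0%N.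
Proof.
move=> e p0; have [p'0 r'0] : p != 0 /\ r != 0.
  by have := dC_neq0 F q; rewrite e mulf_eq0 negb_or => /andP[].
have hR a : (wdeg (wm (Rw a)) p + wdeg (wm (Rw a)) r = 1)%N.
  rewrite -wdegM // -e; apply: wdeg_homog; first exact: dC_neq0.
  apply: dC_homog => s; rewrite (bigD1 a) //= wmU mxE eqxx big1 // => i ia.
  by rewrite /= wmU mxE (negPf ia).
have hC b : (wdeg (wm (Cw b)) p + wdeg (wm (Cw b)) r = 1)%N.
  rewrite -wdegM // -e; apply: wdeg_homog; first exact: dC_neq0.
  apply: dC_homog => s; rewrite (bigD1 ((s^-1)%g b)) //= wmU mxE permKV eqxx big1 // => i ib.
  by rewrite /= wmU mxE; case: eqP => // sib; rewrite -sib permK eqxx in ib.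
have hD a b : (dv a b p + dv a b r = 1)%N by rewrite /dv -wdegM // -e -/(dv a b _) dv_dC.
have dR (f : A) a b : (dv a b f <= wdeg (wm (Rw a)) f)%N.
  by apply: wdeg_mono => i j; rewrite !mxE; do 2 case: (_ == _).
have dCw (f : A) a b : (dv a b f <= wdeg (wm (Cw b)) f)%N.
  by apply: wdeg_mono => i j; rewrite !mxE; do 2 case: (_ == _).
have [a pa] : exists a, (0 < wdeg (wm (Rw a)) p)%N.
  apply: contraPP p0 => /forallNP h; apply/negP; rewrite -leqNgt -ltnS -msizeS // -mlead_deg // ltnS.
  rewrite -sum_Rw leqn0 sum_nat_eq0; apply/forallP => a; apply/implyP => _.
  rewrite -leqn0; apply: leq_trans (@wdeg_mnm _ _ (wm (Rw a)) _ _ (mlead_supp p'0)) _.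
  by rewrite leqNgt; apply/negP/h.
have ra0 b : wdeg (wm (Cw b)) r = 0%N.
  by move: (hD a b) (hR a) (hC b) (dR r a b) (dCw p a b) pa; lia.
apply/eqP; rewrite -leqn0 -ltnS -msizeS // -mlead_deg // ltnS.
rewrite -sum_Cw leqn0 sum_nat_eq0; apply/forallP => b; apply/implyP => _.
by rewrite -leqn0 -(ra0 b); apply: (@wdeg_mnm _ _ (wm (Cw b)) _ _ (mlead_supp r'0)).
Qed.

Definition pd : A := (mleadc dt)^-1 *: dt.

Lemma dtE : dt = (mleadc dt)%:MP * pd.
Proof.
rewrite /pd mul_mpolyC scalerA mulfV ?scale1r //.
by rewrite mleadc_eq0 dC_neq0.
Qed.

Lemma pd_hprime : hprime pd.
Proof.
have [c [s [c0 hs e]]] := homog_factor_hprime (dC_neq0 F q) (inv_msd IC).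
case: s hs e => [|p t] hs e.
  have := degp_ms IC; rewrite e big_nil mulr1 degp_C => q0.
  by have := q1; rewrite -[X in (1 < X)%N]q0.
have hp := hs p (mem_head _ _); have p0 := hom_neq0 (hprime_hom hp).
have e' : dt = p * (c%:MP * \prod_(j <- t) j) by rewrite e big_cons mulrCA.
have := dt_irreducible e' (prime_degp (hprime_prime hp)).
set r := c%:MP * _ in e' *; move=> r0.
have r'0 : r != 0 by apply: contraNneq (dC_neq0 F q) => h; rewrite e' h mulr0.
have [c' c'0 rE] : exists2 c, c != 0 & r = c%:MP.
  by apply/msize_poly1P; rewrite msizeS // r0.
have lE : mleadc dt = c'.
  rewrite e' rE mulrC mul_mpolyC mleadZ // mcoeffZ.
  by have [_ -> _] := hp; rewrite mulr1.
by rewrite /pd lE e' rE mulrC mul_mpolyC scalerA mulVf // scale1r.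
Qed.

Lemma vp_dt : vp pd dt = 1%N.
Proof.
have hp := pd_hprime; rewrite dtE vpM //.
- by rewrite vp_C ?vp_self // mleadc_eq0 dC_neq0.
- by rewrite mpolyC_eq0 mleadc_eq0 dC_neq0.
- exact/hom_neq0/hprime_hom.
Qed.

Lemma ndvd_C i j : ~ dvd pd (C i j).
Proof.
have hp := pd_hprime; have hC := hom_Cm F q1 i j.
move=> [h hE]; have h0 : h != 0 by apply: contraNneq (hom_neq0 hC) => e; rewrite hE e mulr0.
have := degp_homog (hom_neq0 hC) (inv_sgd IC i j).
have dp : degp pd = q.
  apply: degp_homog; first exact/hom_neq0/hprime_hom.
  by apply: dhomogZ; exact: (inv_msd IC).
rewrite hE degpM ?dp //; last exact/hom_neq0/hprime_hom.
move: (degp h) q1 => k; lia.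
Qed.

(** A singular matrix has an adjugate of rank at most one. The vector [z] vanishes at [l] and is
    sent by [Xm] to multiples of the determinant. The adjugate of [Xm] without row [i] and column
    [l] then isolates each coordinate of [z], multiplied by a minor that agrees with a cofactor up
    to sign and is not divisible by [pd]. *)
Lemma minor2_C i j k l : dvd pd (C i j * C k l - C k j * C i l).
Proof.
pose z : 'cV[A]_q := \col_t (C i t * C k l - C k t * C i l).
have zl : z l 0 = 0 by rewrite [z l 0]mxE mulrC subrr.
have Xz r : dvd pd ((Xm F q *m z) r 0).
  suff -> : (Xm F q *m z) r 0 = dt * ((i == r)%:R * C k l - (k == r)%:R * C i l).
    by apply: dvd_mulr; rewrite dtE; apply/dvd_mull/dvd_refl.
  have XC u : \sum_t Xm F q r t * C u t = dt * (u == r)%:R.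
    have /matrixP/(_ r u) := mul_mx_adj (Xm F q); rewrite [RHS]mxE eq_sym => e.
    rewrite mulr_natr -[RHS]e mxE; apply: eq_bigr => t _; by rewrite [C u t]mxE.
  rewrite mxE mulrBr !mulrA -!XC !mulr_suml -sumrB; apply: eq_bigr => t _.
  by rewrite [z t 0]mxE; ring.
pose X' := row' i (col' l (Xm F q)); pose z' := row' l z.
have X'z' s : (X' *m z') s 0 = (Xm F q *m z) (lift i s) 0.
  rewrite [LHS]mxE [RHS]mxE (bigD1_ord l) //= zl mulr0 add0r; apply: eq_bigr => t _.
  by rewrite !mxE.
have [j' jE|->] := unliftP l j; last first.
  have -> : C i l * C k l - C k l * C i l = 0 by ring.
  exact: dvd0.
have e : \det X' * z' j' 0 = \sum_s \adj X' j' s * (Xm F q *m z) (lift i s) 0.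
  have /matrixP/(_ j' 0) := congr1 (fun M => M *m z') (mul_adj_mx X').
  by rewrite mul_scalar_mx [RHS]mxE -mulmxA => <-; rewrite mxE; apply: eq_bigr => s _; rewrite X'z'.
have : dvd pd (\det X' * z' j' 0).
  rewrite e; apply: (big_ind (dvd pd)); [exact: dvd0|exact: dvd_add|].
  by move=> s _; apply/dvd_mull/Xz.
have [_ _ pP] := hprime_prime pd_hprime; case/pP=> [h|].
  by case: (@ndvd_C i l); rewrite CmE; apply: dvd_mull.
by rewrite !mxE -jE.
Qed.

Definition MC : A := sub C (mJ F q).
(** The Hadamard inverse of the cofactor matrix, cleared of denominators: entry [(i, j)] is [MC]
    divided by the cofactor [C i j]. Along the determinant it has rank one again, which gives the
    powers of [pd] in its minors. *)
Definition W : 'M[A]_q := map_mx (sub C) (Jm F q).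

Lemma W_C i j : W i j * C i j = MC.
Proof. by rewrite mxE -[C i j](sub_xv C) -rmorphM /= JmM. Qed.

Lemma MC_E : MC = \prod_(ij : 'I_q * 'I_q) C ij.1 ij.2.
Proof.
rewrite /MC /mJ rmorph_prod sum_mxvec pair_bigA /=; apply: eq_bigr => -[i j] _ /=.
exact: (sub_xv C i j).
Qed.

Lemma MC_neq0 : MC != 0. Proof. exact: (sub_neq0 IC (hom_mJ F q1)). Qed.

Lemma vp_C0 i j : vp pd (C i j) = 0%N.
Proof.
by apply/vp_eq0; [exact: pd_hprime|exact/hom_neq0/hom_Cm|exact: ndvd_C].
Qed.

Lemma vp_MC : vp pd MC = 0%N.
Proof.
rewrite MC_E (vpE (hprime_prime pd_hprime)) val_prod => [|ij _]; last exact/hom_neq0/hom_Cm.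
by rewrite big1 // => ij _; rewrite -vpE vp_C0.
Qed.

Lemma ndvd_MC : ~ dvd pd MC.
Proof. by apply/vp_eq0; [exact: pd_hprime|exact: MC_neq0|exact: vp_MC]. Qed.

Lemma ndvd_W i j : ~ dvd pd (W i j).
Proof. by move=> h; apply: ndvd_MC; rewrite -(W_C i j); apply: dvd_mulr. Qed.

Lemma minor2_W i j k l : dvd pd (W i j * W k l - W k j * W i l).
Proof.
have [_ _ pP] := hprime_prime pd_hprime.
have : dvd pd ((C i j * C k l * (C k j * C i l)) * (W i j * W k l - W k j * W i l)).
  have -> : (C i j * C k l * (C k j * C i l)) * (W i j * W k l - W k j * W i l) =
    (- MC ^+ 2) * (C i j * C k l - C k j * C i l).
    transitivity ((W i j * C i j) * (W k l * C k l) * (C k j * C i l) -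
                  (W k j * C k j) * (W i l * C i l) * (C i j * C k l)); first by ring.
    by rewrite !W_C; ring.
  exact/dvd_mull/minor2_C.
case/pP => //; case/pP => /pP[] /ndvd_C //.
Qed.

Lemma dvd_det_W : dvd (pd ^+ q.-1) (\det W).
Proof.
apply: dvd_det_rank1; [exact/hprime_prime/pd_hprime|exact: ndvd_W|exact: minor2_W].
Qed.

Lemma dvd_cof_W i j : dvd (pd ^+ q.-2) (cofactor W i j).
Proof.
apply: dvd_mull; apply: dvd_det_rank1 => [|s t|s t u v]; first exact/hprime_prime/pd_hprime.
  have -> : row' i (col' j W) s t = W (lift i s) (lift j t) by rewrite !mxE.
  exact: ndvd_W.
have E k l : row' i (col' j W) k l = W (lift i k) (lift j l) by rewrite !mxE.
  by rewrite !E; apply: minor2_W.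
Qed.

Hypothesis qF : q%:R != 0 :> F.

(* On the curve [q I + (t - 1) E], with [E] the all-ones matrix, the determinant has a
   simple zero at [t = 0], where all the cofactors are equal and nonzero. *)
Lemma ndvd_det_W : ~ dvd (pd ^+ q) (\det W).
Proof.
pose a : {poly F} := q%:R%:P; pose b : {poly F} := 'X - 1.
have a0 : a != 0 by rewrite polyC_eq0.
pose P : 'M[{poly F}]_q := a%:M + const_mx b.
pose h := ev (@polyC F) P.
have aqb : a + q%:R * b = a * 'X by rewrite /a /b -polyC_natr; ring.
have detP : \det P = a ^+ q * 'X.
  by apply: (mulfI a0); rewrite det_scalar_const // aqb; ring.
pose al := a ^+ q.-2; have al0 : al != 0 by rewrite expf_neq0.
(* The adjugate of [P], obtained from the fact that the square of the all-ones matrix is [q] times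
   that matrix. *)
pose Q : 'M[{poly F}]_q := al *: ((a * 'X)%:M - const_mx b).
have PQ : P *m Q = (\det P)%:M.
  rewrite -scalemxAr mulmxBr !mulmxDl mul_scalar_mx mul_mx_scalar mul_scalar_mx.
  apply/matrixP => i j; rewrite !mxE (eq_bigr (fun=> b * b)) => [|k _]; last by rewrite !mxE.
  rewrite sumr_const card_ord -[_ *+ q]mulr_natr.
  have -> : (\det P *+ (i == j)) = al * (a * ((a * 'X) *+ (i == j))).
    rewrite detP /al; case: (i == j); rewrite ?mulr1n ?mulr0n ?mulr0 //.
    by rewrite !mulrA -!exprSr; congr (_ ^+ _ * _); move: q1; lia.
  congr (_ * _).
  have -> : a * 'X *+ (i == j) = (a * 'X) *+ (i == j) by [].
  have bE : b * (a + q%:R * b) = b * (a * 'X) by rewrite aqb.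
  transitivity (a * (a * 'X *+ (i == j)) + (b * (a * 'X) - b * (a + q%:R * b))); first by ring.
  by rewrite bE subrr addr0.
have detP0 : \det P != 0 by rewrite detP mulf_neq0 ?expf_neq0 ?polyX_eq0.
have adjP : \adj P = Q.
  have e : \det P *: Q = \det P *: \adj P.
    by rewrite -mul_scalar_mx -mul_adj_mx -mulmxA PQ mul_mx_scalar.
  by apply/matrixP => i j; have /matrixP/(_ i j) := e; rewrite !mxE => /(mulfI detP0).
pose dl := al * (a * 'X - b); pose o := - (al * b).
have QE i j : Q i j = if i == j then dl else o.
  by rewrite !mxE; case: eqP => _; rewrite ?mulr1n ?mulr0n /dl /o; ring.
have hC i j : h (C i j) = if i == j then dl else o.
  have -> : h (C i j) = \adj P j i by rewrite /h ev_Cm mxE.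
  by rewrite adjP QE eq_sym.
have hW i j : h (W i j) * (if i == j then dl else o) = h MC by rewrite -hC -rmorphM W_C.
have odl : o - dl = - (al * a) * 'X by rewrite /o /dl; ring.
have odl0 : o - dl != 0.
  by rewrite odl mulf_neq0 ?oppr_eq0 ?mulf_neq0 ?polyX_eq0.
(* On the curve, [dl * o] times [W] is [h MC] times the matrix with [o] on the diagonal and [dl]
   elsewhere, so [det_scalar_const] applies. As [o - dl] has a simple zero at [t = 0], the
   determinant of [W] vanishes there to order exactly [q - 1]. *)
have detW : (o - dl) * ((dl * o) ^+ q * h (\det W)) =
            h MC ^+ q * ((o - dl) ^+ q * (o - dl + q%:R * dl)).
  rewrite -det_scalar_const // (_ : h (\det W) = \det (map_mx h W)); last exact/esym/(det_map_mx (ev (@polyC F) P)).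
  rewrite -detZ mulrCA -detZ; congr (_ * \det _).
  apply/matrixP => i j; rewrite [LHS]mxE [RHS]mxE [map_mx h W i j]mxE -(hW i j).
  have -> : ((o - dl)%:M + const_mx dl : 'M_q) i j = if i == j then o else dl.
    by rewrite !mxE; case: eqP => _; rewrite ?mulr1n ?mulr0n; ring.
  by case: eqP => _; ring.
move=> [k kE]; pose c : F := mleadc dt.
have c0 : c != 0 by rewrite mleadc_eq0 dC_neq0.
have hk : c%:P ^+ q * h (\det W) = (a ^+ q * 'X) ^+ q * h k.
  have hdt : \det P = c%:P * h pd.
    by rewrite -(ev_dC (@polyC F) P) -/h dtE /h rmorphM /= ev_C.
  by rewrite -detP hdt kE /h rmorphM rmorphXn /= -/h exprMn; ring.
(* If [pd ^+ q] divided the determinant, then after cancelling ['X ^+ q] the right side would still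
   vanish at 0, while the left side is there a product of powers of [q] and of the leading
   coefficient [c], up to sign. *)
have : 'X ^+ q * (c%:P ^+ q * (h MC ^+ q * ((- (al * a)) ^+ q * (o - dl + q%:R * dl)))) =
       'X ^+ q * ('X * ((- (al * a)) * ((dl * o) ^+ q * (a ^+ q ^+ q * h k)))).
  transitivity (c%:P ^+ q * (h MC ^+ q * ((o - dl) ^+ q * (o - dl + q%:R * dl)))).
    by rewrite odl [in RHS]exprMn; ring.
  rewrite -detW [in LHS]odl; transitivity ((- (al * a) * 'X) * (dl * o) ^+ q * (c%:P ^+ q * h (\det W))).
    by ring.
  by rewrite hk [(a ^+ q * 'X) ^+ q]exprMn; ring.
move=> /(mulfI (_ : _ != 0)) {}hk.
have /(congr1 (fun f : {poly F} => f.[0])) := hk (expf_neq0 _ (negbT (polyX_eq0 F))).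
rewrite [RHS]hornerM hornerX mul0r => /eqP; apply/negP.
have alE : al.[0] = q%:R ^+ q.-2 by rewrite /al horner_exp hornerC.
have bE : b.[0] = - 1 by rewrite /b hornerD hornerX hornerN hornerC add0r.
have dl1 : dl.[0] = q%:R ^+ q.-2.
  by rewrite /dl hornerM alE hornerD hornerN bE hornerM hornerX mulr0; ring.
have o1 : o.[0] = q%:R ^+ q.-2 by rewrite /o hornerN hornerM alE bE; ring.
have hE : (o - dl + q%:R * dl).[0] = q%:R * q%:R ^+ q.-2.
  rewrite (hornerD (o - dl)) (hornerD o) (hornerN dl) (hornerM q%:R) -polyC_natr hornerC.
  by rewrite dl1 o1 subrr add0r.
have hM : (h MC).[0] != 0.
  rewrite MC_E /h rmorph_prod horner_prod; apply/prodf_neq0 => ij _.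
  rewrite -[X in X.[0]]/(h (C ij.1 ij.2)) hC.
  by case: ifP => _; rewrite ?dl1 ?o1 expf_neq0.
have hN : (- (al * a)).[0] != 0.
  by rewrite hornerN (hornerM al) alE /a hornerC oppr_eq0 mulf_neq0 ?expf_neq0.
rewrite (hornerM (c%:P ^+ q)) (hornerM (h MC ^+ q)) (hornerM ((- (al * a)) ^+ q)) hE.
by rewrite !horner_exp hornerC !mulf_neq0 ?expf_neq0.
Qed.

End DetPrime.

Section RankOne.
Variables (F : fieldType) (q : nat).
Local Notation A := {mpoly F[q * q]}.
Local Notation x := (@xv F q).
Hypothesis q1 : (1 < q)%N.
Hypothesis qF : q%:R != 0 :> F.
Local Notation dt := (dC F q).
Local Notation C := (Cm F q).
Local Notation J := (Jm F q).
Local Notation m := (mJ F q).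
Local Notation pd := (pd F q).
Local Notation VJ := (@VJ F q).
Local Notation VC := (@VC F q).
Let IJ := J_involutive F q1.
Let IC := C_involutive F q1.
Let N := (q * q)%N.
Let hpd := pd_hprime F q1.

Definition vdet (g : A) : int := (vp pd g)%:Z.
(* Inversion exchanges the divisor of singular matrices with the exceptional divisor over the
   locus of rank-one matrices: [wrk] is the valuation of the latter, up to a multiple of the degree. *)
Definition wrk : A -> int := VC vdet.

Let av : additive_on (@hom F (q * q)) vdet := additive_vp hpd.
Let aw : additive_on (@hom F (q * q)) wrk := additive_op IC av.
Let aJw : additive_on (@hom F (q * q)) (VJ wrk) := additive_op IJ aw.

Lemma wrk_x i j : wrk (x i j) = - 1.
Proof. by rewrite /wrk /VC /op sub_xv degp_x /vdet (vp_C0 F q1) (vp_dt F q1). Qed.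

Lemma wrk_m : wrk m = - N%:Z.
Proof.
rewrite /wrk /VC /op -/(MC F q) /vdet (vp_MC F q1) (vp_dt F q1).
by rewrite (degp_ms IJ) mulr1 sub0r.
Qed.

Lemma wrk_dt : wrk dt = - 1.
Proof. by rewrite /wrk /VC (op_ms IC av) /vdet vp_dt. Qed.

Lemma vp_det_W : vp pd (\det (W F q)) = q.-1.
Proof.
have W0 : \det (W F q) != 0.
  apply/eqP => W0; apply: (ndvd_det_W q1 qF); rewrite W0; exact: dvd0.
have hp := hprime_prime hpd.
apply/eqP; rewrite eqn_leq; apply/andP; split; rewrite (vpE hp).
  rewrite -ltnS prednK ?(ltnW q1) // ltnNge; apply/negP => /(val_geP hp _ W0).
  exact: (ndvd_det_W q1 qF).
by apply/(val_geP hp _ W0)/(dvd_det_W F q1).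
Qed.

Lemma sub_CJ_dt : sub C (sub J dt) = \det (W F q).
Proof. by rewrite sub_dC -det_map_mx. Qed.

(** With the exact order of [\det W] the value is $(q-1)-q(q^2-1)+q\cdot q^2=2q-1$. *)
Lemma Jwrk_dt : VJ wrk dt = (2 * q).-1%:Z.
Proof.
rewrite /VJ /op wrk_m (degp_ms IC) /wrk /VC /op sub_CJ_dt /vdet vp_det_W (vp_dt F q1).
rewrite (degp_sub IJ (hom_dC F q1)) (degp_ms IC) /N.
have N1 : (1 < q * q)%N by move: q1; nia.
by move: q1 N1; nia.
Qed.

Lemma Jwrk_C i j : (2 * q - 3)%:Z <= VJ wrk (C i j).
Proof.
have hC := hom_Cm F q1 i j; have dCij := degp_homog (hom_neq0 hC) (inv_sgd IC i j).
have E : sub C (sub J (C i j)) = cofactor (W F q) i j.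
  by rewrite CmE -cofactor_map_mx map_Xm -cofactor_map_mx.
have W0 : cofactor (W F q) i j != 0.
  by rewrite -E; apply/(sub_neq0 IC)/(sub_hom IJ).
have hp := hprime_prime hpd.
have : (q.-2 <= vp pd (cofactor (W F q) i j))%N.
  by rewrite (vpE hp); apply/(val_geP hp _ W0)/(dvd_cof_W F q1).
rewrite /VJ /op wrk_m dCij /wrk /VC /op E /vdet (vp_dt F q1) (degp_sub IJ hC) dCij /N.
move: (vp _ _) => v; have N1 : (1 < q * q)%N by move: q1; nia.
by move: q1 N1; nia.
Qed.

Let Y := VC (VJ wrk).

(** The comparison is made after one more pull-back by the cofactor map, where the target is the
    order along [pd] and a power of [pd] can be split off [g]. On [pd] both sides equal $1-2q$; on
    entries [Jwrk_C] and [Jwrk_dt] give at least $(2q-3)-(2q-1)=-2$, which [ultra_mnm] extends to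
    the remaining factor. *)
Lemma Y_ge g : hom g -> vdet g - 2 * (degp g)%:Z <= Y g.
Proof.
move=> hg; have p0 := hom_neq0 (hprime_hom hpd).
have aY : additive_on (@hom F (q * q)) Y := additive_op IC aJw.
have YC c : c != 0 -> Y c%:MP = 0.
  by move=> c0; rewrite /Y /VC /VJ /wrk !op_C /VC op_C /vdet vp_C.
have [h gE nh] := vp_spec hpd (hom_neq0 hg).
set a := vp pd g in gE.
have [hpa hh] : hom (pd ^+ a) /\ hom h by apply: hom_divl; rewrite -gE.
have c0 : mleadc dt != 0 by rewrite mleadc_eq0 dC_neq0.
have Ypd : Y pd = - (2 * q).-1%:Z.
  have : Y dt = - (2 * q).-1%:Z by rewrite /Y /VC (op_ms IC aJw) Jwrk_dt.
  rewrite {1}dtE aY; [|exact: homC|exact: hprime_hom].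
  by rewrite YC // add0r.
have dpd : degp pd = q.
  have := degp_ms IC; rewrite {1}dtE degpM ?mpolyC_eq0 //.
  by rewrite degp_C.
have Yx i j : - 2 <= Y (x i j).
  have -> : Y (x i j) = VJ wrk (C i j) - VJ wrk dt.
    by rewrite /Y /VC {1}/op sub_xv degp_x mul1r.
  by rewrite Jwrk_dt; have := Jwrk_C i j; move: q1; lia.
have Yh : - 2 * (degp h)%:Z <= Y h.
  apply: (ultra_mnm (ultra_op IC (ultra_op IJ (ultra_op IC (ultra_vp hpd)))) aY) => // mm mh.
  have /dhomogP/(_ _ mh)/= <- := hom_degp hh.
  rewrite mdegE (big_morph Posz PoszD (erefl 0%:Z)) mulr_sumr; apply: ler_sum => k _.
  case/mxvec_indexP: k => i j; rewrite mulrC; apply: ler_wpM2l => //.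
  exact: Yx.
have Yg : Y g = a%:Z * Y pd + Y h.
  by rewrite {1}gE aY // additive_onX //; exact: hprime_hom.
have dg : degp g = (a * q + degp h)%N.
  by rewrite {1}gE (degpM (expf_neq0 _ p0) (hom_neq0 hh)) (degpX _ p0) dpd.
rewrite Yg Ypd /vdet -/a dg PoszD PoszM; move: Yh q1 => /=; nia.
Qed.

Lemma Jwrk_ge g : hom g -> wrk g + 2 * (degp g)%:Z <= VJ wrk g.
Proof.
move=> hg; have := Y_ge (sub_hom IC hg).
have -> : Y (sub C g) = VJ wrk g - (degp g * (2 * q).-1)%:Z.
  rewrite /Y /VC /op (sub_sub IC hg) aJw //; last exact/homX/hom_dC.
  rewrite (additive_onX _ aJw (hom_dC F q1)) Jwrk_dt (degp_sub IC hg).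
  rewrite (_ : (2 * q).-1 = 2 * q.-2 + 3)%N; last by move: q1; lia.
  rewrite (_ : q.-1 = q.-2.+1); last by move: q1; lia.
  by move: (VJ _ _) (degp g) (q.-2) => u d p; rewrite !(PoszM, PoszD, intS); ring.
have vd : vdet dt = 1 by rewrite /vdet (vp_dt F q1).
have wE : wrk g = vdet (sub C g) - (degp g)%:Z by rewrite /wrk /VC /op vd mulr1.
rewrite wE (degp_sub IC hg).
rewrite (_ : (2 * q).-1 = 2 * q.-2 + 3)%N; last by move: q1; lia.
rewrite (_ : q.-1 = q.-2.+1); last by move: q1; lia.
by move: (vdet _) (VJ _ _) (degp g) (q.-2) => u v d p; rewrite !(PoszM, PoszD, intS); lia.
Qed.

(** [VJ] is an involution, so [Jwrk_ge] at [sub J g] is the reverse inequality at [g]. Up to a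
    multiple of the degree, the Hadamard inverse thus fixes the divisor over the rank-one
    matrices. *)
Lemma Jwrk g : hom g -> VJ wrk g = wrk g + 2 * (degp g)%:Z.
Proof.
move=> hg; apply/eqP; rewrite eq_le Jwrk_ge // andbT.
have := Jwrk_ge (sub_hom IJ hg).
have -> : VJ wrk (sub J g) = wrk g + (degp g * N)%:Z.
  rewrite /VJ /op (sub_sub IJ hg) aw //; last exact/homX/hom_mJ.
  rewrite (additive_onX _ aw (hom_mJ F q1)) wrk_m (degp_sub IJ hg) /N.
  have N1 : (1 < q * q)%N by move: q1; nia.
  by move: (wrk _) (degp g) => u d; move: (q * q)%N N1 => n; nia.
rewrite /VJ /op wrk_m (degp_sub IJ hg) /N.
have N1 : (1 < q * q)%N by move: q1; nia.
by move: (wrk _) (wrk _) (degp g) => u v d; move: (q * q)%N N1 => n; nia.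
Qed.

End RankOne.

(** * Orbits of prime divisors *)

Section Orbits.
Variables (F : fieldType) (q : nat).
Local Notation A := {mpoly F[q * q]}.
Local Notation x := (@xv F q).
Hypothesis q1 : (1 < q)%N.
Hypothesis qF : q%:R != 0 :> F.
Local Notation dt := (dC F q).
Local Notation C := (Cm F q).
Local Notation J := (Jm F q).
Local Notation m := (mJ F q).
Local Notation pd := (pd F q).
Local Notation VJ := (@VJ F q).
Local Notation VC := (@VC F q).
Local Notation wrk := (@wrk F q).
Local Notation hom := (@hom F (q * q)).
Let IJ := J_involutive F q1.
Let IC := C_involutive F q1.
Let hpd := pd_hprime F q1.
Implicit Types (g p : A).

(** The sign rule for twists is stated on forms homogeneous for row and column scalings. Entries,
    their product and the determinant are such forms, and both substitutions preserve the class. *)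
Definition mh g := hom g /\ forall a b, exists k, g \is k.-homog for (wm (Tw a b)).
Definition tw a b g : int := (wdeg (wm (Tw a b)) g)%:Z.
Definition tws (c : 'I_q -> 'I_q -> int) (d : int) g : int :=
  \sum_a \sum_b c a b * tw a b g + d * (degp g)%:Z.

Lemma mh_x i j : mh (x i j).
Proof. by split=> [|a b]; [exact: hom_x | exists (Tw a b i j); rewrite dhomogX /= wmU]. Qed.
Lemma mh_m : mh m.
Proof. by split=> [|a b]; [exact: hom_mJ | exists (2 * q)%N; apply: Tw_mJ]. Qed.
Lemma mh_dt : mh dt.
Proof. by split=> [|a b]; [exact: hom_dC | exists 2; apply: Tw_dC]. Qed.
Lemma Tw_leq (i j a b : 'I_q) : (Tw a b i j <= 2 * q)%N.
Proof. by apply: leq_trans (Tw_le2 _ _ _ _) _; rewrite -[X in (X <= _)%N]muln1 leq_mul2l ltnW. Qed.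
Lemma mh_subJ g : mh g -> mh (sub J g).
Proof.
move=> [hg hk]; split=> [|a b]; first exact: (sub_hom IJ).
have [k hk'] := hk a b; have hle i j := Tw_leq i j a b.
by have [_] := sub_whomog hle (@Tw_Jm F q q1 a b) hg hk'; eexists; eassumption.
Qed.
Lemma mh_subC g : mh g -> mh (sub C g).
Proof.
move=> [hg hk]; split=> [|a b]; first exact: (sub_hom IC).
have [k hk'] := hk a b.
by have [_] := sub_whomog (Tw_le2 a b) (@Tw_Cm F q a b) hg hk'; eexists; eassumption.
Qed.

Lemma op_tws sg ms e c d g : involutive sg ms e -> hom g ->
  (forall a b, op sg ms (tw a b) g = - tw a b g) ->
  op sg ms (tws c d) g = - tws c d g.
Proof.
move=> I hg htw; rewrite /op /tws (degp_ms I) (degp_sub I hg) opprD mulrDr opprD addrACA.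
congr (_ + _); last by have := inv_e I; case: (e) => [|k] //= _; rewrite !(PoszM, intS); ring.
rewrite mulr_sumr -sumrB -sumrN; apply: eq_bigr => a _.
rewrite mulr_sumr -sumrB -sumrN; apply: eq_bigr => b _.
have := htw a b; rewrite /op => h.
transitivity (c a b * (tw a b (sub sg g) - (degp g)%:Z * tw a b ms)); first by ring.
by rewrite h; ring.
Qed.

Lemma VJ_tws c d g : mh g -> VJ (tws c d) g = - tws c d g.
Proof.
move=> [hg hk]; apply: (op_tws _ _ IJ) => // a b; have [k hk'] := hk a b.
have hle i j := Tw_leq i j a b.
have h1 := @op_wdeg _ _ _ _ _ IJ _ _ hle (@Tw_Jm F q q1 a b) (Tw_mJ F q1 a b) g _ hg hk'.
exact: h1.
Qed.

Lemma VC_tws c d g : mh g -> VC (tws c d) g = - tws c d g.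
Proof.
move=> [hg hk]; apply: (op_tws _ _ IC) => // a b; have [k hk'] := hk a b.
have h1 := @op_wdeg _ _ _ _ _ IC _ _ (Tw_le2 a b) (@Tw_Cm F q a b) (Tw_dC F a b) g _ hg hk'.
exact: h1.
Qed.

Lemma op_ext (sg : 'M[A]_q) ms V V' g : V (sub sg g) = V' (sub sg g) -> V ms = V' ms ->
  op sg ms V g = op sg ms V' g.
Proof. by rewrite /op => -> ->. Qed.

Lemma opD (sg : 'M[A]_q) ms V V' g :
  op sg ms (fun g => V g + V' g) g = op sg ms V g + op sg ms V' g.
Proof. by rewrite /op; ring. Qed.

Lemma op_deg sg ms e c g : involutive sg ms e -> hom g ->
  op sg ms (fun g => c * (degp g)%:Z) g = - (c * (degp g)%:Z).
Proof.
move=> I hg; rewrite /op (degp_ms I) (degp_sub I hg).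
by have := inv_e I; case: (e) => [|k] //= _; rewrite !(PoszM, intS); ring.
Qed.

(* State of a divisorial valuation, modulo twists by the torus of row and column scalings:
   centred at a prime divisor, at the pole of one entry, or at the rank-one matrices. *)
Inductive state := Gen of A | Pole of 'I_q & 'I_q | Rank.

(** Choice of the prime supplied by [op_vp_transport]; by [nextP] the default 0 does not occur when
    [p] is an [hprime] not dividing [ms]. *)
Definition next (sg : 'M[A]_q) ms p : A :=
  if pselect (exists p', hprime p' /\
     forall g, hom g -> op sg ms (fun g => (vp p g)%:Z) g = (vp p' g)%:Z)
  is left h then sval (cid h) else 0.

Lemma nextP sg ms e p : involutive sg ms e -> hprime p -> ~ dvd p ms ->
  hprime (next sg ms p) /\
  forall g, hom g -> op sg ms (fun g => (vp p g)%:Z) g = (vp (next sg ms p) g)%:Z.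
Proof.
move=> I hp np; rewrite /next; case: pselect => [h|[]]; first by case: cid.
by have [p' hp' h] := op_vp_transport I hp np; exists p'.
Qed.

Definition stepJ st := match st with
  | Gen p => if [pick ab : 'I_q * 'I_q | p == x ab.1 ab.2] is Some ab
             then Pole ab.1 ab.2 else Gen (next J m p)
  | Pole a b => Gen (x a b)
  | Rank => Rank end.

Definition stepC st := match st with
  | Gen p => if p == pd then Rank else Gen (next C dt p)
  | Pole a b => Pole a b
  | Rank => Gen pd end.

Definition valid st := if st is Gen p then hprime p else True.

(** Function attached to a state before the Hadamard inverse is applied; [base_o] is its analogue
    between the Hadamard inverse and the cofactor map. They differ only at [Rank], by the term found
    in [Jwrk]. *)
Definition base_e st g : int := match st with
  | Gen p => (vp p g)%:Z
  | Pole a b => - (dv a b g)%:Z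
  | Rank => wrk g + 2 * (degp g)%:Z end.

Definition base_o st g : int := match st with
  | Gen p => (vp p g)%:Z
  | Pole a b => - (dv a b g)%:Z
  | Rank => wrk g end.

Definition is_x st a b : bool := if st is Gen p then p == x a b else false.
Definition is_det st : bool := if st is Gen p then p == pd else false.

Lemma x_inj i j a b : (x i j == x a b) = ((i == a) && (j == b)).
Proof.
apply/eqP/andP => [e|[/eqP-> /eqP->]//].
have := dv_x F a b i j; rewrite e dv_x !eqxx.
by case: (i == a); case: (j == b).
Qed.

Lemma hprime_eq p p' : hprime p -> hprime p' -> dvd p p' -> p = p'.
Proof. by move=> [pp mp _] [pp' mp' _]; apply: monic_dvd_eq. Qed.

Lemma vp_hprime p p' : hprime p -> hprime p' -> vp p p' = (p == p').
Proof.
by move=> [pp mp _] [pp' mp' _]; rewrite vpE (val_prime_neq _ pp' mp mp').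
Qed.

Lemma stepJ_valid st : valid st -> valid (stepJ st).
Proof.
case: st => //= [p hp|a b _]; last exact: x_hprime.
case: pickP => //= np; apply: (nextP IJ hp _).1 => h.
have [k _ hk] : exists2 k, k \in enum 'I_(q * q) & dvd p 'X_k.
  have [_ nu pP] := hprime_prime hp; move: h; rewrite /mJ -big_enum /=.
  elim: (enum _) => [|k r IHr]; first by rewrite big_nil => /(dvd_unit (unitr1 _)) pu; rewrite pu in nu.
  rewrite big_cons => /pP[hk|/IHr [k' k'r hk]]; first by exists k; rewrite ?mem_head.
  by exists k'; rewrite // inE k'r orbT.
case/mxvec_indexP: k hk => a b /(hprime_eq hp (x_hprime F a b)) pE.
by have := np (a, b); rewrite /= pE eqxx.
Qed.

Lemma ndvd_dt p : hprime p -> p != pd -> ~ dvd p dt.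
Proof.
move=> hp ne; rewrite dtE => h; have [_ nu pP] := hprime_prime hp.
case/pP: h => [h|/(hprime_eq hp hpd)/eqP]; last by rewrite (negPf ne).
have : (mleadc dt)%:MP_[q * q] \is a GRing.unit.
  by apply/mpoly_unitP; exists (mleadc dt) => //; rewrite mleadc_eq0 dC_neq0.
by move/dvd_unit/(_ h) => pu; rewrite pu in nu.
Qed.

Lemma stepC_valid st : valid st -> valid (stepC st).
Proof.
case: st => //= p hp; case: eqVneq => //= ne.
exact: (nextP IC hp (ndvd_dt hp ne)).1.
Qed.

Lemma VJ_base st g : valid st -> hom g -> VJ (base_e st) g = base_o (stepJ st) g.
Proof.
case: st => [p|a b|] /= hst hg.
- case: pickP => /= [[a b] /= /eqP->|np]; first exact: VJ_vp_x.
  have := @stepJ_valid (Gen p) hst; rewrite /=; case: pickP => [ab|_ _].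
    by rewrite np.
  apply: (nextP IJ hst _).2 => // h.
  have := @stepJ_valid (Gen p) hst; rewrite /=.
  have [k _ hk] : exists2 k, k \in enum 'I_(q * q) & dvd p 'X_k.
    have [_ nu pP] := hprime_prime hst; move: h; rewrite /mJ -big_enum /=.
    elim: (enum _) => [|k r IHr]; first by rewrite big_nil => /(dvd_unit (unitr1 _)) pu; rewrite pu in nu.
    rewrite big_cons => /pP[hk|/IHr [k' k'r hk]]; first by exists k; rewrite ?mem_head.
    by exists k'; rewrite // inE k'r orbT.
  case/mxvec_indexP: k hk => a b /(hprime_eq hst (x_hprime F a b)) pE.
  by have := np (a, b); rewrite /= pE eqxx.
- rewrite -(op_op IJ (additive_vp (x_hprime F a b)) hg).
  apply: op_ext; first exact/esym/(VJ_vp_x q1)/(sub_hom IJ hg).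
  exact/esym/(VJ_vp_x q1)/(hom_mJ F q1).
rewrite /VJ opD (op_deg _ IJ) // -[op J m wrk g]/(VJ wrk g) Jwrk //; ring.
Qed.

(** Two corrections occur: a pole acquires the twist of [VC_dv], and the determinant becomes [wrk],
    which is [base_e Rank] minus twice the degree. *)
Lemma VC_base st g : valid st -> mh g ->
  VC (base_o st) g = base_e (stepC st) g
    + (if st is Pole a b then tw a b g else 0) - 2 * (is_det st)%:Z * (degp g)%:Z.
Proof.
case: st => [p|a b|] /= hst mg; have [hg hk] := mg.
- case: eqVneq => [->|ne] /=; first by rewrite -/(wrk g) /base_e; ring.
  rewrite mulr0 mul0r addr0 subr0.
  exact: (nextP IC hst (ndvd_dt hst ne)).2 g hg.
- by have [k hk'] := hk a b; rewrite (VC_dv q1 hg hk') mulr0 mul0r subr0.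
rewrite mulr0 mul0r addr0 subr0; have h1 := op_op IC (additive_vp hpd) hg; exact: h1.
Qed.

Fixpoint st_e p k := if k is k'.+1 then stepC (stepJ (st_e p k')) else Gen p.
Definition st_o p k := stepJ (st_e p k).

Fixpoint Ve p k : A -> int :=
  if k is k'.+1 then VC (VJ (Ve p k')) else fun g => (vp p g)%:Z.
Definition Vo p k := VJ (Ve p k).

(** Marks the times at which the Hadamard inverse is about to turn the centre into a pole; [r] marks
    those at which the cofactor map is about to send the determinant to the rank-one locus. *)
Definition s p k a b : int := (is_x (st_e p k) a b)%:Z.
Definition r p k : int := (is_det (st_o p k))%:Z.

Lemma st_e_valid p k : hprime p -> valid (st_e p k).
Proof. by move=> hp; elim: k => //= k /stepJ_valid/stepC_valid. Qed.

Lemma st_o_valid p k : hprime p -> valid (st_o p k).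
Proof. by move=> hp; apply/stepJ_valid/st_e_valid. Qed.

Definition cum_s p k a b : int := \sum_(l < k) s p l a b.
Definition cum_r p k : int := \sum_(l < k) r p l.

Lemma pole_s p k g :
  (if st_o p k is Pole a b then tw a b g else 0) = \sum_a \sum_b s p k a b * tw a b g.
Proof.
rewrite /st_o /s; case: (st_e p k) => [p'|a b|] /=.
- case: pickP => [[a b] /= /eqP->|np] /=.
    rewrite (bigD1 a) //= (bigD1 b) //= eqxx mul1r.
    rewrite big1 => [|b' nb]; last by rewrite x_inj eqxx eq_sym (negPf nb) mul0r.
    rewrite big1 => [|a' na]; first by rewrite !addr0.
    by rewrite big1 // => b' _; rewrite x_inj eq_sym (negPf na) mul0r.
  rewrite big1 // => a _; rewrite big1 // => b _.
  by have /= -> := np (a, b); rewrite mul0r.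
- by rewrite big1 // => a' _; rewrite big1 // => b' _; rewrite mul0r.
by rewrite big1 // => a' _; rewrite big1 // => b' _; rewrite mul0r.
Qed.

(** The corrections of [VC_base] change sign under [VJ] and again under [VC]. They therefore add up
    over past times, with sign + before the Hadamard inverse and sign - after it. *)
Lemma V_invariant p k : hprime p ->
  (forall g, mh g -> Ve p k g = base_e (st_e p k) g + tws (cum_s p k) (- 2 * cum_r p k) g) /\
  (forall g, mh g -> Vo p k g = base_o (st_o p k) g - tws (cum_s p k) (- 2 * cum_r p k) g).
Proof.
move=> hp.
have eo k' : (forall g, mh g -> Ve p k' g = base_e (st_e p k') g + tws (cum_s p k') (- 2 * cum_r p k') g) ->
  (forall g, mh g -> Vo p k' g = base_o (st_o p k') g - tws (cum_s p k') (- 2 * cum_r p k') g).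
  move=> IH g mg.
  transitivity (op J m (fun g => base_e (st_e p k') g + tws (cum_s p k') (- 2 * cum_r p k') g) g).
    by apply: op_ext; apply: IH; [exact: mh_subJ|exact: mh_m].
  by rewrite opD -!/(VJ _ _) VJ_tws // VJ_base //; [exact: st_e_valid|exact: mg.1].
elim: k => [|k [IHe IHo]].
  have h0 g : mh g -> Ve p 0 g = base_e (st_e p 0) g + tws (cum_s p 0) (- 2 * cum_r p 0) g.
    move=> _; rewrite /= /tws /cum_s /cum_r big_ord0 mulr0 mul0r addr0.
    by rewrite big1 ?addr0 // => a _; rewrite big1 // => b _; rewrite big_ord0 mul0r.
  by split=> //; apply: eo.
suff h g : mh g -> Ve p k.+1 g = base_e (st_e p k.+1) g + tws (cum_s p k.+1) (- 2 * cum_r p k.+1) g.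
  by split=> //; apply: eo.
move=> mg.
transitivity (op C dt (fun g => base_o (st_o p k) g - tws (cum_s p k) (- 2 * cum_r p k) g) g).
  by apply: op_ext; apply: IHo; [exact: mh_subC|exact: mh_dt].
have -> : op C dt (fun g => base_o (st_o p k) g - tws (cum_s p k) (- 2 * cum_r p k) g) g =
  VC (base_o (st_o p k)) g - VC (tws (cum_s p k) (- 2 * cum_r p k)) g.
  by rewrite /VC /op mulrBr !opprD addrACA.
rewrite VC_tws // opprK VC_base //; last exact: st_o_valid.
rewrite -[st_e p k.+1]/(stepC (st_o p k)) pole_s -/(r p k).
rewrite /tws /cum_r big_ord_recr /=.
have -> : \sum_a \sum_b cum_s p k.+1 a b * tw a b g =
  \sum_a \sum_b cum_s p k a b * tw a b g + \sum_a \sum_b s p k a b * tw a b g.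
  rewrite -big_split; apply: eq_bigr => a _; rewrite -big_split; apply: eq_bigr => b _.
  by rewrite /cum_s big_ord_recr /= mulrDl.
ring.
Qed.

End Orbits.

(** * The recursion for the degree sums *)

Definition trK (q : nat) : int := q%:Z ^+ 2 - 4 * q%:Z + 2.

Fixpoint Spair (q k : nat) : int * int :=
  if k is k'.+1 then let: (a, b) := Spair q k' in (b, trK q * b - a + q%:Z)
  else (1, trK q + q%:Z).

Definition Sn q k := (Spair q k).1.

Lemma Sn0 q : Sn q 0 = 1. Proof. by []. Qed.
Lemma Sn1 q : Sn q 1 = trK q + q%:Z. Proof. by []. Qed.
Lemma SnSS q k : Sn q k.+2 = trK q * Sn q k.+1 - Sn q k + q%:Z.
Proof. by rewrite /Sn /=; case: (Spair q k). Qed.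

(** Elimination in time order: the entry equation yields the next [s], the same for all entries by
    induction, and the determinant equation the next [r]. The factor [q - 2] stands on the left
    because the formula for [r] has it as denominator. *)
Lemma balance_recursion q (K : nat) (s : nat -> 'I_q -> 'I_q -> int) (r : nat -> int) :
  (2 < q)%N ->
  (forall i j, s 0%N i j = 1) ->
  (forall k i j, (k < K)%N -> 1 = s k.+1 i j - s k i j + r k +
      \sum_(l < k.+1) (\sum_b s l i b + \sum_a s l a j) - 2 * \sum_(l < k.+1) r l) ->
  - q%:Z = r 0%N - \sum_a \sum_b s 0%N a b ->
  (forall k, (k < K)%N -> - q%:Z = r k.+1 - r k - \sum_a \sum_b s k.+1 a b -
      2 * \sum_(l < k.+1) \sum_a \sum_b s l a b + 2 * q%:Z * \sum_(l < k.+1) r l) ->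
  forall k, (k <= K)%N -> (forall i j, s k i j = Sn q k) /\
      (q%:Z - 2) * r k = q%:Z * (Sn q k.+1 + Sn q k - 1).
Proof.
move=> q2 s0 E1 E20 E2.
have qq : q%:Z - 2 != 0 by apply/eqP; move: q2; lia.
have sumc (c : int) : \sum_(a < q) c = q%:Z * c by rewrite sumr_const card_ord pmulrn -mulrzl intz.
have r0 : r 0%N = q%:Z ^+ 2 - q%:Z.
  move: E20; under eq_bigr => a _ do under eq_bigr => b _ do rewrite s0.
  rewrite !sumc mulr1 => e; have -> : r 0%N = (r 0%N - q%:Z * q%:Z) + q%:Z * q%:Z by ring.
  by rewrite -e; ring.
(* The third clause is the entry equation solved for the next [s]; it is carried along to eliminate
   the sums over past times from the determinant equation. *)
suff h k : (k <= K)%N ->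
    [/\ forall l i j, (l <= k)%N -> s l i j = Sn q l,
        (q%:Z - 2) * r k = q%:Z * (Sn q k.+1 + Sn q k - 1)
      & Sn q k.+1 = 1 + Sn q k - r k - 2 * q%:Z * \sum_(l < k.+1) Sn q l + 2 * \sum_(l < k.+1) r l].
  by move=> k /h [h1 h2 _]; split=> // i j; apply: h1.
elim: k => [|k IHk] kK.
  split=> [l i j| |].
    by rewrite leqn0 => /eqP->; rewrite s0.
    by rewrite r0 Sn1 Sn0 /trK; ring.
  by rewrite !big_ord_recr !big_ord0 /= r0 Sn1 Sn0 /trK; ring.
have [hs hr hI] := IHk (ltnW kK).
have hs1 i j : s k.+1 i j = Sn q k.+1.
  have := E1 k i j kK.
  rewrite (hs k) // (eq_bigr (fun l : 'I_k.+1 => 2 * q%:Z * Sn q l)); last first.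
    move=> l _; have lk : (l <= k)%N by rewrite -ltnS.
    transitivity (\sum_(b < q) Sn q l + \sum_(b < q) Sn q l); last by rewrite !sumc; ring.
    by congr (_ + _); apply: eq_bigr => b _; apply: hs.
  rewrite -mulr_sumr hI; move: (\sum_(l < k.+1) Sn q l) (\sum_(l < k.+1) r l) => cS cR e.
  have -> : s k.+1 i j = (s k.+1 i j - Sn q k + r k + 2 * q%:Z * cS - 2 * cR)
      + Sn q k - r k - 2 * q%:Z * cS + 2 * cR by ring.
  by rewrite -e.
have hr1 : r k.+1 = q%:Z * (q%:Z - 1) * Sn q k.+1 + q%:Z * Sn q k - (q%:Z - 1) * r k.
  have := E2 k kK.
  rewrite (eq_bigr (fun=> q%:Z * Sn q k.+1)) => [|a _]; last first.
    by rewrite -sumc; apply: eq_bigr => b _; rewrite hs1.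
  rewrite sumc (eq_bigr (fun l : 'I_k.+1 => q%:Z ^+ 2 * Sn q l)); last first.
    move=> l _; have lk : (l <= k)%N by rewrite -ltnS.
    rewrite expr2 -mulrA -sumc; apply: eq_bigr => a _; rewrite -sumc; apply: eq_bigr => b _.
    by rewrite hs.
  rewrite -mulr_sumr; move: hI.
  move: (\sum_(l < k.+1) Sn q l) (\sum_(l < k.+1) r l) => cS cR hI e.
  have : r k.+1 - (q%:Z * (q%:Z - 1) * Sn q k.+1 + q%:Z * Sn q k - (q%:Z - 1) * r k) = 
    (r k.+1 - r k - q%:Z * (q%:Z * Sn q k.+1) - 2 * (q%:Z ^+ 2 * cS) + 2 * q%:Z * cR) + q%:Z
    + q%:Z * (Sn q k.+1 - (1 + Sn q k - r k - 2 * q%:Z * cS + 2 * cR)) by ring.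
  by rewrite -e -hI subrr mulr0 addr0 addNr => /eqP; rewrite subr_eq0 => /eqP.
have hH : (q%:Z - 2) * r k.+1 = q%:Z * (Sn q k.+2 + Sn q k.+1 - 1).
  rewrite hr1 SnSS /trK.
  transitivity ((q%:Z - 2) * (q%:Z * (q%:Z - 1) * Sn q k.+1 + q%:Z * Sn q k) - (q%:Z - 1) * ((q%:Z - 2) * r k)).
    by ring.
  by rewrite hr; ring.
split=> //.
  move=> l i j; rewrite leq_eqVlt => /predU1P[->|]; first exact: hs1.
  by rewrite ltnS; apply: hs.
rewrite !(big_ord_recr k.+1) /=.
apply: (mulfI qq); move: hI.
move: (\sum_(l < k.+1) Sn q l) (\sum_(l < k.+1) r l) => cS cR hI.
have e : 1 - 2 * q%:Z * cS + 2 * cR = Sn q k.+1 - Sn q k + r k by rewrite hI; ring.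
transitivity ((q%:Z - 2) * ((1 - 2 * q%:Z * cS + 2 * cR) + Sn q k.+1 - 2 * q%:Z * Sn q k.+1)
    + (q%:Z - 2) * r k.+1); last by ring.
rewrite e hH.
transitivity ((q%:Z - 2) * (2 * Sn q k.+1 - Sn q k - 2 * q%:Z * Sn q k.+1) + (q%:Z - 2) * r k
   + q%:Z * (Sn q k.+2 + Sn q k.+1 - 1)); last by ring.
by rewrite hr SnSS /trK; ring.
Qed.

(** * Balance of degrees over all primes *)

Section Balance.
Variables (F : fieldType) (q : nat).
Local Notation A := {mpoly F[q * q]}.
Local Notation x := (@xv F q).
Hypothesis q2 : (2 < q)%N.
Hypothesis qF : q%:R != 0 :> F.
Let q1 : (1 < q)%N := ltnW q2.
Local Notation dt := (dC F q).
Local Notation C := (Cm F q).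
Local Notation J := (Jm F q).
Local Notation m := (mJ F q).
Local Notation pd := (pd F q).
Local Notation hom := (@hom F (q * q)).
Let IJ := J_involutive F q1.
Let IC := C_involutive F q1.
Let hpd := pd_hprime F q1.
Implicit Types (g p : A).

Definition is_pole (st : state F q) a b : bool :=
  if st is Pole i j then (a == i) && (b == j) else false.
Definition is_rank (st : state F q) : bool := if st is Rank then true else false.

Lemma base_e_x st i j : valid st ->
  base_e st (x i j) = (is_x st i j)%:Z - (is_pole st i j)%:Z + (is_rank st)%:Z.
Proof.
case: st => [p hp|a b _|_] /=.
- by rewrite (vp_hprime hp (x_hprime F i j)) subr0 addr0.
- by rewrite dv_x addr0 sub0r.
by rewrite wrk_x // degp_x.
Qed.

Lemma base_o_dt st : valid st ->
  base_o st dt = (is_det st)%:Z - \sum_a \sum_b (is_pole st a b)%:Z - (is_rank st)%:Z.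
Proof.
have z : \sum_(a < q) \sum_(b < q) 0%:Z = 0 by rewrite big1 // => a _; rewrite big1.
case: st => [p hp|a b _|_] /=.
- rewrite z !subr0; congr Posz; rewrite dtE vpM //; last 2 first.
  + by rewrite mpolyC_eq0 mleadc_eq0 dC_neq0.
  + exact/hom_neq0/hprime_hom.
  by rewrite vp_C ?mleadc_eq0 ?dC_neq0 // (vp_hprime hp hpd).
- rewrite dv_dC subr0 sub0r (bigD1 a) //= (bigD1 b) //= !eqxx.
  rewrite big1 => [|b' /negPf->]; last by rewrite andbF.
  rewrite big1 => [|a' /negPf->]; first by rewrite !addr0.
  by rewrite big1.
by rewrite wrk_dt // z.
Qed.

Lemma is_pole_J st a b : valid st -> is_pole (stepJ st) a b = is_x st a b.
Proof.
case: st => //= p hp; case: pickP => [[i j] /= /eqP->|np] /=.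
  by rewrite x_inj; rewrite [i == a]eq_sym [j == b]eq_sym.
by have /= -> := np (a, b).
Qed.

Lemma is_rank_J st : is_rank (stepJ st) = is_rank st.
Proof. by case: st => //= p; case: pickP. Qed.

Lemma is_pole_C st a b : is_pole (stepC st) a b = is_pole st a b.
Proof. by case: st => //= p; case: eqP. Qed.

Lemma is_rank_C st : is_rank (stepC st) = is_det st.
Proof. by case: st => //= p; case: eqP. Qed.

Lemma tw_x a b i j : tw a b (x i j) = (i == a)%:Z + (j == b)%:Z.
Proof. by rewrite /tw wdeg_x mxE PoszD. Qed.

Lemma tws_x c d i j : tws c d (x i j) = \sum_b c i b + \sum_a c a j + d.
Proof.
rewrite /tws degp_x mulr1; congr (_ + _).
under eq_bigr => a _ do under eq_bigr => b _ do rewrite tw_x mulrDr.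
under eq_bigr => a _ do rewrite big_split /=.
rewrite big_split /=; congr (_ + _).
  rewrite (bigD1 i) //= [X in _ + X]big1 => [|a ne]; last first.
    by rewrite big1 // => b _; rewrite eq_sym (negPf ne) mulr0.
  by rewrite addr0; apply: eq_bigr => b _; rewrite eqxx mulr1.
apply: eq_bigr => a _; rewrite (bigD1 j) //= eqxx mulr1 big1 ?addr0 // => b ne.
by rewrite eq_sym (negPf ne) mulr0.
Qed.

Lemma tws_dt c d : tws c d dt = 2 * \sum_a \sum_b c a b + d * q%:Z.
Proof.
rewrite /tws (degp_ms IC); congr (_ + _); rewrite mulr_sumr; apply: eq_bigr => a _.
rewrite mulr_sumr; apply: eq_bigr => b _.
by rewrite /tw (wdeg_homog (dC_neq0 F q) (Tw_dC F a b)) mulrC.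
Qed.

Lemma Ve0_x p i j : hprime p -> Ve p 0 (x i j) = s p 0 i j.
Proof. by move=> hp; rewrite /= (vp_hprime hp (x_hprime F i j)). Qed.

(** A pole now was a hyperplane one step earlier, and a rank-one centre now was the determinant one
    step earlier: hence the terms [- s p k i j] and [r p k]. The sums are the accumulated
    corrections evaluated at [x i j]. *)
Lemma VeS_x p k i j : hprime p -> Ve p k.+1 (x i j) =
  s p k.+1 i j - s p k i j + r p k +
    \sum_(l < k.+1) (\sum_b s p l i b + \sum_a s p l a j) - 2 * \sum_(l < k.+1) r p l.
Proof.
move=> hp; have [h _] := V_invariant q1 qF k.+1 hp.
rewrite h; last exact: mh_x.
rewrite base_e_x; last exact: st_e_valid.
rewrite -[st_e p k.+1]/(stepC (stepJ (st_e p k))) is_pole_C is_pole_J; last exact: st_e_valid.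
rewrite is_rank_C tws_x /s /r /cum_r /cum_s -[st_e p k.+1]/(stepC (stepJ (st_e p k))).
have -> : \sum_(l < k.+1) (\sum_b s p l i b + \sum_a s p l a j) =
    \sum_b \sum_(l < k.+1) s p l i b + \sum_a \sum_(l < k.+1) s p l a j.
  by rewrite big_split /=; congr (_ + _); apply: exchange_big.
rewrite /s /r /=; ring.
Qed.

Lemma Vo0_dt p : hprime p -> Vo p 0 dt = r p 0 - \sum_a \sum_b s p 0 a b.
Proof.
move=> hp; have [_ h] := V_invariant q1 qF 0 hp.
rewrite h; last exact: mh_dt.
rewrite base_o_dt; last exact: st_o_valid.
rewrite tws_dt /cum_s /cum_r big_ord0 mulr0 mul0r addr0.
rewrite [X in 2 * X]big1 => [|a _]; last by rewrite big1 // => b _; rewrite big_ord0.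
rewrite mulr0 subr0 is_rank_J /= subr0; congr (_ - _).
by apply: eq_bigr => a _; apply: eq_bigr => b _; rewrite is_pole_J.
Qed.

Lemma VoS_dt p k : hprime p -> Vo p k.+1 dt =
  r p k.+1 - r p k - \sum_a \sum_b s p k.+1 a b -
    2 * \sum_(l < k.+1) \sum_a \sum_b s p l a b + 2 * q%:Z * \sum_(l < k.+1) r p l.
Proof.
move=> hp; have [_ h] := V_invariant q1 qF k.+1 hp.
rewrite h; last exact: mh_dt.
rewrite base_o_dt; last exact: st_o_valid.
rewrite tws_dt.
have -> : is_rank (st_o p k.+1) = is_det (st_o p k).
  by rewrite /st_o is_rank_J -[st_e p k.+1]/(stepC (stepJ (st_e p k))) is_rank_C.
have -> : \sum_a \sum_b (is_pole (st_o p k.+1) a b)%:Z = \sum_a \sum_b s p k.+1 a b.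
  apply: eq_bigr => a _; apply: eq_bigr => b _; rewrite /st_o is_pole_J //.
  exact: st_e_valid.
have -> : \sum_(l < k.+1) \sum_a \sum_b s p l a b = \sum_a \sum_b cum_s p k.+1 a b.
  rewrite exchange_big; apply: eq_bigr => a _; exact: exchange_big.
rewrite -/(r p k.+1) -/(r p k) /cum_r; ring.
Qed.

(* Each of the finitely many forms under consideration has finitely many prime factors, so that
   all degree sums can be taken over one sufficiently large finite list of primes. *)
Definition ev_list (P : seq A -> Prop) := exists2 L0 : seq A, {in L0, forall p, hprime p} &
  forall L, uniq L -> {in L, forall p, hprime p} -> {subset L0 <= L} -> P L.

Lemma ev_and P Q : ev_list P -> ev_list Q -> ev_list (fun L => P L /\ Q L).
Proof.
move=> [L1 h1 e1] [L2 h2 e2]; exists (L1 ++ L2) => [p|L uL hL sL].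
  by rewrite mem_cat => /orP[/h1|/h2].
by split; [apply: e1|apply: e2] => // p pL; apply: sL; rewrite mem_cat pL ?orbT.
Qed.

Lemma ev_mono P Q : (forall L, {in L, forall p, hprime p} -> P L -> Q L) -> ev_list P -> ev_list Q.
Proof. by move=> h [L0 h0 e0]; exists L0 => // L uL hL sL; apply: h => //; apply: e0. Qed.

Lemma ev_forall (T : finType) (P : T -> seq A -> Prop) :
  (forall t, ev_list (P t)) -> ev_list (fun L => forall t, P t L).
Proof.
move=> h; suff [L0 h0 e0] : ev_list (fun L => {in enum T, forall t, P t L}).
  by exists L0 => // L uL hL sL t; apply: (e0 L) => //; rewrite mem_enum.
elim: (enum T) => [|t r IHr]; first by exists [::].
apply: ev_mono (ev_and (h t) IHr) => L _ [h1 h2] t'; rewrite inE => /predU1P[->//|]; exact: h2.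
Qed.

Lemma ev_ltn K (P : nat -> seq A -> Prop) :
  (forall k, (k < K)%N -> ev_list (P k)) -> ev_list (fun L => forall k, (k < K)%N -> P k L).
Proof.
move=> h; apply: ev_mono (ev_forall (fun k : 'I_K => h k (ltn_ord k))) => L _ hL k kK.
exact: (hL (Ordinal kK)).
Qed.

Lemma ev_ex P : ev_list P -> exists L, {in L, forall p, hprime p} /\ P L.
Proof.
move=> [L0 h0 e0]; exists (undup L0); split; first by move=> p; rewrite mem_undup => /h0.
by apply: e0; [exact: undup_uniq|move=> p; rewrite mem_undup => /h0|move=> p; rewrite mem_undup].
Qed.

Definition dsum (L : seq A) (V : A -> int) : int := \sum_(p <- L) (degp p)%:Z * V p.

Definition deg_sum (V : A -> A -> int) (c : int) :=
  forall g, hom g -> ev_list (fun L => dsum L (fun p => V p g) = c * (degp g)%:Z).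

(** Unique factorization: the degree of a form is the sum of the degrees of its primes, with
    multiplicity. *)
Lemma deg_sum_vp : deg_sum (fun p g => (vp p g)%:Z) 1.
Proof.
move=> g [g0 [d hd]]; have [c [t [c0 ht gE]]] := homog_factor_hprime g0 hd.
exists t => // L uL hL tL; rewrite mul1r /dsum.
have {g0 hd d gE} : degp g = (\sum_(p <- t) degp p)%N /\ forall p, hprime p -> vp p g = count_mem p t.
  rewrite gE; elim: t ht {tL gE} => [|p t IHt] ht.
    rewrite !big_nil mulr1 degp_C; split=> // p hp.
    by rewrite vp_C.
  have ht' : {in t, forall p, hprime p} by move=> p' p't; apply: ht; rewrite inE p't orbT.
  have hp := ht p (mem_head _ _); have p0 := hom_neq0 (hprime_hom hp).
  have [IH1 IH2] := IHt ht'.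
  have h0 : c%:MP_[q * q] * \prod_(p <- t) p != 0.
    rewrite mulf_neq0 ?mpolyC_eq0 // prodf_seq_neq0; apply/allP => p' /ht' hp' /=.
    exact: hom_neq0 (hprime_hom hp').
  rewrite !big_cons mulrCA degpM // IH1; split=> // p' hp'.
  by rewrite vpM //; rewrite (vp_hprime hp' hp) (IH2 _ hp') /= eq_sym.
move=> [-> hv]; rewrite (eq_big_seq (fun p => (degp p * count_mem p t)%:Z)); last first.
  by move=> p pL; rewrite (hv _ (hL _ pL)) PoszM.
elim: t tL {ht hv} => [|p t IHt] tL.
  by rewrite big_nil big1 // => p _; rewrite muln0.
rewrite big_cons PoszD -IHt; last by move=> p' p't; apply: tL; rewrite inE p't orbT.
have pL : p \in L by apply: tL; rewrite mem_head.
rewrite !(bigD1_seq p pL uL) /= eqxx mulnDr PoszD muln1 -addrA; congr (_ + (_ + _)).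
by apply: eq_bigr => p' ne; rewrite eq_sym (negPf ne).
Qed.

(** The total for [sub sg g] is [c * (e - 1) * degp g] and the normalisation removes
    [c * e * degp g]. *)
Lemma deg_sum_op sg ms e V c : involutive sg ms e -> deg_sum V c ->
  deg_sum (fun p => op sg ms (V p)) (- c).
Proof.
move=> I hV g hg; have h1 := hV _ (sub_hom I hg); have h2 := hV _ (inv_ms I).
apply: ev_mono (ev_and h1 h2) => L _ [e1 e2].
rewrite /dsum /op; under eq_bigr => p _ do rewrite mulrBr mulrCA.
rewrite sumrB -mulr_sumr -!/(dsum _ _) e1 e2 (degp_ms I) (degp_sub I hg).
by have := inv_e I; case: (e) => [|k] //= _; rewrite !(PoszM, intS); ring.
Qed.

Lemma deg_sum_Ve k : deg_sum (fun p => Ve p k) 1.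
Proof.
elim: k => [|k IHk]; first exact: deg_sum_vp.
by have h := deg_sum_op IC (deg_sum_op IJ IHk); rewrite opprK in h.
Qed.

Lemma deg_sum_Vo k : deg_sum (fun p => Vo p k) (- 1).
Proof. exact: deg_sum_op IJ (deg_sum_Ve k). Qed.

Lemma dsumD L (V V' : A -> int) : dsum L (fun p => V p + V' p) = dsum L V + dsum L V'.
Proof. by rewrite /dsum -big_split; apply: eq_bigr => p _ /=; ring. Qed.

Lemma dsumB L (V V' : A -> int) : dsum L (fun p => V p - V' p) = dsum L V - dsum L V'.
Proof. by rewrite /dsum -sumrB; apply: eq_bigr => p _ /=; ring. Qed.

Lemma dsumZ L c (V : A -> int) : dsum L (fun p => c * V p) = c * dsum L V.
Proof. by rewrite /dsum mulr_sumr; apply: eq_bigr => p _ /=; ring. Qed.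

Lemma dsum_sum L (I : finType) (V : I -> A -> int) :
  dsum L (fun p => \sum_i V i p) = \sum_i dsum L (V i).
Proof.
rewrite /dsum exchange_big; apply: eq_bigr => p _ /=; rewrite mulr_sumr //.
Qed.

Lemma eq_dsum L (V V' : A -> int) : {in L, V =1 V'} -> dsum L V = dsum L V'.
Proof. by move=> h; rewrite /dsum; apply: eq_big_seq => p /h ->. Qed.

(* The total degree of the primes that reach a given entry, resp. the determinant, at time [k]. *)
Definition SL L k i j := dsum L (fun p => s p k i j).
Definition RL L k := dsum L (fun p => r p k).

(** Over all primes the values at an entry total 1 before the Hadamard inverse, and the values at
    the determinant total [- q] after it. Inserting the formulas for single orbits gives the
    hypotheses of [balance_recursion]. *)
Lemma counts K : ev_list (fun L => forall k, (k <= K)%N ->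
  (forall i j, SL L k i j = Sn q k) /\
  (q%:Z - 2) * RL L k = q%:Z * (Sn q k.+1 + Sn q k - 1)).
Proof.
have h1 k i j : ev_list (fun L => dsum L (fun p => Ve p k (x i j)) = 1).
  by have := deg_sum_Ve k (hom_x F i j); rewrite degp_x.
have h2 k : ev_list (fun L => dsum L (fun p => Vo p k dt) = - q%:Z).
  by have := deg_sum_Vo k (hom_dC F q1); rewrite (degp_ms IC) mulN1r.
have h1K := ev_ltn (K := K.+1) (fun k _ => ev_forall (fun i => ev_forall (h1 k i))).
have h2K := ev_ltn (K := K.+1) (fun k _ => h2 k).
apply: ev_mono (ev_and h1K h2K) => L hL [e1 e2].
apply: (balance_recursion q2 (s := SL L) (r := RL L)).
- move=> i j; rewrite -[RHS](e1 0%N isT i j); apply: eq_dsum => p /hL hp.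
  by rewrite Ve0_x.
- move=> k i j kK; apply: (eq_trans (esym (e1 k.+1 kK i j))).
  transitivity (dsum L (fun p => s p k.+1 i j - s p k i j + r p k +
    \sum_(l < k.+1) (\sum_b s p l i b + \sum_a s p l a j) - 2 * \sum_(l < k.+1) r p l)).
    by apply: eq_dsum => p /hL hp; apply: VeS_x.
  rewrite dsumB dsumD dsumD dsumB dsumZ !dsum_sum; congr (_ + _ - _).
  by apply: eq_bigr => l _; rewrite dsumD !dsum_sum.
- apply: (eq_trans (esym (e2 0%N isT))).
  transitivity (dsum L (fun p => r p 0 - \sum_a \sum_b s p 0 a b)).
    by apply: eq_dsum => p /hL hp; apply: Vo0_dt.
  rewrite dsumB dsum_sum; congr (_ - _); apply: eq_bigr => a _.
  by rewrite dsum_sum.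
move=> k kK; apply: (eq_trans (esym (e2 k.+1 kK))).
transitivity (dsum L (fun p => r p k.+1 - r p k - \sum_a \sum_b s p k.+1 a b -
    2 * \sum_(l < k.+1) \sum_a \sum_b s p l a b + 2 * q%:Z * \sum_(l < k.+1) r p l)).
  by apply: eq_dsum => p /hL hp; apply: VoS_dt.
rewrite dsumD !dsumB !dsumZ !dsum_sum; congr (_ - _ - _ + _).
  by apply: eq_bigr => a _; rewrite dsum_sum.
congr (_ * _); apply: eq_bigr => l _; rewrite dsum_sum; apply: eq_bigr => a _.
by rewrite dsum_sum.
Qed.

End Balance.

(** * Degrees of the iterates *)

Section Degrees.
Variables (F : fieldType) (q : nat).
Local Notation A := {mpoly F[q * q]}.
Local Notation x := (@xv F q).
Hypothesis q2 : (2 < q)%N.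
Let q1 : (1 < q)%N := ltnW q2.
Local Notation dt := (dC F q).
Local Notation C := (Cm F q).
Local Notation J := (Jm F q).
Local Notation m := (mJ F q).
Local Notation hom := (@hom F (q * q)).
Let IJ := J_involutive F q1.
Let IC := C_involutive F q1.
Implicit Types (g p : A) (G M : 'M[A]_q).

Hypothesis qF : q%:R != 0 :> F.

Let i0 : 'I_q := Ordinal (ltn_trans (ltn0Sn 1) q2).

(** This notion, [reduced_mx] and [has_deg] restate over a general field what the theorem uses over
    the complex numbers, in a shape that makes [has_degreeE] hold by conversion. *)
Definition same_ratio M G := forall i j k l, M i j * G k l = M k l * G i j.

Definition reduced_mx G e :=
  [/\ G != 0, (forall i j, G i j \is e.-homog) &
      ~ (exists H : A, (1 < msize H)%N /\ forall i j, exists Q : A, G i j = H * Q)].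

Definition has_deg M e := exists G, reduced_mx G e /\ same_ratio M G.

Definition Kmap : 'M[A]_q := map_mx (sub J) (\adj (Xm F q)).
Definition Kiter n : 'M[A]_q := iter n (fun M => map_mx (sub M) Kmap) (Xm F q).

Definition dominant M := exists D, forall g, hom g -> hom (sub M g) /\ degp (sub M g) = (degp g * D)%N.

Lemma dominant_id : dominant (Xm F q).
Proof. by exists 1%N => g hg; rewrite sub_id muln1. Qed.

Lemma dominant_comp sg ms e M : involutive sg ms e -> dominant M -> dominant (map_mx (sub M) sg).
Proof.
move=> I [D hD]; exists (e.-1 * D)%N => g hg; rewrite -sub_comp.
have [h1 ->] := hD _ (sub_hom I hg); split=> //.
by rewrite (degp_sub I hg) mulnA.
Qed.

Fixpoint chain n : 'M[A]_q :=
  if n is n'.+1 then map_mx (sub (map_mx (sub (chain n')) J)) C else Xm F q.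

Lemma dominant_chain n : dominant (chain n).
Proof.
elim: n => [|n IHn]; first exact: dominant_id.
exact: dominant_comp IC (dominant_comp IJ IHn).
Qed.

Lemma op_pullback sg ms e M (V : A -> int) p c : involutive sg ms e ->
  (forall g, hom g -> V g = (vp p (sub M g))%:Z - (degp g)%:Z * c) ->
  exists c', forall g, hom g ->
    op sg ms V g = (vp p (sub (map_mx (sub M) sg) g))%:Z - (degp g)%:Z * c'.
Proof.
move=> I hV; exists (e.-1%:Z * c + V ms) => g hg.
rewrite /op hV; last exact: sub_hom I _ hg.
by rewrite -sub_comp (degp_sub I hg) PoszM; ring.
Qed.

(** The normalisations of the single steps combine into one multiple of the degree, which disappears
    when two entries are compared. *)
Lemma Ve_chain p n : exists c, forall g, hom g ->
  Ve p n g = (vp p (sub (chain n) g))%:Z - (degp g)%:Z * c.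
Proof.
elim: n => [|n [c hc]]; first by exists 0 => g hg; rewrite /= sub_id mulr0 subr0.
have [c1 hc1] := op_pullback IJ hc; exact: op_pullback IC hc1.
Qed.

Lemma same_ratio_refl M : same_ratio M M.
Proof. by move=> i j k l; rewrite mulrC. Qed.

Lemma has_deg_tr M e : has_deg M e -> has_deg M^T e.
Proof.
move=> [G [[G0 hG nG] sG]]; exists G^T; split; last by move=> i j k l; rewrite !mxE sG.
split=> [|i j|[H [h1 h2]]]; first by rewrite trmx_eq0.
  by rewrite mxE.
by apply: nG; exists H; split=> // i j; have [Q hQ] := h2 j i; exists Q; rewrite mxE in hQ.
Qed.

Lemma sub_Jm_tr M : map_mx (sub M^T) J = (map_mx (sub M) J)^T.
Proof.
have hm : sub (Xm F q)^T m = m.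
  rewrite /mJ rmorph_prod /= !(@sum_mxvec q A 1 _) exchange_big; apply: eq_bigr => j _.
  by apply: eq_bigr => i _; rewrite /= (sub_xv (Xm F q)^T i j) !mxE.
have hX : map_mx (sub (Xm F q)^T) J = J^T.
  apply/matrixP => i j; rewrite [LHS]mxE [RHS]mxE; apply: (mulIf (x_neq0 F j i)).
  have xE : (Xm F q)^T i j = x j i by rewrite !mxE.
  have := congr1 (sub (Xm F q)^T) (JmM F i j).
  by rewrite rmorphM /= sub_xv xE hm JmM.
have -> : M^T = map_mx (sub M) (Xm F q)^T.
  by apply/matrixP => i j; rewrite !mxE sub_xv.
have comp (Y : 'M[A]_q) : map_mx (sub (map_mx (sub M) Y)) J = map_mx (sub M) (map_mx (sub Y) J).
  by apply/matrixP => i j; rewrite [LHS]mxE -sub_comp [RHS]mxE [in RHS]mxE.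
rewrite map_trmx.
transitivity (map_mx (sub M) (map_mx (sub (Xm F q)^T) J)); first exact: comp.
by rewrite hX.
Qed.

Lemma Kmap_adj : Kmap = \adj J.
Proof. by rewrite /Kmap map_mx_adj map_Xm. Qed.

Lemma KiterS n :
  Kiter n.+1 = \adj (map_mx (sub (Kiter n)) J).
Proof.
rewrite -[Kiter n.+1]/(map_mx (sub (Kiter n)) Kmap).
by move: (Kiter n) => M; rewrite Kmap_adj map_mx_adj.
Qed.

(** Each adjugate differs from the cofactor matrix by a transposition, and transposition commutes
    with both involutions. *)
Lemma Kiter_chain n :
  Kiter n = chain n \/ Kiter n = (chain n)^T.
Proof.
elim: n => [|n IHn]; first by left.
rewrite KiterS /=; move: (chain n) (Kiter n) IHn => P M.
rewrite sub_Cm => -[->|->]; first by right; rewrite trmxK.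
by left; rewrite sub_Jm_tr trmx_adj.
Qed.

(** All entries have the same degree [D], and dividing them by a nonconstant common factor lowers
    it; induction on [D]. *)
Lemma dominant_reduced M : dominant M -> exists e, has_deg M e.
Proof.
move=> [D hD].
have : forall i j, hom (M i j) /\ degp (M i j) = D.
  by move=> i j; have := hD _ (hom_x F i j); rewrite sub_xv degp_x mul1n.
have [N] := ubnP D; elim: N D M {hD} => // N IHN D M DN hM.
have [[H [h1 h2]]|nr] := pselect (exists H : A, (1 < msize H)%N /\
  forall i j, exists Q : A, M i j = H * Q); last first.
  exists D, M; split; last exact: same_ratio_refl.
  split=> // [|i j]; last by have [h <-] := hM i j; exact: hom_degp.
  apply/eqP => M0; have [[]] := hM i0 i0; by rewrite M0 mxE eqxx.
have [Q hQ] := choice (fun ij : 'I_q * 'I_q => h2 ij.1 ij.2).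
have hHQ i j : hom H /\ hom (Q (i, j)).
  by apply: hom_divl; have := (hM i j).1; rewrite (hQ (i, j)).
have hH := (hHQ i0 i0).1.
have dQ i j : (D = degp H + degp (Q (i, j)))%N.
  rewrite -degpM ?hom_neq0 //; last by have [] := hHQ i j.
  by rewrite -(hQ (i, j)) (hM i j).2.
have dH : (0 < degp H)%N by rewrite /degp -ltnS prednK //; exact: leq_trans h1.
have [||e [G [rG sG]]] := IHN (D - degp H)%N (\matrix_(i, j) Q (i, j)).
- by have := dQ i0 i0; move: DN dH; lia.
- by move=> i j; rewrite mxE; split; [have [] := hHQ i j|rewrite (dQ i j) addKn].
exists e, G; split=> // i j k l; have := sG i j k l; rewrite !mxE (hQ (i, j)) (hQ (k, l)) /= => h.
by rewrite -!mulrA h.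
Qed.

Lemma V_entry p n i j : hprime p -> Ve p n (x i j) =
  base_e (st_e p n) (x i j) + \sum_b cum_s p n i b + \sum_a cum_s p n a j - 2 * cum_r p n.
Proof.
move=> hp; have [h _] := V_invariant q1 qF n hp.
by rewrite h; [rewrite tws_x; ring | exact: mh_x].
Qed.

Lemma sum_s_unit p n a b : is_x (st_e p n) a b -> \sum_i \sum_j s p n i j = 1.
Proof.
rewrite /s; case: (st_e p n) => //= p' /eqP->.
rewrite (bigD1 a) //= (bigD1 b) //= eqxx.
rewrite big1 => [|b' nb]; last by rewrite x_inj eqxx eq_sym (negPf nb).
rewrite big1 => [|a' na]; first by rewrite !addr0.
by rewrite big1 // => b' _; rewrite x_inj eq_sym (negPf na).
Qed.

Section Reduced.
Variables (n : nat) (G : 'M[A]_q) (e : nat).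
Hypotheses (pG : reduced_mx G e) (rG : same_ratio (chain n) G).

Lemma reduced_hom i j : hom (G i j) /\ degp (G i j) = e.
Proof.
have [G0 hG _] := pG; have [D hD] := dominant_chain n.
have M0 k l : chain n k l != 0.
  by rewrite -(sub_xv (chain n)); have [/hom_neq0] := hD _ (hom_x F k l).
suff h : G i j != 0 by split; [split=> //; exists e | apply: degp_homog].
apply: contraNneq G0 => Gij; apply/eqP/matrixP => k l; rewrite mxE.
have := rG i j k l; rewrite Gij mulr0 => /eqP.
by rewrite mulf_eq0 (negPf (M0 i j)) => /eqP.
Qed.

(** Differences of orders between entries depend only on the rational map. With [reduced_min], the
    order of [G i j] is therefore the value of [Ve p n] at that entry minus its minimum over all
    entries. *)
Lemma reduced_vp p i j k l : hprime p ->
  (vp p (G i j))%:Z - (vp p (G k l))%:Z = Ve p n (x i j) - Ve p n (x k l).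
Proof.
move=> hp; have [D hD] := dominant_chain n; have [c hc] := Ve_chain p n.
have M0 a b : chain n a b != 0.
  by rewrite -(sub_xv (chain n)); have [/hom_neq0] := hD _ (hom_x F a b).
have G0 a b : G a b != 0 by apply/hom_neq0; case: (reduced_hom a b).
rewrite !hc ?sub_xv; try exact: hom_x.
have := congr1 (vp p) (rG i j k l); rewrite !vpM // !degp_x.
move: (vp p (chain n i j)) (vp p (chain n k l)) (vp p (G i j)) (vp p (G k l)); lia.
Qed.

Lemma reduced_min p : hprime p -> exists i j, vp p (G i j) = 0%N.
Proof.
move=> hp; apply: contrapT => ne; have [_ _ nG] := pG; apply: nG; exists p; split.
  by have := prime_degp (hprime_prime hp); rewrite /degp; lia.
move=> i j; have /hom_neq0 G0 : hom (G i j) by case: (reduced_hom i j).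
have [vij|vij] := posnP (vp p (G i j)); first by case: ne; exists i, j.
by have [Q QE] := (vp_gt0 hp G0).1 vij; exists Q.
Qed.

(** The alternating sum over the entries of a 2 by 2 block cancels all row and column twists, while
    a centre at [x a b] contributes 1 to it. *)
Lemma constant_V_s p : hprime p -> (forall i j k l, Ve p n (x i j) = Ve p n (x k l)) ->
  forall i j, s p n i j = 0.
Proof.
move=> hp hV a b; rewrite /s; case: (boolP (is_x _ a b)) => // hab; exfalso.
have [i ia] : exists i, i != a.
  have [->|ne] := eqVneq a i0; last by exists i0; rewrite eq_sym.
  by exists (Ordinal q1).
have [j jb] : exists j, j != b.
  have [->|ne] := eqVneq b i0; last by exists i0; rewrite eq_sym.
  by exists (Ordinal q1).
have h1 := hV a b i b; have h2 := hV a j i j; move: h1 h2.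
rewrite !V_entry //; have hst := st_e_valid q1 n hp.
rewrite !(base_e_x q2 _ _ hst); move: hab; case: (st_e p n) => //= p' /eqP->.
rewrite !x_inj !eqxx ![a == i]eq_sym ![b == j]eq_sym (negPf ia) (negPf jb) /=; lia.
Qed.

(** A centre lies on at most one coordinate hyperplane, so the left side is 0 or 1. If [p] divides
    no entry of [G], all differences vanish and [constant_V_s] makes it 0. *)
Lemma sum_s_le_vp p : hprime p ->
  \sum_i \sum_j s p n i j <= \sum_i \sum_j (vp p (G i j))%:Z.
Proof.
move=> hp.
have [h|h] := pselect (exists i j, (0 < vp p (G i j))%N); last first.
  rewrite big1 => [|i _]; first by apply: sumr_ge0 => i _; apply: sumr_ge0.
  apply: big1 => j _; apply: constant_V_s => // a b c d; apply/eqP.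
  have z k l : vp p (G k l) = 0%N.
    by have [//|v] := posnP (vp p (G k l)); case: h; exists k, l.
  by rewrite -subr_eq0 -reduced_vp // !z.
have [i [j v]] := h.
have {h v} : 1 <= \sum_i \sum_j (vp p (G i j))%:Z :> int.
  rewrite (bigD1 i) //= (bigD1 j) //= -addrA; apply: le_trans (_ : (vp p (G i j))%:Z <= _).
    by rewrite lez_nat.
  by rewrite lerDl addr_ge0 //; apply: sumr_ge0 => k _ //; apply: sumr_ge0.
apply: le_trans.
have [[a [b h]]|h] := pselect (exists a b, is_x (st_e p n) a b).
  by rewrite (sum_s_unit h).
rewrite big1 // => a _; apply: big1 => b _; rewrite /s.
by case: (boolP (is_x _ _ _)) => // hab; case: h; exists a, b.
Qed.

(** At the entry where the order of [G] is 0, the term [- s] is absorbed by the twist accumulated at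
    that same entry, so only the terms [- 2 * r] can make the minimum negative. *)
Lemma vp_le p i j : hprime p ->
  (vp p (G i j))%:Z <= Ve p n (x i j) + 2 * \sum_(l < n) r p l.
Proof.
move=> hp; have [k [l v0]] := reduced_min hp.
have := reduced_vp i j k l hp; rewrite v0 subr0 => ->.
rewrite lerD2l; case: (n) => [|n'].
  by rewrite big_ord0 mulr0 Ve0_x // oppr_le0 /s.
rewrite VeS_x // big_ord_recr /=.
have s0 a b c : 0 <= s p a b c by [].
have r0 : 0 <= r p n' by [].
have h1 : s p n' k l <= \sum_(l0 < n'.+1) (\sum_b s p l0 k b + \sum_a s p l0 a l).
  rewrite big_ord_recr /= (bigD1 l) //= -!addrA addrCA lerDl !addr_ge0 //.
  - by apply: sumr_ge0 => t _; apply: addr_ge0; apply: sumr_ge0.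
  - by apply: sumr_ge0.
  by apply: sumr_ge0.
have h2 := s0 n'.+1 k l.
move: h1 h2 r0; rewrite big_ord_recr /=; lia.
Qed.

(** Weight the previous two bounds by the degrees of the primes and sum. In the first, both sides
    run over all entries and the factor [q * q] cancels; in the second, the values at an entry total
    1. *)
Lemma reduced_degree_bounds :
  Sn q n <= e%:Z /\
  (q%:Z - 2) * (e%:Z - 1) <= 2 * q%:Z * \sum_(l < n) (Sn q l.+1 + Sn q l - 1).
Proof.
have eG i j : ev_list (fun L => dsum L (fun p => (vp p (G i j))%:Z) = e%:Z).
  have [h1 h2] := reduced_hom i j; have := deg_sum_vp h1; rewrite h2 mul1r; apply: ev_mono.
  by move=> L _.
have eV : ev_list (fun L => dsum L (fun p => Ve p n (x i0 i0)) = 1).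
  by have := deg_sum_Ve q2 n (hom_x F i0 i0); rewrite degp_x mul1r.
have [L [hL [hc [hG hV]]]] := ev_ex (ev_and (counts q2 qF n)
  (ev_and (ev_forall (fun i => ev_forall (eG i))) eV)).
split.
  have : dsum L (fun p => \sum_i \sum_j s p n i j) <= dsum L (fun p => \sum_i \sum_j (vp p (G i j))%:Z).
    rewrite /dsum big_seq [X in _ <= X]big_seq; apply: ler_sum => p /hL hp.
    by rewrite ler_wpM2l // sum_s_le_vp.
  have sumc (c : int) : \sum_(a < q) c = q%:Z * c.
    by rewrite sumr_const card_ord pmulrn -mulrzl intz.
  rewrite !dsum_sum (eq_bigr (fun=> q%:Z * Sn q n)) => [|i _]; last first.
    rewrite dsum_sum -sumc; apply: eq_bigr => j _; exact: (hc n (leqnn n)).1.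
  rewrite [X in _ <= X](eq_bigr (fun=> q%:Z * e%:Z)) => [|i _]; last first.
    by rewrite dsum_sum -sumc; apply: eq_bigr => j _.
  by rewrite !sumc !mulrA ler_pM2l // mulr_gt0 // ltz_nat (ltn_trans _ q2).
have : e%:Z <= 1 + 2 * \sum_(l < n) RL L l.
  rewrite -(hG i0 i0) -[X in X + _]hV.
  have -> : \sum_(l < n) RL L l = dsum L (fun p => \sum_(l < n) r p l) by rewrite dsum_sum.
  rewrite -dsumZ -dsumD /dsum big_seq [X in _ <= X]big_seq; apply: ler_sum => p /hL hp.
  by rewrite ler_wpM2l // vp_le.
rewrite -lerBlDl => h.
have h2 : 0 <= q%:Z - 2 by rewrite subr_ge0 lez_nat ltnW.
apply: le_trans (ler_wpM2l h2 h) _; rewrite mulrCA -mulrA ler_wpM2l //.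
rewrite !mulr_sumr; apply: ler_sum => l _.
by have [_ ->] := hc l (ltnW (ltn_ord l)).
Qed.

End Reduced.

(** A representative of degree 0 has constant entries, so every [Ve p n] is a multiple of the
    degree. This persists under both pull-backs; the next values are then constant on entries and
    [constant_V_s] applies. *)
Lemma degree_zero_next n : has_deg (chain n) 0 -> Sn q n.+1 = 0.
Proof.
move=> [G [pG rG]].
have [D hD] := dominant_chain n.
have hM i j : hom (chain n i j) by rewrite -(sub_xv (chain n)); case: (hD _ (hom_x F i j)).
have hG i j := (reduced_hom pG rG i j).1.
have v0 p g : hprime p -> g != 0 -> g \is 0.-homog -> vp p g = 0%N.
  move=> hp g0 hg; apply/vp_eq0 => // -[Q gE].
  have := degp_homog g0 hg; move: g0; rewrite gE mulf_eq0 negb_or => /andP[p0 Q0].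
  by rewrite degpM //; have := prime_degp (hprime_prime hp); lia.
have hV p : hprime p -> exists c, forall g, hom g -> Ve p n g = c * (degp g)%:Z.
  move=> hp; have [c hc] := Ve_chain p n.
  exists ((vp p (chain n i0 i0))%:Z - c) => g hg; rewrite hc //.
  have gd := hom_degp hg; have [/hom_neq0 Mg0 _] := hD _ hg.
  have e1 : map_mx ( *%R (G i0 i0)) (chain n) = map_mx ( *%R (chain n i0 i0)) G.
    by apply/matrixP => i j; rewrite !mxE mulrC rG mulrC.
  have := congr1 (fun M => sub M g) e1; rewrite /= !(sub_scale _ _ gd) => e2.
  have Gg0 : sub G g != 0.
    apply: contraNneq (mulf_neq0 (expf_neq0 (degp g) (hom_neq0 (hG i0 i0))) Mg0).
    by rewrite e2 => ->; rewrite mulr0.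
  have hGg : sub G g \is 0.-homog.
    apply: (sub_homog (K := const_mx 0%N)) => [i j|mm _].
      by have [_ h _] := pG; rewrite mxE.
    by apply: big1 => k _; case/mxvec_indexP: k => i j; rewrite mxvecE mxE muln0.
  have := congr1 (vp p) e2;
  have vpXM a b k : a != 0 -> b != 0 -> vp p (a ^+ k * b) = (k * vp p a + vp p b)%N.
    by move=> a0 b0; rewrite vpM ?vpX ?expf_neq0.
  rewrite (vpXM _ _ _ (hom_neq0 (hG i0 i0)) Mg0) (vpXM _ _ _ (hom_neq0 (hM i0 i0)) Gg0).
  rewrite (v0 _ _ hp Gg0 hGg).
  rewrite (v0 _ _ hp (hom_neq0 (hG i0 i0))); last by have [_ h _] := pG.
  by rewrite muln0 add0n addn0 => ->; rewrite PoszM; ring.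
have hs p i j : hprime p -> s p n.+1 i j = 0.
  move=> hp; apply: constant_V_s => // a b k l; have [c hc] := hV p hp.
  have h1 : forall g, hom g -> Vo p n g = - (c * (degp g)%:Z).
    move=> g hg; rewrite -(op_deg c IJ hg); apply: op_ext; apply: hc.
      exact: sub_hom IJ _ hg.
    exact: hom_mJ.
  have h2 u v : Ve p n.+1 (x u v) = op C dt (fun g => - c * (degp g)%:Z) (x u v).
    apply: op_ext; rewrite mulNr; apply: h1; last exact: hom_dC.
    exact: sub_hom IC _ (hom_x F u v).
  by rewrite !h2 !(op_deg _ IC) ?degp_x //; exact: hom_x.
have [L [hL hc]] := ev_ex (counts q2 qF n.+1).
rewrite -((hc n.+1 (leqnn _)).1 i0 i0) /SL /dsum big_seq big1 // => p /hL hp.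
by rewrite hs // mulr0.
Qed.

Lemma Kiter_has_deg n : exists e, has_deg (Kiter n) e.
Proof.
have [e he] := dominant_reduced (dominant_chain n).
by exists e; case: (Kiter_chain n) => -> //; apply: has_deg_tr.
Qed.

Lemma Kiter_degree_bounds n e : has_deg (Kiter n) e ->
  [/\ Sn q n <= e%:Z,
      (q%:Z - 2) * (e%:Z - 1) <= 2 * q%:Z * \sum_(l < n) (Sn q l.+1 + Sn q l - 1) &
      e = 0%N -> Sn q n.+1 = 0].
Proof.
move=> he; have {}he : has_deg (chain n) e.
  by case: (Kiter_chain n) he => -> // /has_deg_tr; rewrite trmxK.
have [G [pG rG]] := he; have [h1 h2] := reduced_degree_bounds pG rG.
by split=> // e0; apply: degree_zero_next; rewrite -e0.
Qed.

End Degrees.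

(** * Transfer to the complex representatives of the statement *)

Section Bridge.
Variables (R : rcfType) (q : nat).
Hypothesis q2 : (2 < q)%N.

Lemma natq_neq0 : q%:R != 0 :> complex R.
Proof. by rewrite pnatr_eq0 -lt0n (ltn_trans _ q2). Qed.

Lemma has_degreeE n e :
  has_degree (iter_rep (Krep R q) n) e = has_deg (Kiter (complex R) q n) e.
Proof. by []. Qed.

Lemma has_degree_exists n : exists e, has_degree (iter_rep (Krep R q) n) e.
Proof.
have [e he] := Kiter_has_deg q2 natq_neq0 n.
by exists e; rewrite has_degreeE.
Qed.

Lemma has_degree_bounds n e : has_degree (iter_rep (Krep R q) n) e ->
  [/\ Sn q n <= e%:Z,
      (q%:Z - 2) * (e%:Z - 1) <= 2 * q%:Z * \sum_(l < n) (Sn q l.+1 + Sn q l - 1) &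
      e = 0%N -> Sn q n.+1 = 0].
Proof. by rewrite has_degreeE => /(Kiter_degree_bounds q2 natq_neq0). Qed.

End Bridge.

End Iterates.

From mathcomp Require Import all_classical all_reals all_analysis.
Import Iterates.
Import numFieldNormedType.Exports.
Local Open Scope classical_set_scope.
Local Open Scope ring_scope.

(** * Growth *)

Section Growth.
Variables (R : realType) (q : nat).
Hypothesis q2 : (2 < q)%N.

Definition TR : R := q%:R ^+ 2 - 4 * q%:R + 2.
Let a k : R := (Sn q k)%:~R.

Lemma a0 : a 0%N = 1. Proof. by []. Qed.
Lemma a1 : a 1%N = TR + q%:R.
Proof. by rewrite /a Sn1 /trK /TR !(rmorphD, rmorphN, rmorphM, rmorphXn). Qed.
Lemma aSS k : a k.+2 = TR * a k.+1 - a k + q%:R.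
Proof. by rewrite /a SnSS /trK /TR !(rmorphD, rmorphN, rmorphM, rmorphXn). Qed.

Lemma q3R : 3 <= q%:R :> R. Proof. by rewrite ler_nat. Qed.

(** For [q = 3] the discriminant is negative and both roots have modulus 1; otherwise this is the
    larger of two real roots with product 1. *)
Definition lam : R := if q == 3%N then 1 else (TR + Num.sqrt (TR ^+ 2 - 4)) / 2.

Lemma TR3 : q = 3%N -> TR = -1.
Proof. by rewrite /TR => ->; ring. Qed.

Lemma TR_ge2 : q != 3%N -> 2 <= TR.
Proof.
move=> q3; have : (4 <= q)%N by move: q2 q3; lia.
rewrite -(ler_nat R) /TR => q4; nra.
Qed.

Lemma lam_ge1 : 1 <= lam.
Proof.
rewrite /lam; case: eqP => // /eqP /TR_ge2 T2.
have := sqrtr_ge0 (TR ^+ 2 - 4); lra.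
Qed.

Lemma lam_quad : q != 3%N -> lam ^+ 2 = TR * lam - 1.
Proof.
move=> q3; rewrite /lam (negPf q3); have T2 := TR_ge2 q3.
have : Num.sqrt (TR ^+ 2 - 4) ^+ 2 = TR ^+ 2 - 4 by rewrite sqr_sqrtr //; nra.
move: (Num.sqrt _) => w wE; nra.
Qed.

Lemma three_periodic k : q = 3%N ->
  (a k = 1 /\ a k.+1 = 2) \/ (a k = 2 /\ a k.+1 = 0) \/ (a k = 0 /\ a k.+1 = 1).
Proof.
move=> q3; elim: k => [|k IHk].
  by left; rewrite a0 a1 TR3 // q3; split=> //; ring.
rewrite aSS TR3 // q3; case: IHk => [[-> ->]|[[-> ->]|[-> ->]]].
- by right; left; split=> //; ring.
- by right; right; split=> //; ring.
by left; split=> //; ring.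
Qed.

(** The combination [a k.+1 - lam * a k] belongs to the other root: at each step it is divided by
    [lam] and increased by [q]. As [lam >= 1] it grows at most linearly; this rate is attained for
    [q = 4], where [lam = 1]. *)
Lemma a_growth k : q != 3%N -> lam ^+ k <= a k /\
  0 <= a k.+1 - lam * a k <= (TR + q%:R) * k.+1%:R.
Proof.
move=> q3; have l1 := lam_ge1; have lq := lam_quad q3; have T2 := TR_ge2 q3.
have q3' := q3R.
elim: k => [|k [IH1 /andP[IH2 IH3]]].
  split; first by rewrite expr0.
  rewrite a0 a1 mulr1; nra.
split; first by rewrite exprS; nra.
have e : lam * (a k.+2 - lam * a k.+1) = (a k.+1 - lam * a k) + lam * q%:R.
  rewrite aSS mulrBr mulrA -expr2 lq; ring.
move: e IH2 IH3; rewrite -[k.+2%:R]natr1; move: (k.+1%:R) (a k.+2 - _) (a k.+1 - _) => t u v.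
move=> e v0 vt; have u0 : 0 <= u by nra.
rewrite u0 /=; nra.
Qed.

Lemma a_upper k : a k <= (TR + q%:R) * k.+1%:R ^+ 2 * lam ^+ k.
Proof.
have q3' := q3R.
have [q3|q3] := eqVneq q 3%N.
  have -> : lam = 1 by rewrite /lam q3.
  have : a k <= 2.
    by case: (three_periodic k q3) => [[-> _]|[[-> _]|[-> _]]]; lra.
  have : 1 <= k.+1%:R :> R by rewrite ler1n.
  rewrite TR3 // q3 expr1n; nra.
have T2 := TR_ge2 q3; have l1 := lam_ge1.
elim: k => [|k IHk]; first by rewrite a0; nra.
have [_ /andP[_ h]] := a_growth k q3.
have p1 : 1 <= lam ^+ k.+1 by rewrite exprn_ege1.
have t1 : 1 <= k.+1%:R :> R by rewrite ler1n.
rewrite -[k.+2%:R]natr1.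
have h1 : lam * a k <= (TR + q%:R) * k.+1%:R ^+ 2 * lam ^+ k.+1.
  by rewrite (exprS lam); rewrite [X in _ <= X](_ : _ = lam * ((TR + q%:R) * k.+1%:R ^+ 2 * lam ^+ k)); [rewrite ler_wpM2l //; lra|ring].
have c0 : 0 <= TR + q%:R by lra.
move: (k.+1%:R) (lam ^+ k.+1) (TR + q%:R) h h1 p1 t1 c0 => t p c h h1 p1 t1 c0.
have h2 : c * t <= c * t * p by rewrite ler_peMr //; nra.
have h3 : 0 <= c * p * (t + 1) by nra.
nra.
Qed.

Section Degrees.
Variable d : nat -> nat.
Hypothesis hd : forall n, has_degree (iter_rep (Krep R q) n) (d n).

Lemma degree_lower n : lam ^+ n <= (d n)%:R.
Proof.
have [h1 _ h3] := has_degree_bounds q2 (hd n).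
have h1' : a n <= (d n)%:R by rewrite /a -[(d n)%:R]/((d n)%:Z%:~R) ler_int.
have [q3|q3] := eqVneq q 3%N; last exact: le_trans (a_growth n q3).1 h1'.
rewrite /lam q3 /= expr1n ler1n lt0n; apply/negP => /eqP d0.
move: h1'; have := three_periodic n q3.
by rewrite d0 /a (h3 d0) => -[[-> h]|[[-> h]|[_ h]]]; lra.
Qed.

(** The [n] summands raise the quadratic factor of [a_upper] to a cubic one, and [q - 2 >= 1]
    removes the denominator. This gives the constant 4; 5 also absorbs the 1 in [d n - 1]. *)
Lemma degree_upper n : (d n)%:R <= 5 * q%:R * (TR + q%:R) * n.+1%:R ^+ 3 * lam ^+ n.
Proof.
have [_ h2 _] := has_degree_bounds q2 (hd n).
have q3' := q3R; have l1 := lam_ge1.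
have c2 : 2 <= TR + q%:R.
  have [q3|/TR_ge2] := eqVneq q 3%N; last by lra.
  by rewrite TR3 // q3; lra.
have {}h2 : (q%:R - 2) * ((d n)%:R - 1) <= 2 * q%:R * \sum_(l < n) (a l.+1 + a l - 1) :> R.
  move: h2; rewrite -(ler_int R) !(rmorphM, rmorphB) /= rmorph_sum /=.
  congr (_ <= _ * _); apply: eq_bigr => l _.
  by rewrite rmorphB rmorphD.
have h3 : \sum_(l < n) (a l.+1 + a l - 1) <= n%:R * (2 * (TR + q%:R) * n.+1%:R ^+ 2 * lam ^+ n).
  rewrite mulr_natl -[X in _ *+ X]card_ord -sumr_const; apply: ler_sum => l _.
  have h k : (k <= n)%N -> a k <= (TR + q%:R) * n.+1%:R ^+ 2 * lam ^+ n.
    move=> kn; apply: le_trans (a_upper k) _.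
    have c0 : 0 <= TR + q%:R by lra.
    apply: ler_pM => //.
    - by rewrite mulr_ge0 // exprn_ge0.
    - by rewrite exprn_ge0 //; lra.
    - by rewrite ler_wpM2l // lerXn2r ?nnegrE // ler_nat.
    by rewrite ler_weXn2l.
  have := h _ (ltn_ord l); have := h _ (ltnW (ltn_ord l)); lra.
have p1 : 1 <= lam ^+ n by rewrite exprn_ege1.
have t1 : 0 <= n%:R :> R by [].
move: h2 h3 p1 t1 c2; rewrite -[n.+1%:R]natr1.
move: (\sum_(l < n) _) (lam ^+ n) n%:R (TR + q%:R) => U p t c h2 h3 p1 t1 c2.
have z : 1 <= c * (t + 1) ^+ 3 * p.
  have h1 : 1 <= c * (t + 1) ^+ 3 by have : 1 <= (t + 1) ^+ 3 by [rewrite exprn_ege1 // lerDr]; nra.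
  by rewrite mulr_ege1.
have [dn|dn] := lerP ((d n)%:R - 1) (0 : R); first by nra.
have h4 : (d n)%:R - 1 <= 2 * q%:R * U by nra.
have h5 : 2 * q%:R * U <= 4 * q%:R * c * (t * (t + 1) ^+ 2) * p by nra.
have h6 : t * (t + 1) ^+ 2 <= (t + 1) ^+ 3 by nra.
have h7 : c * (t * (t + 1) ^+ 2) * p <= c * (t + 1) ^+ 3 * p by rewrite ler_wpM2r ?ler_wpM2l //; lra.
nra.
Qed.

(** From $\ln y\le y$ at $y=\sqrt{n+2}$ follows $\ln(n+2)\le 4\sqrt{n+1}$; tripled, this is the
    constant 12 of the majorant. *)
Lemma ln_quotient_to0 (b : R) :
  (fun n : nat => (b + 3 * ln n.+2%:R) / n.+1%:R) @ \oo --> (0 : R).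
Proof.
have h : (fun n : nat => Num.sqrt (n.+1%:R^-1) : R) @ \oo --> (0 : R).
  rewrite -[X in _ --> X]sqrtr0.
  apply: (cvg_comp (@harmonic R) (@Num.sqrt R)); [exact: cvg_harmonic|exact: sqrt_continuous].
have h2 : (fun n : nat => `|b| * n.+1%:R^-1 + 12 * Num.sqrt (n.+1%:R^-1) : R) @ \oo --> (0 : R).
  have -> : (0 : R) = `|b| * 0 + 12 * 0 by rewrite !mulr0 addr0.
  apply: cvgD; apply: cvgMr => //; exact: cvg_harmonic.
apply/cvgr0Pnorm_le => e e0.
have /cvgr0Pnorm_le/(_ e e0) := h2; apply: filterS => n; apply: le_trans.
set t : R := n.+1%:R; have t1 : 1 <= t by rewrite ler1n.
have l0 : 0 <= ln n.+2%:R :> R by rewrite ln_ge0 // ler1n.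
have s0 : 0 < Num.sqrt t by rewrite sqrtr_gt0; lra.
have st : Num.sqrt t ^+ 2 = t by rewrite sqr_sqrtr //; lra.
have hln : ln n.+2%:R <= 4 * Num.sqrt t.
  have n2 : n.+2%:R = t + 1 :> R by rewrite natr1.
  have w0 : 0 < Num.sqrt (t + 1) by rewrite sqrtr_gt0; lra.
  have wt : Num.sqrt (t + 1) ^+ 2 = t + 1 by rewrite sqr_sqrtr //; lra.
  have -> : ln n.+2%:R = ln (Num.sqrt (t + 1)) *+ 2 by rewrite n2 -[in LHS]wt lnXn.
  have wl : Num.sqrt (t + 1) <= 2 * Num.sqrt t by nra.
  have := ln_sublinear w0; rewrite mulr2n; lra.
rewrite normrM [`|t^-1|]ger0_norm ?invr_ge0; last by lra.
rewrite [X in _ <= X]ger0_norm; last by rewrite addr_ge0 ?mulr_ge0 // ?sqrtr_ge0 // invr_ge0; lra.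
rewrite sqrtrV; last by lra.
have -> : (Num.sqrt t)^-1 = Num.sqrt t * t^-1 by rewrite -[X in _ * X^-1]st expr2 invfM mulrA mulfV ?mul1r // gt_eqF.
rewrite mulrA -mulrDl; apply: ler_wpM2r; first by rewrite invr_ge0; lra.
apply: le_trans (ler_normD _ _) _; rewrite lerD2l ger0_norm; lra.
Qed.

Lemma degree_root_limit : (fun n : nat => (d n)%:R `^ (n%:R)^-1 : R) @ \oo --> lam.
Proof.
have l1 := lam_ge1; have q3' := q3R.
set B := 5 * q%:R * (TR + q%:R).
have B0 : 0 < B.
  have c2 : 2 <= TR + q%:R.
    have [q3|/TR_ge2] := eqVneq q 3%N; last by lra.
    by rewrite TR3 // q3; lra.
  by rewrite mulr_gt0 //; lra.
(* The shift leaves out [n = 0], where the exponent is the default value 0 of the inverse and no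
   root is taken. *)
rewrite -(cvg_shiftS _).
apply: (@squeeze_cvgr _ _ _ _ (fun=> lam)
  (fun n : nat => expR ((ln B + 3 * ln n.+2%:R) / n.+1%:R) * lam)); last 2 first.
- exact: cvg_cst.
- have e := continuous_cvg _ (@continuous_expR R 0) (ln_quotient_to0 (ln B)).
  have := cvgM (e _) (cvg_cst lam); rewrite expR0 mul1r; apply; exact: eventually_filter.
apply: nearW => n.
have t0 : n.+1%:R != 0 :> R by rewrite pnatr_eq0.
have lroot : (lam ^+ n.+1) `^ (n.+1%:R)^-1 = lam.
  by rewrite -powR_mulrn -?powRrM ?mulfV ?powRr1 //; lra.
have lo := degree_lower n.+1; have up := degree_upper n.+1.
have p0 : 0 <= lam ^+ n.+1 by rewrite exprn_ge0 //; lra.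
apply/andP; split.
  by rewrite -[X in X <= _]lroot ge0_ler_powR ?nnegrE ?invr_ge0.
have C0 : 0 < B * n.+2%:R ^+ 3 by rewrite mulr_gt0 // exprn_gt0.
rewrite -[X in _ <= _ * X]lroot.
have -> : expR ((ln B + 3 * ln n.+2%:R) / n.+1%:R) = (B * n.+2%:R ^+ 3) `^ (n.+1%:R)^-1.
  rewrite /powR gt_eqF // lnM ?posrE ?exprn_gt0 // lnXn // mulr_natl mulrC //.
rewrite -powRM ?(ltW C0) // ge0_ler_powR ?nnegrE ?invr_ge0 // mulr_ge0 // ltW //.
Qed.

End Degrees.

(** * Roots of the quadratic polynomial *)

Local Notation toC := (real_complex R).

Lemma KpolyE (z : complex R) : (Kpoly R q).[z] = z ^+ 2 - toC TR * z + 1.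
Proof.
rewrite /Kpoly !hornerE; congr (_ - _ * _ + _).
by rewrite /TR rmorphD rmorphB !rmorphM /= !rmorph_nat; ring.
Qed.

Lemma Kpoly_max_root : max_root_modulus (Kpoly R q) lam.
Proof.
have l1 := lam_ge1; have [q3|q3] := eqVneq q 3%N.
  have -> : lam = 1 by rewrite /lam q3.
  have hT := TR3 q3; split.
    have h3 : Num.sqrt 3 ^+ 2 = 3 :> R by rewrite sqr_sqrtr.
    exists (Complex (- (2^-1)) (Num.sqrt 3 / 2)); split.
      rewrite /root KpolyE hT expr2 eq_complex /=; apply/andP; split; apply/eqP; [|by field].
      transitivity (1 / 4 - Num.sqrt 3 ^+ 2 / 4 + 2^-1 : R); first by field.
      by rewrite h3; field.
    rewrite /cmod [X in Num.sqrt X](_ : _ = 1) ?sqrtr1 //= exprMn h3; by field.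
  case=> u v; rewrite /root KpolyE hT expr2 eq_complex /cmod /= => /andP[/eqP h1 /eqP h2].
  suff -> : u ^+ 2 + v ^+ 2 = 1 by rewrite sqrtr1.
  (* The imaginary part of the equation factors. A real root is excluded because $u^2+u+1$ is
     positive, so the real part is $-1/2$ and the modulus is 1. *)
  have /eqP : v * (2 * u + 1) = 0 by rewrite -[RHS]h2; ring.
  rewrite mulf_eq0 => /orP[/eqP v0|/eqP u0].
    by exfalso; have := sqr_ge0 (u + 2^-1); move: h1; rewrite v0; nra.
  have : u = - 2^-1 by lra.
  move=> uE; move: h1; rewrite uE; nra.
have lq := lam_quad q3; have l0 : lam != 0 by rewrite gt_eqF //; lra.
have TE : TR = lam + lam^-1.
  by apply: (mulIf l0); rewrite [RHS]mulrDl mulVf // -expr2 lq; ring.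
have fE z : (Kpoly R q).[z] = (z - toC lam) * (z - toC lam^-1).
  rewrite KpolyE TE rmorphD /=.
  transitivity (z ^+ 2 - (toC lam + toC lam^-1) * z + toC lam * toC lam^-1); last by ring.
  by congr (_ + _); rewrite -rmorphM mulfV // rmorph1.
have cm t : 0 <= t -> cmod (toC t) = t.
  by move=> t0; rewrite /cmod /= expr0n addr0 sqrtr_sqr ger0_norm.
have l0' : 0 <= lam by lra.
split; first by exists (toC lam); rewrite /root fE subrr mul0r cm.
move=> z; rewrite /root fE mulf_eq0 !subr_eq0 => /orP[] /eqP ->; rewrite cm ?invr_ge0 //.
by apply: le_trans (l1); rewrite invf_le1 //; lra.
Qed.

End Growth.

(** Degrees enter through the relation [has_degree], so the limit is asserted for every sequence of
    degrees, and the existence clause keeps this from being vacuous. *)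
Theorem mainTheorem1 (R : realType) (q : nat) (hq : (3 <= q)%N) :
  exists r : R,
    max_root_modulus (Kpoly R q) r /\
    (exists d : nat -> nat, forall n, has_degree (iter_rep (Krep R q) n) (d n)) /\
    (forall d : nat -> nat,
       (forall n, has_degree (iter_rep (Krep R q) n) (d n)) ->
       (fun n : nat => (d n)%:R `^ (n%:R)^-1) @ \oo --> r).
Proof.
exists (lam R q); split; first exact: Kpoly_max_root.
split; last by move=> d hd; apply: degree_root_limit.
have [d hd] := choice (@has_degree_exists R q hq); by exists d.
Qed.
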